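(* Let $w_1,\dots,w_n$ be positive integers with $\gcd(w_1,\dots,w_n)=1$, let $d=\sum_{i=1}^n w_i$, and assume $w_i\mid d$ for all $i$. Let $1\le k\le n$ and let $\beta_1,\dots,\beta_k$ be positive integers with $\sum_{i=1}^k\beta_i w_i=d$. Consider the $1$-parameter family $\mathcal{X}\subset\mathbb{P}_{w_1,\dots,w_n}$ over $\mathbb{A}^1_{\mathbb{C}}$ (with parameter $a$) given by the polynomial $$F=\left(\sum_{i=1}^{n} x_i^{\frac{d}{w_i}}\right)+a\cdot\prod_{i=1}^{k}x_i^{\beta_i},$$ and put $\gamma:=\gcd(\beta_1w_1,\dots,\beta_kw_k)$. Then the discriminant of the family is $$V\left(a^{\frac{d}{\gamma}}+(-1)^{\frac{d}{\gamma}-1}\frac{d^{\frac{d}{\gamma}}}{\prod_{i=1}^{k}(\beta_iw_i)^{\frac{\beta_iw_i}{\gamma}}}\right)\subset\mathbb{A}^1_{\mathbb{C}}.$$ In the fibre above each of the $\frac{d}{\gamma}$ points of the discriminant there are precisely $$\frac{\gcd(w_1,\dots,w_k)}{\prod_{i=1}^k w_i}\cdot d^{k-2}\cdot\gamma$$ singularities with local equation $$\sum_{i=2}^k x_i^2+\sum_{i=k+1}^n x_i^{\frac{d}{w_i}}$$ of Milnor number $\prod_{i=k+1}^{n}\left(\frac{d}{w_i}-1\right)$, and no further singularities.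
   Context: $\mathbb{P}_{w_1,\dots,w_n}$ is the weighted projective space $(\mathbb{C}^n\setminus\{0\})/\mathbb{C}^*$, where $\lambda\in\mathbb{C}^*$ acts by $\lambda\cdot(x_1,\dots,x_n)=(\lambda^{w_1}x_1,\dots,\lambda^{w_n}x_n)$. For each $a\in\mathbb{C}$ the polynomial $F=F_a$ is weighted homogeneous of degree $d$, and the fibre over $a$ is the hypersurface $\{F_a=0\}\subset\mathbb{P}_{w_1,\dots,w_n}$. Singularities of a fibre are understood via the affine cone: a singularity of the fibre over $a$ is a point $p\in\mathbb{P}_{w_1,\dots,w_n}$ at which $\partial F_a/\partial x_1,\dots,\partial F_a/\partial x_n$ (hence, by Euler's relation, also $F_a$) all vanish. The discriminant of the family is the set of those $a\in\mathbb{A}^1_{\mathbb{C}}$ whose fibre has at least one singularity. The local equation and Milnor number of a singularity $p$ refer to the hypersurface germ in $\mathbb{C}^{n-1}$ obtained by setting equal to $1$ a coordinate that does not vanish at $p$ (e.g. $x_1=1$), at a point representing $p$; ''having a given local equation'' means equivalence of hypersurface germs up to analytic change of coordinates and multiplication by units, after moving the point to the origin. Empty products equal $1$ and empty sums equal $0$. *)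

(* Defs.v *)
From HB Require Import structures.
From mathcomp Require Import all_boot all_order all_algebra.
From mathcomp Require Import complex.
From mathcomp Require Import all_classical all_reals all_analysis.
Import numFieldNormedType.Exports.
Import Order.TTheory GRing.Theory Num.Theory.

Set Implicit Arguments.
Unset Strict Implicit.
Unset Printing Implicit Defensive.

Local Open Scope classical_set_scope.
Local Open Scope ring_scope.

(* MathComp-Analysis gives every abstract [numClosedFieldType] its norm topology,
   but not the concrete type [R[i]]; going through this alias triggers it. *)
Definition complexField (R : realType) : numClosedFieldType := R[i].

Definition partial (K : numClosedFieldType) (m : nat) (i : 'I_m)
    (f : 'rV[K]_m -> K) (x : 'rV[K]_m) : K :=
  'D_(delta_mx 0 i) f x.

(** Germs at the origin of K^m are represented by globally defined functions, of
    which only the values near [0] matter. *)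

Definition power_series_box (K : numClosedFieldType) (m : nat)
    (c : {ffun 'I_m -> nat} -> K) (x : 'rV[K]_m) (N : nat) : K :=
  \sum_(al : {ffun 'I_m -> 'I_N})
    c [ffun i => nat_of_ord (al i)] * \prod_(i < m) x 0 i ^+ al i.

(* [f] is, on some polydisc centred at 0, the sum of a power series converging
   absolutely there. Absolute convergence at (r, ..., r) is the boundedness of the
   sums of norms over boxes, and makes the order of summation irrelevant. *)
Definition analytic_at0 (K : numClosedFieldType) (m : nat)
    (f : 'rV[K]_m -> K) : Prop :=
  exists (c : {ffun 'I_m -> nat} -> K) (r M : K),
    [/\ 0 < r,
        forall N, power_series_box (fun al => `|c al|) (const_mx r) N <= M
      & forall x : 'rV[K]_m, (forall i, `|x 0 i| < r) ->
          power_series_box c x @ \oo --> f x].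

Definition analytic_map_at0 (K : numClosedFieldType) (m : nat)
    (phi : 'rV[K]_m -> 'rV[K]_m) : Prop :=
  forall i, analytic_at0 (fun x => phi x 0 i).

Definition coordinate_change (K : numClosedFieldType) (m : nat)
    (phi : 'rV[K]_m -> 'rV[K]_m) : Prop :=
  [/\ analytic_map_at0 phi, phi 0 = 0
    & exists psi : 'rV[K]_m -> 'rV[K]_m,
        [/\ analytic_map_at0 psi, psi 0 = 0,
            \forall x \near (0 : 'rV[K]_m), psi (phi x) = x
          & \forall x \near (0 : 'rV[K]_m), phi (psi x) = x]].

Definition has_local_equation (K : numClosedFieldType) (m : nat)
    (f g : 'rV[K]_m -> K) : Prop :=
  exists (phi : 'rV[K]_m -> 'rV[K]_m) (u : 'rV[K]_m -> K),
    [/\ coordinate_change phi, analytic_at0 u, u 0 != 0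
      & \forall x \near (0 : 'rV[K]_m), f (phi x) = u x * g x].

Definition jacobian_ideal (K : numClosedFieldType) (m : nat)
    (f g : 'rV[K]_m -> K) : Prop :=
  exists h : 'I_m -> 'rV[K]_m -> K,
    (forall j, analytic_at0 (h j)) /\
    \forall x \near (0 : 'rV[K]_m), g x = \sum_(j < m) h j x * partial j f x.

(* The quotient of the ring of analytic germs at 0 by the ideal generated by the
   partial derivatives of [f] has a basis of [mu] elements over K. *)
Definition is_milnor_number (K : numClosedFieldType) (m : nat)
    (f : 'rV[K]_m -> K) (mu : nat) : Prop :=
  exists e : 'I_mu -> 'rV[K]_m -> K,
    (forall i, analytic_at0 (e i)) /\
    forall g : 'rV[K]_m -> K, analytic_at0 g ->
      exists! c : 'rV[K]_mu,
        jacobian_ideal f (fun x => g x - \sum_(i < mu) c 0 i * e i x).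

Definition weighted_scale (K : numClosedFieldType) (m : nat) (w : 'I_m -> nat)
    (l : K) (x : 'rV[K]_m) : 'rV[K]_m :=
  \row_i (l ^+ w i * x 0 i).

Definition weighted_orbit (K : numClosedFieldType) (m : nat) (w : 'I_m -> nat)
    (x : 'rV[K]_m) : set 'rV[K]_m :=
  [set y | exists2 l : K, l != 0 & y = weighted_scale w l x].

(* The points of weighted projective space are the K^*-orbits themselves. *)
Definition weighted_proj (K : numClosedFieldType) (m : nat) (w : 'I_m -> nat) :
    set (set 'rV[K]_m) :=
  [set p | exists2 x : 'rV[K]_m, x != 0 & p = weighted_orbit w x].

Definition singularities (K : numClosedFieldType) (m : nat) (w : 'I_m -> nat)
    (f : 'rV[K]_m -> K) : set (set 'rV[K]_m) :=
  [set p | weighted_proj w p /\ forall x, p x -> forall i, partial i f x = 0].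

Definition family_discriminant (K : numClosedFieldType) (m : nat) (w : 'I_m -> nat)
    (F : K -> 'rV[K]_m -> K) : set K :=
  [set a | exists p, singularities w (F a) p].

(* Germ at [q] (where [q 0 j = 1]) of the hypersurface [f = 0] in the chart
   [x_j = 1], moved to the origin. The [n] local coordinates are indexed, in
   order, by the indices different from [j]. *)
Definition chart_germ (K : numClosedFieldType) (n : nat)
    (f : 'rV[K]_n.+1 -> K) (j : 'I_n.+1) (q : 'rV[K]_n.+1) : 'rV[K]_n -> K :=
  fun y => f (\row_i (if unlift j i is Some i' then q 0 i + y 0 i' else 1)).

(* Indices start at 0, so the variables x_1, ..., x_k are those with [i < k];
   the values of [beta] at the other indices play no role. *)
Definition hypersurface_family (K : numClosedFieldType) (n : nat) (w beta : 'I_n -> nat)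
    (k d : nat) (a : K) (x : 'rV[K]_n) : K :=
  \sum_(i < n) x 0 i ^+ (d %/ w i) + a * \prod_(i < n | (i < k)%N) x 0 i ^+ beta i.

(* The coordinates x_2, ..., x_(n+1) are those of K^n: the one of 0-based index
   [i] is x_(i+2), whose weight is [w (lift ord0 i)]. *)
Definition normal_form (K : numClosedFieldType) (n : nat) (w : 'I_n.+1 -> nat)
    (k d : nat) (y : 'rV[K]_n) : K :=
  \sum_(i < n | (i.+1 < k)%N) y 0 i ^+ 2
  + \sum_(i < n | (k <= i.+1)%N) y 0 i ^+ (d %/ w (lift ord0 i)).

(* Main.v *)
(** A point is singular exactly when x_i = 0 for i >= k, x_i^(d/w_i) = beta_i w_i t
    for i < k and a x^beta = - d t, for some t <> 0; on the orbit one can take t = 1.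
    The solutions with t = 1 differ by characters x_i |-> zeta^(w_i e_i) x_i, with zeta
    a primitive d-th root of unity and e in (Z/d)^k; raising x^beta to the power
    d/gamma eliminates x, and both cardinalities come from counting in (Z/d)^k.
    In a chart x_j = 1 around a singular point, and up to rescaling the coordinates,
    F is kappa (sum lam_i ((1+y_i)^D_i - 1) - (prod (1+y_i)^b_i - 1)) + sum y_i^D_i,
    where the first part has zero 1-jet and a Hessian that is a rank one perturbation
    of a diagonal matrix, of explicit square root. Its quadratic part is removed
    as in the proof of the Morse lemma: F = y A(y) y^T, and A(y) is diagonalised by
    solving a matrix equation with contracting right-hand side in the Banach algebra
    of power series with summable weighted coefficients. The Milnor number is then
    read off from partial derivatives of the form H(y) (y_l^(e_l))_l with H(0)
    invertible, whose ideal has the monomials below e as complement. *)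
Require Import Defs.
From HB Require Import structures.
From mathcomp Require Import all_boot all_order all_algebra.
From mathcomp Require Import complex.
From mathcomp Require Import all_classical all_reals all_analysis.
From mathcomp Require Import cyclic separable ring lra zify.
Import numFieldNormedType.Exports.
Import Order.TTheory GRing.Theory Num.Theory.

Local Open Scope classical_set_scope.
Local Open Scope card_scope.
Local Open Scope ring_scope.

Set Implicit Arguments.
Unset Strict Implicit.
Unset Printing Implicit Defensive.

(** The Morse change of variables is built without composing power series: analytic functions are
    only substituted into polynomials. The inverse map comes from a second equation, written in the
    target variable; uniqueness of small solutions identifies the two solutions at corresponding
    points, so that the maps are mutually inverse. The same uniqueness makes the solution matrix
    symmetric, because its transpose solves the same equation. The projection [Pi] onto the
    nondegenerate variables is carried through, so that the change fixes the other variables and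
    leaves their powers intact. Nondegeneracy rests on positivity: the numbers beta_i w_i / d are
    positive with sum 1. After rescaling, the Hessian is 1 - B, where B has rank one and its
    eigenvalue is the sum of these numbers without that of the chart coordinate, hence less than 1.
    For the count, the group of e with sum e_i beta_i w_i = 0 in Z/d has d^(k-1) gamma elements, and
    each orbit accounts for d w_1...w_k / gcd(w_1,...,w_k) of them. *)

Section ComplexNumbers.
Variable R : realType.
Local Notation K := (complexField R).
Implicit Types (x y e q : K).

(** The order on [K] compares only numbers with equal imaginary parts, so both [q] and [e] are real
    and the claim is the one over [R]. *)
Lemma complex_geometric_small q e : 0 <= q < 1 -> 0 < e -> exists n, q ^+ n <= e.
Proof.
case: q => qr qi; case: e => er ei.
rewrite lecE !ltcE /= => /andP[/andP[/eqP -> q0] /andP[_ q1]] /andP[/eqP -> e0].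
have /cvgrPdist_le /(_ _ e0) [n _ /(_ n (leqnn n))] : (GRing.exp qr : R^nat) @ \oo --> (0:R).
  by apply: cvg_expr; rewrite ger0_norm.
rewrite sub0r normrN ger0_norm ?exprn_ge0// => hn; exists n.
have -> : (Complex qr 0 : K) ^+ n = Complex (qr ^+ n) 0.
  by rewrite -[Complex qr 0]/(qr%:C%C) -rmorphXn.
by rewrite lecE /= eqxx.
Qed.

(** The intervals [u N - e N, u N + e N] meet pairwise, so the supremum of their left ends lies in
    all of them. *)
Lemma cauchy_limit_real (u e : nat -> R) :
  (forall N N', (N <= N')%N -> `|u N' - u N| <= e N) ->
  exists l, forall N, `|l - u N| <= e N.
Proof.
move=> ue.
have e0 N : 0 <= e N by apply: le_trans (normr_ge0 _) (ue N N _).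
have H N N' : u N - e N <= u N' + e N'.
  have [/ue|/ltnW/ue] := leqP N N'; rewrite ler_norml => /andP[]; have := e0 N; have := e0 N'; lra.
pose S := [set u N - e N | N in [set: nat]].
have S0 : S !=set0 by exists (u 0%N - e 0%N); exists 0%N.
have SB N' : ubound S (u N' + e N') by move=> _ [N _ <-].
exists (sup S) => N.
have h1 : sup S <= u N + e N by apply: ge_sup.
have h2 : u N - e N <= sup S.
  by apply: sup_upper_bound; [split=> //; exists (u 0%N + e 0%N) | exists N].
by rewrite ler_norml; apply/andP; split; lra.
Qed.

Lemma normC_Re_Im (a b : R) : `|Complex a b : K| <= (`|a| + `|b|)%:C%C.
Proof.
rewrite [X in `|X|](_ : _ = a%:C%C + 'i%C * b%:C%C); last first.
  by apply/eqP; rewrite eq_complex /=; apply/andP; split; apply/eqP; ring.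
apply: le_trans (ler_normD _ _) _; rewrite normrM.
rewrite [X in _ + X](_ : _ = `|b|%:C%C) ?[X in X + _](_ : _ = `|a|%:C%C) ?rmorphD//.
  by rewrite normc_def /= expr0n addr0 sqrtr_sqr.
rewrite [X in X * _](_ : _ = 1) ?mul1r; last first.
  by rewrite normc_def /= expr0n add0r expr1n sqrtr1.
by rewrite normc_def /= expr0n addr0 sqrtr_sqr.
Qed.

Lemma normC_ge_Im (z : K) : `|complex.Im z|%:C%C <= `|z|.
Proof.
rewrite normc_def lecR -sqrtr_sqr ler_wsqrtr//.
by rewrite lerDr sqr_ge0.
Qed.

Lemma complex_cauchy_limit (u e : nat -> K) :
  (forall N N', (N <= N')%N -> `|u N' - u N| <= e N) ->
  (forall d : K, 0 < d -> exists n, forall m, (n <= m)%N -> e m <= d) ->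
  exists l : K, forall N, `|l - u N| <= e N.
Proof.
move=> ue e_small.
have eR N : e N = (complex.Re (e N))%:C%C.
  have := le_trans (normr_ge0 _) (ue N N (leqnn N)).
  by case: (e N) => a b; rewrite lecE /= => /andP[/eqP -> _].
have [|lr Hr] := @cauchy_limit_real (fun N => complex.Re (u N)) (fun N => complex.Re (e N)).
  move=> N N' /ue; rewrite eR; have := normc_ge_Re (u N' - u N).
  move=> /le_trans /[apply]; rewrite lecR.
  by case: (u N') (u N) => [a b] [a' b'].
have [|li Hi] := @cauchy_limit_real (fun N => complex.Im (u N)) (fun N => complex.Re (e N)).
  move=> N N' /ue; rewrite eR; have := normC_ge_Im (u N' - u N).
  move=> /le_trans /[apply]; rewrite lecR.
  by case: (u N') (u N) => [a b] [a' b'].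
exists (Complex lr li) => N.
(* Adding the errors of the real and imaginary parts costs a factor 2; passing through a late [u m]
   with small error removes it. *)
have H2 m : `|(Complex lr li : K) - u m| <= e m *+ 2.
  have := Hr m; have := Hi m; rewrite [e m]eR /=.
  case: (u m) => a b /= h1 h2.
  apply: le_trans (normC_Re_Im _ _) _.
  by rewrite -rmorphMn /= lecR mulr2n lerD.
apply/ler_addgt0Pr => d d0.
have [n Hn] := e_small (d / 2) (divr_gt0 d0 (ltr0Sn _ _)).
pose m := maxn n N.
have -> : (Complex lr li : K) - u N = ((Complex lr li : K) - u m) + (u m - u N) by ring.
apply: le_trans (ler_normD _ _) _; rewrite addrC lerD ?ue ?leq_maxr//.
apply: le_trans (H2 m) _; have := Hn m (leq_maxl _ _).
by rewrite ler_pdivlMr// mulr_natr.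
Qed.
End ComplexNumbers.

(* The two facts on R[i] that power series need. Stating everything over an
   abstract field keeps the unifier from unfolding complex arithmetic. *)
Class complete_numfield (K : numClosedFieldType) : Prop := CompleteNumfield {
  geometric_small : forall q e : K, 0 <= q < 1 -> 0 < e -> exists n, q ^+ n <= e;
  cauchy_limit : forall u e : nat -> K,
    (forall N N', (N <= N')%N -> `|u N' - u N| <= e N) ->
    (forall d : K, 0 < d -> exists n, forall m, (n <= m)%N -> e m <= d) ->
    exists l : K, forall N, `|l - u N| <= e N }.

Lemma complexField_complete (R : realType) : complete_numfield (complexField R).
Proof. by split; [exact: complex_geometric_small | exact: complex_cauchy_limit]. Qed.

(** * Convergent power series *)

Section MultiIndices.
Variable m : nat.
Local Notation mi := {ffun 'I_m -> nat}.
Implicit Types (a b : mi).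

Definition mdeg a := (\sum_i a i)%N.
Definition madd a b : mi := [ffun i => (a i + b i)%N].
Definition msub a b : mi := [ffun i => (a i - b i)%N].
Definition munit (i : 'I_m) : mi := [ffun j => nat_of_bool (j == i)].
Definition mzero : mi := [ffun=> 0%N].
Definition mle a b := [forall i, (a i <= b i)%N].

(** The index set of [power_series_box] as a duplicate-free list, so that it can be compared with
    arbitrary finite lists of exponents. *)
Definition box N : seq mi :=
  [seq [ffun i => nat_of_ord (b i)] | b : {ffun 'I_m -> 'I_N}].

Lemma box_uniq N : uniq (box N).
Proof.
rewrite /box map_inj_uniq ?enum_uniq// => b b' /ffunP bb'.
by apply/ffunP => i; apply: val_inj; have := bb' i; rewrite !ffunE.
Qed.

Lemma mem_box N a : (a \in box N) = [forall i, (a i < N)%N].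
Proof.
apply/mapP/forallP => [[b _ ->] i|aN]; first by rewrite ffunE.
exists [ffun i => Ordinal (aN i)]; first by rewrite mem_enum.
by apply/ffunP => i; rewrite !ffunE.
Qed.

Lemma box_le N N' : (N <= N')%N -> {subset box N <= box N'}.
Proof.
move=> NN' a; rewrite !mem_box => /forallP h; apply/forallP => i.
exact: leq_trans (h i) NN'.
Qed.

Lemma mdeg_ge a i : (a i <= mdeg a)%N.
Proof. by rewrite /mdeg (bigD1 i)//= leq_addr. Qed.

Lemma mem_box_deg a : a \in box (mdeg a).+1.
Proof. by rewrite mem_box; apply/forallP => i; rewrite ltnS mdeg_ge. Qed.

Lemma notin_box_deg N a : a \notin box N -> (N <= mdeg a)%N.
Proof.
rewrite mem_box negb_forall; case/existsP => i; rewrite -leqNgt => h; apply: (leq_trans h).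
exact: mdeg_ge.
Qed.

Lemma seq_box (s : seq mi) : exists N, {subset s <= box N}.
Proof.
elim: s => [|a s [N hN]]; first by exists 0%N.
exists (maxn N (mdeg a).+1) => b; rewrite inE => /orP[/eqP ->|/hN].
  by apply: box_le (mem_box_deg a); apply: leq_maxr.
by apply: box_le; apply: leq_maxl.
Qed.

Lemma mdegD a b : mdeg (madd a b) = (mdeg a + mdeg b)%N.
Proof. by rewrite /mdeg -big_split/=; apply: eq_bigr => i _; rewrite ffunE. Qed.

Lemma mdeg_unit i : mdeg (munit i) = 1%N.
Proof.
rewrite /mdeg (bigD1 i)//= ffunE eqxx big1 ?addn0// => j /negPf ji.
by rewrite ffunE ji.
Qed.

Lemma mdeg_zero : mdeg mzero = 0%N.
Proof. by rewrite /mdeg big1// => i _; rewrite ffunE. Qed.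

Lemma mdeg_eq0 a : mdeg a = 0%N -> a = mzero.
Proof.
move=> a0; apply/ffunP => i; rewrite ffunE; apply/eqP.
by rewrite -leqn0 -a0 mdeg_ge.
Qed.

Lemma maddC a b : madd a b = madd b a.
Proof. by apply/ffunP => i; rewrite !ffunE addnC. Qed.

Lemma maddK a b : msub (madd a b) b = a.
Proof. by apply/ffunP => i; rewrite !ffunE addnK. Qed.

Lemma msubK a b : mle b a -> madd (msub a b) b = a.
Proof. by move=> /forallP h; apply/ffunP => i; rewrite !ffunE subnK. Qed.

Lemma mle_add a b : mle b (madd a b).
Proof. by apply/forallP => i; rewrite ffunE leq_addl. Qed.

Lemma madd_inj b : injective (madd ^~ b).
Proof. by move=> a a' /(congr1 (fun c => msub c b)); rewrite !maddK. Qed.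

Definition below a := [seq b <- box (mdeg a).+1 | mle b a].

Lemma mem_below a b : (b \in below a) = mle b a.
Proof.
rewrite mem_filter; case: (boolP (mle b a)) => //= /forallP ba.
rewrite mem_box; apply/forallP => i; rewrite ltnS.
exact: leq_trans (ba i) (mdeg_ge a i).
Qed.

Lemma below_uniq a : uniq (below a).
Proof. by rewrite filter_uniq// box_uniq. Qed.

Lemma mle_box N a b : mle b a -> a \in box N -> b \in box N.
Proof.
rewrite !mem_box => /forallP ba /forallP aN; apply/forallP => i.
exact: leq_ltn_trans (ba i) (aN i).
Qed.

Lemma msub_le a b : mle (msub a b) a.
Proof. by apply/forallP => i; rewrite ffunE leq_subr. Qed.

(** The substitution e = a - b turns sums over decompositions of exponents, as in a Cauchy product,
    into sums over pairs, where a product of two sums factors. *)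
Lemma big_below (V : nmodType) (G : mi -> mi -> V) (s : seq mi) N :
  uniq s -> {subset s <= box N} ->
  \sum_(a <- s) \sum_(b <- below a) G b (msub a b) =
  \sum_(p <- [seq (b, e) | b <- box N, e <- box N] | madd p.2 p.1 \in s) G p.1 p.2.
Proof.
move=> s_uniq sN.
transitivity (\sum_(p <- [seq (b, msub a b) | a <- s, b <- below a]) G p.1 p.2).
  by rewrite big_allpairs_dep.
rewrite -[RHS]big_filter; apply: perm_big; apply: uniq_perm.
- apply: allpairs_uniq_dep => //; first by move=> a _; apply: below_uniq.
  move=> [a b] [a' b'] /allpairsPdep[a1 [b1 [_ h1 [e1 e2]]]] /allpairsPdep[a2 [b2 [_ h2 [e3 e4]]]] /=.
  rewrite e1 e2 e3 e4 => -[eb es]; rewrite -eb in h2 es *.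
  rewrite !mem_below in h1 h2.
  by rewrite -(msubK h1) -(msubK h2) es.
- by rewrite filter_uniq// allpairs_uniq// ?box_uniq// => -[? ?] [? ?].
move=> [b e]; rewrite mem_filter /=.
apply/allpairsPdep/andP => [[a [b' [as_ hb [-> ->]]]]|[h /allpairsP[[b1 e1] /=[hb he [eb ee]]]]].
  rewrite mem_below in hb; rewrite msubK//; split=> //.
  apply/allpairsP; exists (b', msub a b'); split=> //=.
    exact: mle_box hb (sN _ as_).
  exact: mle_box (msub_le _ _) (sN _ as_).
exists (madd e b), b; split=> //; last by rewrite maddK.
by rewrite mem_below mle_add.
Qed.
End MultiIndices.
Arguments mzero {m}.

Lemma ler_sum_sub (K : numDomainType) (I : eqType) (s t : seq I) (F : I -> K) :
  uniq s -> {subset s <= t} -> (forall i, 0 <= F i) ->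
  \sum_(i <- s) F i <= \sum_(i <- t) F i.
Proof.
elim: s t => [|a s IH] t /=; first by move=> _ _ F0; rewrite big_nil sumr_ge0.
move=> /andP[as_ us] st F0.
have at_ : a \in t by apply: st; rewrite inE eqxx.
rewrite big_cons (perm_big _ (perm_to_rem at_)) big_cons lerD2l; apply: IH => // b bs.
have bt : b \in t by apply: st; rewrite inE bs orbT.
have := perm_mem (perm_to_rem at_) b; rewrite bt inE => /esym/orP[/eqP e|//].
by rewrite e in bs; rewrite bs in as_.
Qed.

Lemma big_sub_diff (V : zmodType) (I : eqType) (s t : seq I) (F : I -> V) :
  uniq s -> uniq t -> {subset t <= s} ->
  \sum_(i <- s) F i - \sum_(i <- t) F i = \sum_(i <- [seq i <- s | i \notin t]) F i.
Proof.
move=> us ut ts; rewrite (bigID (mem t))/=.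
have -> : \sum_(i <- s | i \in t) F i = \sum_(i <- t) F i.
  rewrite -big_filter; apply: perm_big; apply: uniq_perm => //.
    by rewrite filter_uniq.
  by move=> i; rewrite mem_filter; case: (boolP (i \in t)) => //= /ts.
by rewrite addrAC subrr add0r big_filter.
Qed.

Section PowerSeries.
Context {K : numClosedFieldType} {KC : complete_numfield K} {m : nat}.
Local Notation mi := {ffun 'I_m -> nat}.
Implicit Types (a b : mi) (c d : mi -> K) (r M t : K) (x : 'rV[K]_m) (f g : 'rV[K]_m -> K).

Definition mono x a : K := \prod_i x 0 i ^+ a i.

(** A bound on the weighted l^1 norm of the coefficients. Quantifying over all finite lists, not
    only boxes, makes it stable under any regrouping of terms. *)
Definition abs_bounded c r M :=
  forall s : seq mi, uniq s -> \sum_(a <- s) `|c a| * r ^+ mdeg a <= M.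

Definition in_disc r x := forall i, `|x 0 i| < r.

Definition sums_to c f r :=
  forall x, in_disc r x -> power_series_box c x @ \oo --> f x.

Definition expansion c f r M := abs_bounded c r M /\ sums_to c f r.

Lemma power_series_boxE c x N :
  power_series_box c x N = \sum_(a <- box m N) c a * mono x a.
Proof.
rewrite /box big_map big_enum /=; apply: eq_bigr => b _.
by congr (_ * _); apply: eq_bigr => i _; rewrite ffunE.
Qed.

Lemma monoD x a b : mono x (madd a b) = mono x a * mono x b.
Proof. by rewrite -big_split /=; apply: eq_bigr => i _; rewrite ffunE exprD. Qed.

Lemma mono_unit x i : mono x (munit i) = x 0 i.
Proof.
rewrite /mono (bigD1 i)//= ffunE eqxx expr1 big1 ?mulr1// => j /negPf ji.
by rewrite ffunE ji expr0.
Qed.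

Lemma mono0 x : mono x mzero = 1.
Proof. by rewrite /mono big1// => i _; rewrite ffunE expr0. Qed.

Lemma norm_mono_le x r a : (forall i, `|x 0 i| <= r) -> `|mono x a| <= r ^+ mdeg a.
Proof.
move=> xr; rewrite normr_prod /mdeg -prodrXr.
by apply: ler_prod => i _; rewrite normrX exprn_ge0//= lerXn2r ?nnegrE// (le_trans _ (xr i)).
Qed.

Lemma abs_bounded_ge0 c r M : abs_bounded c r M -> 0 <= M.
Proof. by move=> /(_ [::] isT); rewrite big_nil. Qed.

Lemma abs_bounded_le c r M M' : abs_bounded c r M -> M <= M' -> abs_bounded c r M'.
Proof. by move=> h MM' s us; apply: le_trans (h s us) MM'. Qed.

Lemma disc_ratio r x : 0 < r -> in_disc r x ->
  exists2 t, 0 <= t < 1 & forall i, `|x 0 i| <= t * r.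
Proof.
move=> r0 xr; pose u i := `|x 0 i| / r.
have u0 i : 0 <= u i by rewrite divr_ge0// ltW.
have u1 i : u i < 1 by rewrite ltr_pdivrMr// mul1r.
have v01 i : 0 <= 1 - u i <= 1 by rewrite subr_ge0 ltW//= gerBl.
(* A substitute for the maximum of the [u i]: the product is positive and at most each of its
   factors. *)
exists (1 - \prod_i (1 - u i)).
  rewrite subr_ge0 gtrBl prodr_gt0 ?andbT; last by move=> i _; rewrite subr_gt0.
  by apply: prodr_ile1 => i _.
move=> i; rewrite -ler_pdivrMr// -/(u i) lerBrDr -lerBrDl.
rewrite (bigD1 i)//= ler_piMr//; first by case/andP: (v01 i).
by apply: prodr_ile1 => j _.
Qed.

(** Shrinking the radius from r to t r multiplies a term of degree at least N by at most t^N. *)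
Lemma abs_bounded_tail c r M x t N (s : seq mi) :
  0 < r -> abs_bounded c r M -> 0 <= t <= 1 -> (forall i, `|x 0 i| <= t * r) ->
  uniq s -> (forall a, a \in s -> (N <= mdeg a)%N) ->
  `|\sum_(a <- s) c a * mono x a| <= M * t ^+ N.
Proof.
move=> r0 cM /andP[t0 t1] xt us sN.
apply: le_trans (ler_norm_sum _ _ _) _.
apply: (@le_trans _ _ (\sum_(a <- s) `|c a| * r ^+ mdeg a * t ^+ N)).
  rewrite big_seq [leRHS]big_seq; apply: ler_sum => a /sN Na.
  rewrite normrM -mulrA ler_wpM2l//.
  apply: le_trans (norm_mono_le a xt) _.
  rewrite exprMn mulrC ler_wpM2l ?exprn_ge0 ?(ltW r0)//.
  by rewrite ler_wiXn2l.
by rewrite -mulr_suml ler_wpM2r ?exprn_ge0// cM.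
Qed.

Lemma box_sum_diff c r M x t N (s : seq mi) :
  0 < r -> abs_bounded c r M -> 0 <= t <= 1 -> (forall i, `|x 0 i| <= t * r) ->
  uniq s -> {subset box m N <= s} ->
  `|\sum_(a <- s) c a * mono x a - \sum_(a <- box m N) c a * mono x a| <= M * t ^+ N.
Proof.
move=> r0 cM t01 xt us sN; rewrite big_sub_diff// ?box_uniq//.
apply: abs_bounded_tail cM t01 xt _ _ => //; first by rewrite filter_uniq.
by move=> a; rewrite mem_filter => /andP[/notin_box_deg].
Qed.

Lemma ratio_in_disc r x t : 0 < r -> t < 1 -> (forall i, `|x 0 i| <= t * r) -> in_disc r x.
Proof. by move=> r0 t1 xt i; apply: le_lt_trans (xt i) _; rewrite gtr_pMl. Qed.

Lemma expansion_tail c f r M x t N : 0 < r -> expansion c f r M ->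
  0 <= t < 1 -> (forall i, `|x 0 i| <= t * r) ->
  `|f x - \sum_(a <- box m N) c a * mono x a| <= M * t ^+ N.
Proof.
move=> r0 [cM cf] /andP[t0 t1] xt.
have xr := ratio_in_disc r0 t1 xt.
apply/ler_addgt0Pr => e e0.
have /cvgrPdist_le /(_ e e0) [N0 _ H] := cf x xr.
pose N' := maxn N0 N.
have := H N' (leq_maxl _ _); rewrite power_series_boxE => h.
rewrite -[X in `|X|](subrKA (\sum_(a <- box m N') c a * mono x a)) addrC.
apply: le_trans (ler_normD _ _) _; rewrite lerD//; apply: (box_sum_diff r0 cM _ xt).
- by rewrite t0 ltW.
- exact: box_uniq.
- exact/box_le/leq_maxr.
Qed.

Lemma expansion_norm_le c f r M x : 0 < r -> expansion c f r M -> in_disc r x -> `|f x| <= M.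
Proof.
move=> r0 [cM cf] xr.
apply/ler_addgt0Pr => e e0.
have /cvgrPdist_le /(_ e e0) [N _ /(_ N (leqnn N))] := cf x xr.
rewrite power_series_boxE => h.
have -> : f x = (f x - \sum_(a <- box m N) c a * mono x a) + \sum_(a <- box m N) c a * mono x a by rewrite subrK.
apply: le_trans (ler_normD _ _) _; rewrite addrC lerD//.
apply: le_trans (cM _ (box_uniq m N)); apply: le_trans (ler_norm_sum _ _ _) _.
by apply: ler_sum => a _; rewrite normrM ler_wpM2l// norm_mono_le// => i; apply: ltW.
Qed.

(** Absolute convergence makes the order of summation immaterial: it is enough to approximate [f x]
    by sums over some finite lists containing any given box. This serves when terms do not come
    naturally in boxes. *)
Lemma sums_to_intro c f r M : 0 < r -> abs_bounded c r M ->
  (forall x t, 0 <= t < 1 -> (forall i, `|x 0 i| <= t * r) -> forall N e, 0 < e ->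
    exists s, [/\ uniq s, {subset box m N <= s}
                & `|f x - \sum_(a <- s) c a * mono x a| <= e]) ->
  sums_to c f r.
Proof.
move=> r0 cM H x xr; have [t t01 xt] := disc_ratio r0 xr.
have M0 := abs_bounded_ge0 cM.
have /andP[t0 t1] := t01.
apply/cvgrPdist_le => e e0.
have M1 : 0 < M + 1 by rewrite ltr_wpDl.
have [n0 Hn0] := geometric_small t01 (divr_gt0 e0 M1).
exists n0 => // N /= Nn0; rewrite power_series_boxE.
apply: (@le_trans _ _ (M * t ^+ N)); last first.
  apply: (@le_trans _ _ ((M + 1) * t ^+ n0)); last by rewrite mulrC -ler_pdivlMr.
  by rewrite ler_pM ?exprn_ge0 ?lerDl// ler_wiXn2l// ltW.
apply/ler_addgt0Pr => d d0.
have [s [us Ns hs]] := H x t t01 xt N d d0.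
rewrite -[X in `|X|](subrKA (\sum_(a <- s) c a * mono x a)) addrC.
apply: le_trans (ler_normD _ _) _; rewrite lerD//.
by apply: box_sum_diff r0 cM _ xt us Ns; rewrite t0 ltW.
Qed.

Lemma sums_to_exists c r M : 0 < r -> abs_bounded c r M -> exists f, sums_to c f r.
Proof.
move=> r0 cM.
suff H x : exists l : K, in_disc r x -> power_series_box c x @ \oo --> l.
  have [f hf] := choice H; exists f => x; exact: hf.
have [xr|nx] := pselect (in_disc r x); last by exists 0.
have [t t01 xt] := disc_ratio r0 xr; have /andP[t0 t1] := t01.
have M0 := abs_bounded_ge0 cM.
have M1 : 0 < M + 1 by rewrite ltr_wpDl.
have small e : 0 < e -> exists n, forall N, (n <= N)%N -> M * t ^+ N <= e.
  move=> e0; have [n0 Hn0] := geometric_small t01 (divr_gt0 e0 M1).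
  exists n0 => // N /= Nn0.
  apply: (@le_trans _ _ ((M + 1) * t ^+ n0)); last by rewrite mulrC -ler_pdivlMr.
  by rewrite ler_pM ?exprn_ge0 ?lerDl// ler_wiXn2l// ltW.
have [||l hl] := @cauchy_limit _ _ (power_series_box c x) (fun N => M * t ^+ N).
- move=> N N' NN'; rewrite !power_series_boxE; apply: box_sum_diff r0 cM _ xt _ _.
  + by rewrite t0 ltW.
  + exact: box_uniq.
  + exact: box_le.
- exact: small.
exists l => _; apply/cvgrPdist_le => e /small[n hn].
by exists n => // N /= /hn; apply: le_trans.
Qed.

Lemma expansion_mono k b r : 0 < r ->
  expansion (fun a => if a == b then k else 0) (fun x => k * mono x b) r (`|k| * r ^+ mdeg b).
Proof.
move=> r0; split.
  move=> s us; have [bs|bs] := boolP (b \in s).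
    rewrite (perm_big _ (perm_to_rem bs)) big_cons /= eqxx big1_seq ?addr0//.
    move=> a /andP[_]; rewrite mem_rem_uniq// inE => /andP[/negPf -> _].
    by rewrite normr0 mul0r.
  rewrite big1_seq ?mulr_ge0 ?exprn_ge0 ?(ltW r0)// => a /andP[_ as_].
  by case: eqP => [e|]; [rewrite -e as_ in bs | rewrite normr0 mul0r].
move=> x xr; apply: cvg_near_cst; exists (mdeg b).+1 => // N /= bN.
apply/eqP; rewrite power_series_boxE.
have bs : b \in box m N by apply: box_le bN _ (mem_box_deg b).
rewrite (perm_big _ (perm_to_rem bs)) big_cons /= eqxx big1_seq ?addr0//.
move=> a /andP[_]; rewrite mem_rem_uniq ?box_uniq// inE => /andP[/negPf -> _].
by rewrite mul0r.
Qed.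

Lemma expansionD c d f g r M M' : 0 < r -> expansion c f r M -> expansion d g r M' ->
  expansion (c \+ d) (f \+ g) r (M + M').
Proof.
move=> r0 [cM cf] [dM dg]; split=> [s us|x xr].
  apply: le_trans (lerD (cM s us) (dM s us)); rewrite -big_split /=.
  apply: ler_sum => a _.
  by rewrite -mulrDl ler_wpM2r ?exprn_ge0 ?(ltW r0)// ler_normD.
have -> : power_series_box (c \+ d) x = power_series_box c x \+ power_series_box d x.
  apply/funext => N; rewrite /= !power_series_boxE -big_split /=.
  by apply: eq_bigr => a _; rewrite mulrDl.
exact: cvgD (cf x xr) (dg x xr).
Qed.

End PowerSeries.

Section PowerSeriesProduct.
Context {K : numClosedFieldType} {KC : complete_numfield K} {m : nat}.
Local Notation mi := {ffun 'I_m -> nat}.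
Implicit Types (a b : mi) (c d : mi -> K) (r M t : K) (x : 'rV[K]_m) (f g : 'rV[K]_m -> K).

Definition cauchy_product c d a := \sum_(b <- below a) c b * d (msub a b).

Lemma sum_cauchy_product c d x (s : seq mi) N :
  uniq s -> {subset s <= box m N} ->
  \sum_(a <- s) cauchy_product c d a * mono x a =
  \sum_(p <- [seq (b, e) | b <- box m N, e <- box m N] | madd p.2 p.1 \in s)
    (c p.1 * mono x p.1) * (d p.2 * mono x p.2).
Proof.
move=> us sN; rewrite -(big_below (fun b e => (c b * mono x b) * (d e * mono x e)) us sN).
apply: eq_bigr => a _; rewrite mulr_suml big_seq [RHS]big_seq.
apply: eq_bigr => b; rewrite mem_below => ba.
by rewrite mulrACA -monoD maddC msubK.
Qed.

Lemma abs_bounded_prod c d r M M' : 0 < r -> abs_bounded c r M -> abs_bounded d r M' ->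
  abs_bounded (cauchy_product c d) r (M * M').
Proof.
move=> r0 cM dM s us; have [N sN] := seq_box s.
pose C b := `|c b| * r ^+ mdeg b; pose D b := `|d b| * r ^+ mdeg b.
have C0 b : 0 <= C b by rewrite mulr_ge0 ?exprn_ge0 ?(ltW r0).
have D0 b : 0 <= D b by rewrite mulr_ge0 ?exprn_ge0 ?(ltW r0).
apply: (@le_trans _ _ (\sum_(a <- s) \sum_(b <- below a) C b * D (msub a b))).
  apply: ler_sum => a _; rewrite -ler_pdivlMr ?exprn_gt0//.
  apply: le_trans (ler_norm_sum _ _ _) _; rewrite mulr_suml big_seq [leRHS]big_seq.
  apply: ler_sum => b; rewrite mem_below => ba.
  by rewrite normrM ler_pdivlMr ?exprn_gt0// /C /D [leRHS]mulrACA -exprD -mdegD maddC msubK.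
rewrite (big_below (fun b e => C b * D e) us sN).
apply: (@le_trans _ _ (\sum_(p <- [seq (b, e) | b <- box m N, e <- box m N]) C p.1 * D p.2)).
  by rewrite [leRHS](bigID (fun p => madd p.2 p.1 \in s)) /= lerDl sumr_ge0// => p _; rewrite mulr_ge0.
rewrite big_allpairs_dep /=.
under eq_bigr => b _ do rewrite -mulr_sumr.
rewrite -mulr_suml; apply: ler_pM; rewrite ?sumr_ge0//.
  exact/cM/box_uniq.
exact/dM/box_uniq.
Qed.

Lemma expansionM c d f g r M M' : 0 < r -> expansion c f r M -> expansion d g r M' ->
  expansion (cauchy_product c d) (fun x => f x * g x) r (M * M').
Proof.
move=> r0 [cM cf] [dM dg]; split; first exact: abs_bounded_prod.
move=> x xr; have [t t01 xt] := disc_ratio r0 xr; have /andP[t0 t1] := t01.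
have M0 := abs_bounded_ge0 cM; have M'0 := abs_bounded_ge0 dM.
pose P N := power_series_box c x N * power_series_box d x N.
have PE N : P N = \sum_(p <- [seq (b, e) | b <- box m N, e <- box m N])
    (c p.1 * mono x p.1) * (d p.2 * mono x p.2).
  rewrite /P !power_series_boxE big_allpairs_dep /= mulr_suml.
  by apply: eq_bigr => b _; rewrite mulr_sumr.
have Pfg : P @ \oo --> f x * g x by apply: cvgM; [exact: cf | exact: dg].
(* The product of two box sums contains all terms of the box sum of the Cauchy product; the surplus
   pairs have total degree at least N and so gain a factor t^N. *)
have PQ N : `|P N - power_series_box (cauchy_product c d) x N| <= M * M' * t ^+ N.
  rewrite PE power_series_boxE (@sum_cauchy_product _ _ _ _ N) ?box_uniq//.
  rewrite (bigID (fun p => madd p.2 p.1 \in box m N)) /= addrAC subrr add0r.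
  apply: le_trans (ler_norm_sum _ _ _) _.
  apply: (@le_trans _ _ (\sum_(p <- [seq (b, e) | b <- box m N, e <- box m N])
      (`|c p.1| * r ^+ mdeg p.1) * (`|d p.2| * r ^+ mdeg p.2) * t ^+ N)).
    rewrite [leRHS](bigID (fun p => madd p.2 p.1 \notin box m N)) /=.
    apply: ler_wpDr.
      by apply: sumr_ge0 => p _; rewrite !mulr_ge0 ?exprn_ge0 ?(ltW r0).
    apply: ler_sum => -[b e] /= /notin_box_deg; rewrite mdegD addnC => hN.
    rewrite !normrM mulrACA [X in _ <= X * _]mulrACA -[leRHS]mulrA ler_wpM2l ?mulr_ge0//.
    apply: (@le_trans _ _ ((t * r) ^+ mdeg b * (t * r) ^+ mdeg e)).
      by apply: ler_pM => //; apply: norm_mono_le.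
    rewrite -!exprD exprMn mulrC ler_wpM2l ?exprn_ge0 ?(ltW r0)//.
    by rewrite ler_wiXn2l// ltW.
  rewrite -mulr_suml ler_wpM2r ?exprn_ge0// big_allpairs_dep /=.
  under eq_bigr => b _ do rewrite -mulr_sumr.
  rewrite -mulr_suml; apply: ler_pM; rewrite ?sumr_ge0//.
  - by move=> p _; rewrite !mulr_ge0 ?exprn_ge0 ?(ltW r0).
  - by move=> p _; rewrite !mulr_ge0 ?exprn_ge0 ?(ltW r0).
  - exact/cM/box_uniq.
  - exact/dM/box_uniq.
have MM : 0 <= M * M' by rewrite mulr_ge0.
have MM1 : 0 < M * M' + 1 by rewrite ltr_wpDl.
apply/cvgrPdist_le => e e0.
have e2 : 0 < e / 2 by rewrite divr_gt0.
have /cvgrPdist_le /(_ _ e2) [N0 _ HN0] := Pfg.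
have [n0 Hn0] := geometric_small t01 (divr_gt0 e2 MM1).
exists (maxn n0 N0) => // N /=; rewrite geq_max => /andP[nN NN].
rewrite -[X in `|X|](subrKA (P N)) [e]splitr.
apply: le_trans (ler_normD _ _) _; apply: lerD; first exact: HN0.
apply: le_trans (PQ N) _.
apply: (@le_trans _ _ ((M * M' + 1) * t ^+ n0)); last by rewrite mulrC -ler_pdivlMr.
by rewrite ler_pM ?exprn_ge0 ?lerDl// ler_wiXn2l// ltW.
Qed.

Lemma expansion_cst k r : 0 < r -> exists c, expansion c (fun=> k) r `|k|.
Proof.
move=> r0; have := expansion_mono k (@mzero m) r0; rewrite mdeg_zero expr0 mulr1.
rewrite (_ : (fun x => k * mono x mzero) = fun=> k); first by eexists; eassumption.
by apply/funext => x; rewrite mono0 mulr1.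
Qed.

Lemma expansion_coord i r : 0 < r -> exists c, expansion c (fun x => x 0 i) r r.
Proof.
move=> r0; have := expansion_mono 1 (munit i) r0; rewrite mdeg_unit expr1 normr1 mul1r.
rewrite (_ : (fun x => 1 * mono x (munit i)) = fun x => x 0 i); first by eexists; eassumption.
by apply/funext => x; rewrite mono_unit mul1r.
Qed.

(** The norm of the Banach algebra of power series at radius [r], given as a relation because only
    upper bounds are ever used. *)
Definition analytic_norm_le r f M := exists c, expansion c f r M.

(* Completeness of the weighted l^1 norm, for geometrically convergent series. *)
Lemma analytic_norm_sum (f : nat -> 'rV[K]_m -> K) r M : 0 < r -> 0 <= M ->
  (forall L, analytic_norm_le r (f L) (M / 2 ^+ L)) ->
  exists F, analytic_norm_le r F (M *+ 2) /\
    forall x, in_disc r x -> forall L, `|F x - \sum_(l < L) f l x| <= M *+ 2 / 2 ^+ L.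
Proof.
move=> r0 M0 /choice[c hc].
pose S a L := \sum_(l < L) c l a.
have two0 L : (0 : K) < 2 ^+ L by rewrite exprn_gt0.
have geo L L' : (L <= L')%N -> \sum_(L <= l < L') M / 2 ^+ l <= M *+ 2 / 2 ^+ L.
  move=> LL'; suff : \sum_(L <= l < L') M / 2 ^+ l = M *+ 2 / 2 ^+ L - M *+ 2 / 2 ^+ L'.
    by move=> ->; rewrite gerBl divr_ge0 ?mulrn_wge0// ltW.
  rewrite (telescope_sumr_eq (fun l => - (M *+ 2 / 2 ^+ l)))//; first by ring.
  move=> l _; rewrite exprS mulr2n; field.
  by rewrite gt_eqF.
have cM L (s : seq mi) L' : uniq s -> (L <= L')%N ->
    \sum_(a <- s) `|S a L' - S a L| * r ^+ mdeg a <= M *+ 2 / 2 ^+ L.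
  move=> us LL'; apply: le_trans (geo L L' LL').
  have SE a : S a L' - S a L = \sum_(L <= l < L') c l a.
    by rewrite /S -!(big_mkord xpredT (fun l => c l a)) (big_cat_nat (leq0n L) LL')/= addrAC subrr add0r.
  apply: (@le_trans _ _ (\sum_(a <- s) \sum_(L <= l < L') `|c l a| * r ^+ mdeg a)).
    apply: ler_sum => a _; rewrite SE -mulr_suml ler_wpM2r ?exprn_ge0 ?(ltW r0)//.
    exact: ler_norm_sum.
  rewrite exchange_big /=; apply: ler_sum => l _.
  by have [] := hc l => h _; apply: h.
have small e : 0 < e -> forall k : K, 0 < k -> exists n, forall L, (n <= L)%N -> M *+ 2 / 2 ^+ L / k <= e.
  move=> e0 k k0.
  have M1 : 0 < M *+ 2 + 1 by rewrite ltr_wpDl// mulrn_wge0.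
  have h01 : 0 <= (2^-1 : K) < 1 by rewrite invr_ge0 ler0n invf_lt1 ?ltr1n.
  have [n Hn] := geometric_small h01 (divr_gt0 (mulr_gt0 e0 k0) M1).
  exists n => L nL; rewrite ler_pdivrMr// -exprVn.
  apply: (@le_trans _ _ ((M *+ 2 + 1) * 2^-1 ^+ n)); last by rewrite mulrC -ler_pdivlMr.
  apply: ler_pM; rewrite ?exprn_ge0 ?mulrn_wge0 ?lerDl//.
  by apply: ler_wiXn2l => //; case/andP: h01 => [_ /ltW].
(* The limit is first taken coefficient by coefficient; the weight [r ^+ mdeg a] is divided out of
   the error. *)
have lim a : exists l : K, forall L, `|l - S a L| <= M *+ 2 / 2 ^+ L / r ^+ mdeg a.
  apply: cauchy_limit.
    move=> L L' LL'; rewrite ler_pdivlMr ?exprn_gt0//.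
    by have := cM L [:: a] L' isT LL'; rewrite big_seq1.
  by move=> e e0; apply: small; rewrite ?exprn_gt0.
have [C hC] := choice lim.
have CM L : abs_bounded (fun a => C a - S a L) r (M *+ 2 / 2 ^+ L).
  move=> s us; apply/ler_addgt0Pr => e e0.
  (* Since [s] is finite, one late partial sum approximates all its coefficients with total error at
     most e. *)
  have [n Hn] : exists n, forall L', (n <= L')%N -> \sum_(a <- s) M *+ 2 / 2 ^+ L' <= e.
    have k0 : (0 : K) < (size s).+1%:R^-1 by rewrite invr_gt0.
    have [n Hn] := small e e0 _ k0; exists n => L' nL'.
    apply: le_trans (Hn L' nL'); rewrite invrK mulr_natr big_const_seq count_predT iter_addr_0.
    by apply: ler_wpMn2l => //; rewrite divr_ge0 ?mulrn_wge0// ltW.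
  pose L' := maxn n L.
  apply: (@le_trans _ _ (\sum_(a <- s) (`|S a L' - S a L| * r ^+ mdeg a + M *+ 2 / 2 ^+ L'))).
    apply: ler_sum => a _; rewrite -ler_pdivlMr ?exprn_gt0// mulrDl mulfK ?gt_eqF ?exprn_gt0//.
    by rewrite -(subrKA (S a L')) addrC (le_trans (ler_normD _ _))// lerD.
  rewrite big_split /=; apply: lerD; first by apply: cM => //; apply: leq_maxr.
  by apply: Hn; apply: leq_maxl.
have S0 : (fun a => C a - S a 0%N) = C by apply/funext => a; rewrite /S big_ord0 subr0.
have := CM 0%N; rewrite S0 expr0 divr1 => CM0.
have [F hF] := sums_to_exists r0 CM0.
exists F; split; first by exists C.
move=> x xr L.
(* The remainder is itself an expansion with small norm, which bounds its values on the polydisc. *)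
suff : expansion (fun a => C a - S a L) (fun x => F x - \sum_(l < L) f l x) r (M *+ 2 / 2 ^+ L).
  by move=> /(expansion_norm_le r0) /(_ xr).
split; first exact: CM.
move=> {xr}x xr.
have -> : power_series_box (fun a => C a - S a L) x =
   fun N => power_series_box C x N - \sum_(l < L) power_series_box (c l) x N.
  apply/funext => N; rewrite power_series_boxE power_series_boxE.
  under [X in _ = _ - X]eq_bigr => l _ do rewrite power_series_boxE.
  rewrite exchange_big /= -sumrB; apply: eq_bigr => a _.
  by rewrite mulrBl mulr_suml.
apply: cvgB; first exact: hF.
elim: L {CM} => [|L IH].
  under eq_fun do rewrite big_ord0; rewrite big_ord0; exact: cvg_cst.
under eq_fun do rewrite big_ord_recr /=.
rewrite big_ord_recr /=; apply: (cvgD IH).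
by have [_ /(_ x xr)] := hc L.
Qed.
End PowerSeriesProduct.

(** * Analytic solutions of contracting equations *)

Section FixedPoint.
Context {K : numClosedFieldType} {KC : complete_numfield K}.

(** An abstract notion of size with the estimates of a normed algebra. It is used for germs, to make
    the iteration converge, and for numbers ([T] being [unit]), to compare solutions at a single
    point. *)
Record norm_bound (T : Type) (NB : (T -> K) -> K -> Prop) : Prop := NormBound {
  nb_le : forall f M M', NB f M -> M <= M' -> NB f M';
  nb_ge0 : forall f M, NB f M -> 0 <= M;
  nb_cst : forall k, NB (fun=> k) `|k|;
  nb_add : forall f g M M', NB f M -> NB g M' -> NB (fun t => f t + g t) (M + M');
  nb_mul : forall f g M M', NB f M -> NB g M' -> NB (fun t => f t * g t) (M * M') }.

Lemma analytic_norm_bound m (r : K) : 0 < r -> norm_bound (@analytic_norm_le K m r).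
Proof.
move=> r0; split.
- by move=> f M M' [c [cM cf]] MM'; exists c; split=> //; apply: abs_bounded_le MM'.
- by move=> f M [c [/abs_bounded_ge0]].
- by move=> k; apply: expansion_cst.
- by move=> f g M M' [c hc] [d hd]; exists (c \+ d); apply: expansionD.
- by move=> f g M M' [c hc] [d hd]; exists (cauchy_product c d); apply: expansionM.
Qed.

Lemma value_norm_bound : norm_bound (fun (f : unit -> K) M => `|f tt| <= M).
Proof.
split=> //.
- by move=> f M M'; apply: le_trans.
- by move=> f M; apply: le_trans.
- by move=> f g M M' fM gM; rewrite (le_trans (ler_normD _ _))// lerD.
- by move=> f g M M' fM gM; rewrite normrM ler_pM.
Qed.

(** Polynomial functions are generated inductively, so that estimates and substitutions can be
    proved by induction on the construction. *)
Inductive poly_fun (V : Type) : ((V -> K) -> K) -> Prop :=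
| poly_cst k : poly_fun (fun=> k)
| poly_var i : poly_fun (fun v => v i)
| poly_add p q : poly_fun p -> poly_fun q -> poly_fun (fun v => p v + q v)
| poly_mul p q : poly_fun p -> poly_fun q -> poly_fun (fun v => p v * q v).

(** On the unit ball a polynomial is bounded and Lipschitz. The constant is chosen before the
    algebra, so that one value serves for germs and for numbers alike. *)
Lemma poly_fun_bound V (p : (V -> K) -> K) : poly_fun p ->
  exists2 C, 0 <= C &
  forall T (NB : (T -> K) -> K -> Prop), norm_bound NB ->
  forall v v' : V -> T -> K, (forall i, NB (v i) 1) -> (forall i, NB (v' i) 1) ->
    NB (fun t => p (v ^~ t)) C /\
    forall d, 0 <= d -> (forall i, NB (fun t => v i t - v' i t) d) ->
      NB (fun t => p (v ^~ t) - p (v' ^~ t)) (C * d).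
Proof.
elim=> [k|i|p1 p2 _ [C1 C10 H1] _ [C2 C20 H2]|p1 p2 _ [C1 C10 H1] _ [C2 C20 H2]].
- exists `|k| => // T NB nb v v' _ _; split=> [|d d0 _]; first exact: nb_cst.
  under eq_fun do rewrite subrr.
  by apply: nb_le (nb_cst nb 0) _ => //; rewrite normr0 mulr_ge0.
- exists 1 => // T NB nb v v' v1 _; split=> // d d0 hd.
  by rewrite mul1r.
- exists (C1 + C2); rewrite ?addr_ge0// => T NB nb v v' v1 v1'; split.
    by apply: nb_add => //; [case: (H1 T NB nb v v' v1 v1') | case: (H2 T NB nb v v' v1 v1')].
  move=> d d0 hd; rewrite mulrDl.
  under eq_fun do rewrite opprD addrACA.
  by apply: nb_add => //; [apply: (H1 T NB nb v v' v1 v1').2 | apply: (H2 T NB nb v v' v1 v1').2].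
- exists (C1 * C2 *+ 2); rewrite ?mulrn_wge0 ?mulr_ge0// => T NB nb v v' v1 v1'.
  have [h1 h1'] := H1 T NB nb v v' v1 v1'; have [h2 h2'] := H2 T NB nb v v' v1 v1'.
  have [g1 _] := H1 T NB nb v' v v1' v1; have [g2 _] := H2 T NB nb v' v v1' v1.
  split.
    apply: (nb_le nb (nb_mul nb h1 h2)).
    by rewrite mulr2n lerDl mulr_ge0.
  move=> d d0 hd.
  rewrite (_ : (fun t => _) = fun t => (p1 (v ^~ t) - p1 (v' ^~ t)) * p2 (v ^~ t)
      + p1 (v' ^~ t) * (p2 (v ^~ t) - p2 (v' ^~ t))); last by apply/funext => t; ring.
  have := nb_add nb (nb_mul nb (h1' d d0 hd) h2) (nb_mul nb g1 (h2' d d0 hd)).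
  by rewrite (_ : C1 * d * C2 + C1 * (C2 * d) = C1 * C2 *+ 2 * d); last by ring.
Qed.

Variables (m : nat) (J : Type).
Implicit Types (tau p : ('I_m + J -> K) -> K).

(* The ideal of polynomials of order 1 in the variables x_i and order 2 in the
   variables z_j: those small enough to make z |-> tau(x, z) a contraction. *)
Inductive contractive : (('I_m + J -> K) -> K) -> Prop :=
| contractive0 : contractive (fun=> 0)
| contractive_x i p : poly_fun p -> contractive (fun v => v (inl i) * p v)
| contractive_zz i j p : poly_fun p -> contractive (fun v => v (inr i) * v (inr j) * p v)
| contractiveD s t : contractive s -> contractive t -> contractive (fun v => s v + t v).

Lemma contractiveM s p : contractive s -> poly_fun p -> contractive (fun v => s v * p v).
Proof.
move=> hs hp; elim: hs => [|i q hq|i j q hq|s1 s2 _ h1 _ h2].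
- by under eq_fun do rewrite mul0r; apply: contractive0.
- by under eq_fun do rewrite -mulrA; apply: contractive_x; apply: poly_mul.
- by under eq_fun do rewrite -mulrA; apply: contractive_zz; apply: poly_mul.
- by under eq_fun do rewrite mulrDl; apply: contractiveD.
Qed.

Definition env T (x : 'I_m -> T -> K) (z : J -> T -> K) (i : 'I_m + J) : T -> K :=
  match i with inl i => x i | inr j => z j end.

(** With x of size r and z of size s, such a map has size O(r + s^2) and Lipschitz constant O(r + s)
    in z. For s small and r much smaller than s it maps the ball of radius s into itself and
    contracts it. *)
Lemma contractive_bound tau : contractive tau ->
  exists2 C, 0 <= C &
  forall T (NB : (T -> K) -> K -> Prop), norm_bound NB ->
  forall r s, 0 <= r <= 1 -> 0 <= s <= 1 ->
  forall x : 'I_m -> T -> K, (forall i, NB (x i) r) ->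
  forall z : J -> T -> K, (forall j, NB (z j) s) ->
    NB (fun t => tau ((env x z) ^~ t)) (C * (r + s ^+ 2)) /\
    forall z', (forall j, NB (z' j) s) -> forall d, 0 <= d ->
      (forall j, NB (fun t => z j t - z' j t) d) ->
      NB (fun t => tau ((env x z) ^~ t) - tau ((env x z') ^~ t)) (C * (r + s) * d).
Proof.
have env1 T NB r s (nb : @norm_bound T NB) (x : 'I_m -> T -> K) (z : J -> T -> K) :
    0 <= r <= 1 -> 0 <= s <= 1 ->
    (forall i, NB (x i) r) -> (forall j, NB (z j) s) -> forall i, NB (env x z i) 1.
  move=> /andP[_ r1] /andP[_ s1] hx hz [i|j] /=; first exact: nb_le (hx i) r1.
  exact: nb_le (hz j) s1.
have envd T NB d (nb : @norm_bound T NB) (x : 'I_m -> T -> K) (z z' : J -> T -> K) :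
    0 <= d -> (forall j, NB (fun t => z j t - z' j t) d) ->
    forall i, NB (fun t => env x z i t - env x z' i t) d.
  move=> d0 hd [i|j] //=; under eq_fun do rewrite subrr.
  by apply: nb_le (nb_cst nb 0) _ => //; rewrite normr0.
elim=> [|i p hp|i j p hp|s1 s2 _ [C1 C10 H1] _ [C2 C20 H2]].
- exists 0 => // T NB nb r s _ _ x _ z _; split.
    by apply: nb_le (nb_cst nb 0) _ => //; rewrite normr0 mul0r.
  move=> z' _ d _ _; under eq_fun do rewrite subrr.
  by apply: nb_le (nb_cst nb 0) _ => //; rewrite normr0 !mul0r.
- have [C C0 H] := poly_fun_bound hp.
  exists C => // T NB nb r s r01 s01 x hx z hz.
  have /andP[r0 r1] := r01; have /andP[s0 s1] := s01.
  have v1 := env1 T NB r s nb x z r01 s01 hx hz.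
  split.
    have [h _] := H T NB nb _ _ v1 v1.
    apply: (nb_le nb (nb_mul nb (hx i) h)).
    by rewrite mulrC ler_wpM2l// lerDl exprn_ge0.
  move=> z' hz' d d0 hd.
  have v1' := env1 T NB r s nb x z' r01 s01 hx hz'.
  have [_ /(_ d d0 (envd _ _ _ nb x z z' d0 hd)) h] := H T NB nb _ _ v1 v1'.
  under eq_fun do rewrite /= -mulrBr.
  apply: (nb_le nb (nb_mul nb (hx i) h)).
  by rewrite mulrA ler_wpM2r// mulrC ler_wpM2l// lerDl.
- have [C C0 H] := poly_fun_bound hp.
  exists (C *+ 3); rewrite ?mulrn_wge0// => T NB nb r s r01 s01 x hx z hz.
  have /andP[r0 r1] := r01; have /andP[s0 s1] := s01.
  have v1 := env1 T NB r s nb x z r01 s01 hx hz.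
  split.
    have [h _] := H T NB nb _ _ v1 v1.
    apply: (nb_le nb (nb_mul nb (nb_mul nb (hz i) (hz j)) h)).
    rewrite -expr2 mulrC; apply: ler_pM; rewrite ?exprn_ge0//.
      by rewrite mulrS lerDl mulrn_wge0.
    by rewrite lerDr.
  move=> z' hz' d d0 hd.
  have v1' := env1 T NB r s nb x z' r01 s01 hx hz'.
  have [g0 _] := H T NB nb _ _ v1' v1'.
  have [_ /(_ d d0 (envd _ _ _ nb x z z' d0 hd)) h] := H T NB nb _ _ v1 v1'.
  rewrite (_ : (fun t => _) = fun t =>
      z i t * z j t * (p (env x z ^~ t) - p (env x z' ^~ t)) +
      ((z i t - z' i t) * z j t + z' i t * (z j t - z' j t)) * p (env x z' ^~ t)); last first.
    by apply/funext => t /=; ring.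
  have := nb_add nb (nb_mul nb (nb_mul nb (hz i) (hz j)) h)
     (nb_mul nb (nb_add nb (nb_mul nb (hd i) (hz j)) (nb_mul nb (hz' i) (hd j))) g0).
  move/(nb_le nb); apply.
  apply: (@le_trans _ _ (C * s * d *+ 3)).
    have -> : s * s * (C * d) + (d * s + s * d) * C = s * (C * s * d) + (C * s * d) *+ 2 by ring.
    rewrite (mulrS _ 2) lerD2r -[leRHS]mul1r ler_wpM2r// !mulr_ge0//.
  rewrite -!mulrnAl ler_wpM2r// ler_wpM2l ?mulrn_wge0// lerDr//.
- exists (C1 + C2); rewrite ?addr_ge0// => T NB nb r s r01 s01 x hx z hz.
  have [h1 h1'] := H1 T NB nb r s r01 s01 x hx z hz.
  have [h2 h2'] := H2 T NB nb r s r01 s01 x hx z hz.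
  split; first by rewrite mulrDl; apply: nb_add.
  move=> z' hz' d d0 hd; rewrite !mulrDl.
  under eq_fun do rewrite opprD addrACA.
  by apply: nb_add => //; [apply: h1' | apply: h2'].
Qed.
End FixedPoint.

Section FixedPointTheorem.
Context {K : numClosedFieldType} {KC : complete_numfield K} {m : nat} {J : finType}.
Variable tau : J -> ('I_m + J -> K) -> K.
Hypothesis tau_contractive : forall j, contractive (tau j).

Definition point (x : 'rV[K]_m) (z : J -> K) (i : 'I_m + J) : K :=
  match i with inl i => x 0 i | inr j => z j end.

Definition solves (x : 'rV[K]_m) (z : J -> K) := forall j, z j = tau j (point x z).

Lemma contraction_bounds : exists r s : K,
  [/\ 0 < r, 0 < s,
   forall z : J -> 'rV[K]_m -> K, (forall j, analytic_norm_le r (z j) s) ->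
     (forall j, analytic_norm_le r (fun x => tau j (point x (z ^~ x))) (s / 2)) /\
     forall z', (forall j, analytic_norm_le r (z' j) s) -> forall d, 0 <= d ->
       (forall j, analytic_norm_le r (fun x => z j x - z' j x) d) ->
       forall j, analytic_norm_le r
          (fun x => tau j (point x (z ^~ x)) - tau j (point x (z' ^~ x))) (d / 2)
  & forall x, in_disc r x -> forall z z' : J -> K,
     (forall j, `|z j| <= s) -> (forall j, `|z' j| <= s) ->
     forall d, 0 <= d -> (forall j, `|z j - z' j| <= d) ->
     forall j, `|tau j (point x z) - tau j (point x z')| <= d / 2].
Proof.
have /choice[C hC] j : exists C, 0 <= C /\
  forall T (NB : (T -> K) -> K -> Prop), norm_bound NB ->
  forall r s, 0 <= r <= 1 -> 0 <= s <= 1 ->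
  forall x : 'I_m -> T -> K, (forall i, NB (x i) r) ->
  forall z : J -> T -> K, (forall j, NB (z j) s) ->
    NB (fun t => tau j ((env x z) ^~ t)) (C * (r + s ^+ 2)) /\
    forall z', (forall j, NB (z' j) s) -> forall d, 0 <= d ->
      (forall j, NB (fun t => z j t - z' j t) d) ->
      NB (fun t => tau j ((env x z) ^~ t) - tau j ((env x z') ^~ t)) (C * (r + s) * d).
  by have [c c0 h] := contractive_bound (tau_contractive j); exists c.
pose D := 1 + \sum_j C j.
have CD j : C j <= D.
  rewrite /D (bigD1 j)//= addrCA lerDl addr_ge0// sumr_ge0// => i _.
  by case: (hC i).
have D1 : 1 <= D by rewrite /D lerDl sumr_ge0// => i _; case: (hC i).
have D0 : 0 < D by apply: lt_le_trans D1.
(* These radii give D s = 1/4 and D r = s/4, hence D (r + s^2) = s/2 and, as r <= s, D (r + s) <=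
   1/2. *)
pose s := (D *+ 4)^-1; pose r := s / (D *+ 4).
have D4 : 0 < D *+ 4 by rewrite pmulrn_rgt0.
have D41 : 1 <= D *+ 4 by apply: le_trans D1 _; rewrite mulrS lerDl mulrn_wge0// ltW.
have s0 : 0 < s by rewrite invr_gt0.
have r0 : 0 < r by rewrite divr_gt0.
have s1 : s <= 1 by rewrite invf_le1.
have rs : r <= s by rewrite ler_pdivrMr// ler_peMr// ltW.
have r01 : 0 <= r <= 1 by rewrite ltW// (le_trans rs).
have s01 : 0 <= s <= 1 by rewrite ltW.
have Ds : D * s = 4^-1 by rewrite /s -mulr_natr; field; rewrite gt_eqF.
have Dr : D * r = s / 4 by rewrite /r mulrCA -/s Ds.
have B1 j : C j * (r + s ^+ 2) <= s / 2.
  apply: (@le_trans _ _ (D * (r + s ^+ 2))).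
    by rewrite ler_wpM2r// addr_ge0 ?exprn_ge0// ltW.
  rewrite mulrDr Dr.
  by rewrite (_ : s / 4 + s / 4 = s / 2)//; field.
have B2 j d : 0 <= d -> C j * (r + s) * d <= d / 2.
  move=> d0; rewrite mulrC ler_wpM2l//.
  apply: (@le_trans _ _ (D * (s + s))).
    by apply: ler_pM; rewrite ?lerD2r ?addr_ge0 ?(ltW r0) ?(ltW s0)//; case: (hC j).
  by rewrite mulrDr Ds (_ : 4^-1 + 4^-1 = 2^-1 :> K)//; field.
clearbody r s D.
exists r, s; split; [exact: r0 | exact: s0 | | ].
  move=> z hz.
  have nb := @analytic_norm_bound K KC m r r0.
  pose xs (i : 'I_m) (x : 'rV[K]_m) : K := x 0 i.
  have hx i : analytic_norm_le r (xs i) r by apply: expansion_coord.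
  have envE (u : J -> 'rV[K]_m -> K) x : (fun i => env xs u i x) = point x (u ^~ x).
    by apply/funext => -[].
  split=> [j|z' hz' d d0 hd j].
    have [h _] := (hC j).2 _ _ nb r s r01 s01 _ hx z hz.
    apply: (nb_le nb) (B1 j); move: h.
    by under eq_fun do rewrite envE.
  have [_ h] := (hC j).2 _ _ nb r s r01 s01 _ hx z hz.
  move: (nb_le nb (h z' hz' d d0 hd) (B2 j d d0)).
  by under eq_fun do rewrite !envE.
move=> x xr z z' hz hz' d d0 hd j.
have [_ h] := (hC j).2 _ _ (@value_norm_bound K) r s r01 s01 (fun i _ => x 0 i) (fun i => ltW (xr i))
  (fun i _ => z i) hz.
have := h (fun i _ => z' i) hz' d d0 hd.
have pE (u : J -> K) : (fun i => env (fun i _ => x 0 i) (fun i _ => u i) i tt) = point x u.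
  by apply/funext => -[].
by rewrite !pE => /le_trans; apply; apply: B2.
Qed.

Theorem analytic_fixpoint : exists (r s : K) (z : 'rV[K]_m -> J -> K),
  [/\ 0 < r, 0 < s, forall j, analytic_norm_le r (z ^~ j) s,
      forall x, in_disc r x -> solves x (z x)
    & forall x, in_disc r x -> forall z1 z2,
        (forall j, `|z1 j| <= s) -> (forall j, `|z2 j| <= s) ->
        solves x z1 -> solves x z2 -> z1 = z2].
Proof.
have [r [s [r0 s0 H1 H2]]] := contraction_bounds.
have nb := @analytic_norm_bound K KC m r r0.
have sge0 := ltW s0.
have half01 : 0 <= (2^-1 : K) < 1 by rewrite invr_ge0 ler0n invf_lt1 ?ltr1n.
have vanish (a C : K) : 0 <= C -> (forall L, `|a| <= C / 2 ^+ L) -> a = 0.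
  move=> C0 h; apply/eqP; rewrite -normr_le0; apply/ler_addgt0Pr => e e0.
  have C1 : 0 < C + 1 by rewrite ltr_wpDl.
  have [n Hn] := geometric_small half01 (divr_gt0 e0 C1).
  rewrite add0r; apply: le_trans (h n) _; rewrite -exprVn.
  apply: (@le_trans _ _ ((C + 1) * 2^-1 ^+ n)); last by rewrite mulrC -ler_pdivlMr.
  by rewrite ler_wpM2r ?exprn_ge0 ?invr_ge0// lerDl.
(* Picard iteration from 0. The increments have norms at most s/2, s/4, ..., so the limit stays in
   the ball of radius s. *)
have [Z [Z0 ZS]] : exists Z : nat -> J -> 'rV[K]_m -> K, Z 0%N = (fun _ _ => 0) /\
    forall n, Z n.+1 = fun j x => tau j (point x (Z n ^~ x)).
  by exists (fun n => iter n (fun u j x => tau j (point x (u ^~ x))) (fun _ _ => 0)).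
have ZA n j : analytic_norm_le r (Z n j) s.
  elim: n j => [|n IH] j.
    by rewrite Z0; apply: (nb_le nb (nb_cst nb 0)); rewrite normr0.
  rewrite ZS; apply: (nb_le nb ((H1 _ IH).1 j)).
  by rewrite ler_pdivrMr// mulr_natr mulr2n lerDl.
have ZD n j : analytic_norm_le r (fun x => Z n.+1 j x - Z n j x) (s / 2 / 2 ^+ n).
  elim: n j => [|n IH] j.
    rewrite expr0 divr1; under eq_fun do rewrite Z0 subr0.
    by rewrite ZS; apply: (H1 _ (ZA 0%N)).1.
  have -> : s / 2 / 2 ^+ n.+1 = s / 2 / 2 ^+ n / 2 by rewrite exprSr invfM mulrA.
  rewrite (_ : (fun x => _) = fun x => tau j (point x (Z n.+1 ^~ x)) - tau j (point x (Z n ^~ x))).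
    2: by apply/funext => x; congr (_ - _); rewrite ZS.
  apply: (H1 _ (ZA n.+1)).2; [exact: ZA|by rewrite !divr_ge0 ?exprn_ge0|].
  by move=> i; apply: IH.
have s20 : 0 <= s / 2 by rewrite divr_ge0.
have [z hz] := choice (fun j => analytic_norm_sum r0 s20 (fun n => ZD n j)).
have s22 : s / 2 *+ 2 = s by rewrite -mulr_natr divfK ?pnatr_eq0.
have zA j : analytic_norm_le r (z j) s by rewrite -s22; apply: (hz j).1.
have zZ x : in_disc r x -> forall j L, `|z j x - Z L j x| <= s / 2 ^+ L.
  move=> xr j L; have := (hz j).2 x xr L; rewrite s22.
  have -> : \sum_(l < L) (Z l.+1 j x - Z l j x) = Z L j x => //.
  by rewrite -(big_mkord xpredT (fun l => Z l.+1 j x - Z l j x)) telescope_sumr// Z0 subr0.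
have val_le f x : analytic_norm_le r f s -> in_disc r x -> `|f x| <= s.
  by move=> [c hc]; apply: expansion_norm_le hc.
exists r, s, (fun x j => z j x); split => //.
  (* The equation is verified pointwise: [z] and its image are both close to the same iterate, with
     a total error of s / 2^L for every L. *)
  move=> x xr j; apply/eqP; rewrite -subr_eq0; apply/eqP.
  apply: (@vanish _ s) => // L.
  rewrite -(subrKA (Z L.+1 j x)).
  apply: le_trans (ler_normD _ _) _.
  have -> : s / 2 ^+ L = s / 2 ^+ L.+1 + s / 2 ^+ L / 2.
    by rewrite exprSr invfM mulrA -splitr.
  apply: lerD; first exact: zZ.
  rewrite ZS distrC; apply: H2 => //.
  - by move=> i; apply: val_le.
  - by move=> i; apply: val_le.
  - by rewrite divr_ge0 ?exprn_ge0.
  - by move=> i; apply: zZ.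
move=> x xr z1 z2 h1 h2 e1 e2; apply/funext => j.
apply/eqP; rewrite -subr_eq0; apply/eqP.
apply: (@vanish _ (s *+ 2)); first by rewrite mulrn_wge0.
move=> L; elim: L j => [|L IH] j.
  by rewrite expr0 divr1 (le_trans (ler_normB _ _))// mulr2n lerD.
rewrite e1 e2 exprSr invfM mulrA; apply: H2 => //.
by rewrite divr_ge0 ?mulrn_wge0 ?exprn_ge0.
Qed.

(** A contractive map vanishes at the origin, so the zero assignment is a small solution at x = 0,
    and uniqueness gives the value of [z] there. *)
Corollary analytic_solution : exists (r s : K) (z : 'rV[K]_m -> J -> K),
  [/\ 0 < r, 0 < s, forall j, analytic_norm_le r (z ^~ j) s /\ z 0 j = 0,
      forall x, in_disc r x -> solves x (z x)
    & forall x, in_disc r x -> forall z1 z2,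
        (forall j, `|z1 j| <= s) -> (forall j, `|z2 j| <= s) ->
        solves x z1 -> solves x z2 -> z1 = z2].
Proof.
have [r [s [z [r0 s0 zA zs zu]]]] := analytic_fixpoint.
exists r, s, z; split=> // j; split=> //.
have d0 : in_disc r (0 : 'rV[K]_m) by move=> i; rewrite mxE normr0.
suff -> : z 0 = fun=> 0 by [].
apply: (zu 0 d0) => //.
- by move=> i; have [c hc] := zA i; apply: (expansion_norm_le r0 hc d0).
- by move=> i; rewrite normr0 ltW.
- exact: zs.
move=> i.
suff h t : contractive t -> t (point 0 (fun=> 0)) = 0 by rewrite h.
elim=> [//|a p _|a b p _|t1 t2 _ h1 _ h2] /=; last by rewrite h1 h2 addr0.
  by rewrite mxE mul0r.
by rewrite !mul0r.
Qed.
End FixedPointTheorem.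

(** * Germs of analytic functions at the origin *)

Section AnalyticGerms.
Context {K : numClosedFieldType} {KC : complete_numfield K} {m : nat}.
Local Notation mi := {ffun 'I_m -> nat}.
Implicit Types (a b : mi) (c d : mi -> K) (r M t : K) (x : 'rV[K]_m) (f g : 'rV[K]_m -> K).

Lemma near0P (P : 'rV[K]_m -> Prop) :
  (\forall x \near (0 : 'rV[K]_m), P x) <->
  exists2 r : K, 0 < r & forall x, in_disc r x -> P x.
Proof.
split=> [/nbhs_ballP[r /= r0 rP]|[r r0 rP]].
  exists r => // x xr; apply: rP; split=> // i j; rewrite /ball/= ord1 mxE sub0r normrN.
  exact: xr.
apply/nbhs_ballP; exists r => //= x [_ xr]; apply: rP => i.
by have := xr 0 i; rewrite /ball/= mxE sub0r normrN.
Qed.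

Lemma in_disc_le r r' x : r <= r' -> in_disc r x -> in_disc r' x.
Proof. by move=> rr' xr i; apply: lt_le_trans (xr i) rr'. Qed.

Lemma analytic_norm_le_sub r r' f M :
  0 < r' -> r' <= r -> analytic_norm_le r f M -> analytic_norm_le r' f M.
Proof.
move=> r'0 rr' [c [cM cf]]; exists c; split=> [s us|x xr].
  apply: le_trans (cM s us); apply: ler_sum => a _; rewrite ler_wpM2l//.
  by rewrite lerXn2r// nnegrE ltW// (lt_le_trans r'0).
exact/cf/(in_disc_le rr').
Qed.

(** Every finite list of exponents lies in a box, so bounds on box sums and bounds on all finite
    sums are equivalent. *)
Lemma analytic_at0P f :
  analytic_at0 f <-> exists r M, 0 < r /\ analytic_norm_le r f M.
Proof.
split=> [[c [r [M [r0 cM cf]]]]|[r [M [r0 [c [cM cf]]]]]]; exists r, M || exists c, r, M.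
- split=> //; exists c; split=> // s us; have [N sN] := seq_box s.
  apply: le_trans (cM N); rewrite power_series_boxE.
  apply: (@le_trans _ _ (\sum_(a <- box m N) `|c a| * r ^+ mdeg a)).
    by apply: ler_sum_sub => // a; rewrite mulr_ge0// exprn_ge0// ltW.
  apply: ler_sum => a _; rewrite /mono /mdeg -prodrXr.
  by under [X in _ <= _ * X]eq_bigr => i _ do rewrite mxE.
- split=> // N; rewrite power_series_boxE.
  apply: le_trans (cM _ (box_uniq m N)).
  apply: ler_sum => a _; rewrite /mono /mdeg -prodrXr.
  by under [X in _ * X <= _]eq_bigr => i _ do rewrite mxE.
Qed.

Lemma analytic_min2 f g : analytic_at0 f -> analytic_at0 g ->
  exists r M M', [/\ 0 < r, analytic_norm_le r f M & analytic_norm_le r g M'].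
Proof.
move=> /analytic_at0P[r [M [r0 fM]]] /analytic_at0P[r' [M' [r'0 gM]]].
pose s := Num.min r r'.
have [s0 [sr sr']] : 0 < s /\ s <= r /\ s <= r'.
  rewrite /s /Num.min; case: ifPn => [/ltW rr'//|].
  by rewrite -real_leNgt ?gtr0_real// => r'r.
clearbody s; exists s, M, M'; split; first exact: s0.
  exact: analytic_norm_le_sub s0 sr fM.
exact: analytic_norm_le_sub s0 sr' gM.
Qed.

Lemma analyticD f g : analytic_at0 f -> analytic_at0 g -> analytic_at0 (fun x => f x + g x).
Proof.
move=> hf hg; have [r [M [M' [r0 fM gM]]]] := analytic_min2 hf hg.
apply/analytic_at0P; exists r, (M + M'); split=> //.
exact: (nb_add (@analytic_norm_bound K KC m r r0) fM gM).
Qed.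

Lemma analyticM f g : analytic_at0 f -> analytic_at0 g -> analytic_at0 (fun x => f x * g x).
Proof.
move=> hf hg; have [r [M [M' [r0 fM gM]]]] := analytic_min2 hf hg.
apply/analytic_at0P; exists r, (M * M'); split=> //.
exact: (nb_mul (@analytic_norm_bound K KC m r r0) fM gM).
Qed.

Lemma analytic_cst (k : K) : analytic_at0 (fun _ : 'rV[K]_m => k).
Proof.
by apply/analytic_at0P; exists 1, `|k|; split=> //; apply: expansion_cst.
Qed.

Lemma analytic_coord i : analytic_at0 (fun x : 'rV[K]_m => x 0 i).
Proof. by apply/analytic_at0P; exists 1, 1; split=> //; apply: expansion_coord. Qed.

Lemma analytic_sum (I : Type) (s : seq I) (P : pred I) (F : I -> 'rV[K]_m -> K) :
  (forall i, P i -> analytic_at0 (F i)) -> analytic_at0 (fun x => \sum_(i <- s | P i) F i x).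
Proof.
move=> hF; elim: s => [|i s IH].
  by rewrite (_ : (fun x => _) = fun=> 0); [exact: (analytic_cst 0) | apply/funext => x; rewrite big_nil].
rewrite (_ : (fun x => _) = fun x => (if P i then F i x else 0) + \sum_(j <- s | P j) F j x).
  by apply: analyticD => //; case: (P i) (@hF i) => [|_]; [exact | exact: analytic_cst].
by apply/funext => x; rewrite big_cons; case: (P i) => //; rewrite add0r.
Qed.

Lemma analytic_prod (I : Type) (s : seq I) (P : pred I) (F : I -> 'rV[K]_m -> K) :
  (forall i, P i -> analytic_at0 (F i)) -> analytic_at0 (fun x => \prod_(i <- s | P i) F i x).
Proof.
move=> hF; elim: s => [|i s IH].
  by rewrite (_ : (fun x => _) = fun=> 1); [exact: (analytic_cst 1) | apply/funext => x; rewrite big_nil].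
rewrite (_ : (fun x => _) = fun x => (if P i then F i x else 1) * \prod_(j <- s | P j) F j x).
  by apply: analyticM => //; case: (P i) (@hF i) => [|_]; [exact | exact: analytic_cst].
by apply/funext => x; rewrite big_cons; case: (P i) => //; rewrite mul1r.
Qed.

Lemma analyticX f n : analytic_at0 f -> analytic_at0 (fun x => f x ^+ n).
Proof.
move=> hf; elim: n => [|n IH]; first exact: analytic_cst.
rewrite (_ : (fun x => _) = fun x => f x * f x ^+ n); first exact: analyticM.
by apply/funext => x; rewrite exprS.
Qed.

Lemma poly_fun_analytic V (p : (V -> K) -> K) (v : V -> 'rV[K]_m -> K) :
  poly_fun p -> (forall i, analytic_at0 (v i)) -> analytic_at0 (fun x => p (v ^~ x)).
Proof.
move=> hp hv; elim: hp => [k|i|p1 p2 _ h1 _ h2|p1 p2 _ h1 _ h2] //.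
- exact: analytic_cst.
- exact: analyticD.
- exact: analyticM.
Qed.

Lemma expansion_at0 c f r M : 0 < r -> expansion c f r M -> f 0 = c mzero.
Proof.
move=> r0 cf; apply/eqP; rewrite -subr_eq0 -normr_le0.
have x0 i : `|(0 : 'rV[K]_m) 0 i| <= 0 * r by rewrite mxE normr0 mul0r.
have t01 : 0 <= (0 : K) < 1 by rewrite lexx ltr01.
(* At the origin the ratio can be taken to be 0, so the error beyond the box of the single exponent
   0 is M * 0. *)
have := expansion_tail 1 r0 cf t01 x0; rewrite expr1 mulr0.
have -> : \sum_(a <- box m 1) c a * mono 0 a = c mzero => //.
rewrite (perm_big [:: mzero]) ?big_seq1 ?mono0 ?mulr1//.
apply: uniq_perm; rewrite ?box_uniq// => a.
rewrite mem_box inE; apply/forallP/eqP => [h|-> i]; last by rewrite ffunE.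
by apply/ffunP => i; rewrite ffunE; apply/eqP; rewrite -leqn0 -ltnS.
Qed.

Lemma analytic_cvg0 f e : analytic_at0 f -> 0 < e ->
  \forall x \near (0 : 'rV[K]_m), `|f x - f 0| <= e.
Proof.
move=> /analytic_at0P[r [M [r0 [c cf]]]] e0.
have M0 : 0 <= M by case: cf => /abs_bounded_ge0.
have M1 : 0 < M + 1 by rewrite ltr_wpDl.
(* The ratio t = k / (1 + k) is below both 1 and k, so the tail bound M t is at most e. *)
pose k := e / (M + 1) ; have k0 : 0 < k by rewrite divr_gt0.
pose t := k / (1 + k).
have k1 : 0 < 1 + k by rewrite addr_gt0.
have t01 : 0 <= t < 1.
  by rewrite divr_ge0 ?(ltW k0) ?(ltW k1)//= ltr_pdivrMr// mul1r ltrDr.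
have t0 : 0 < t by rewrite divr_gt0.
apply/near0P; exists (t * r); first by rewrite mulr_gt0.
move=> x xr; have xt i : `|x 0 i| <= t * r by apply: ltW.
have := expansion_tail 1 r0 cf t01 xt; rewrite expr1.
have -> : \sum_(a <- box m 1) c a * mono x a = c mzero.
  rewrite (perm_big [:: mzero]) ?big_seq1 ?mono0 ?mulr1//.
  apply: uniq_perm; rewrite ?box_uniq// => a.
  rewrite mem_box inE; apply/forallP/eqP => [h|-> i]; last by rewrite ffunE.
  by apply/ffunP => i; rewrite ffunE; apply/eqP; rewrite -leqn0 -ltnS.
rewrite -(expansion_at0 r0 cf) => /le_trans; apply.
apply: (@le_trans _ _ ((M + 1) * k)); last by rewrite mulrC divfK ?gt_eqF.
apply: ler_pM; [exact: M0 | exact: ltW | by rewrite lerDl ler01 |].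
by rewrite /t ler_pdivrMr// ler_peMr ?lerDl// ltW.
Qed.

Lemma analytic_map_near (phi : 'rV[K]_m -> 'rV[K]_m) (P : 'rV[K]_m -> Prop) :
  analytic_map_at0 phi -> phi 0 = 0 ->
  (\forall x \near (0 : 'rV[K]_m), P x) ->
  \forall x \near (0 : 'rV[K]_m), P (phi x).
Proof.
move=> phiA phi0 /near0P[r r0 rP].
have r2 : 0 < r / 2 by rewrite divr_gt0.
have H : \forall x \near (0 : 'rV[K]_m), forall i, `|phi x 0 i| <= r / 2.
  apply: (@filter_forall _ _ (fun i x => `|phi x 0 i| <= r / 2) _ (nbhs_filter _)) => i.
  by apply: filterS (analytic_cvg0 (phiA i) r2) => x; rewrite phi0 [X in _ - X]mxE subr0.
apply: filterS H => x h; apply: rP => i; apply: le_lt_trans (h i) _.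
by rewrite ltr_pdivrMr// ltr_pMr// ltr1n.
Qed.
End AnalyticGerms.

(** * Milnor algebras with a monomial basis *)

Section CoordinateSplit.
Context {K : numClosedFieldType} {KC : complete_numfield K} {m : nat}.
Local Notation mi := {ffun 'I_m -> nat}.
Implicit Types (a b : mi) (c d : mi -> K) (r M t : K) (x : 'rV[K]_m) (f g : 'rV[K]_m -> K).

Definition zero_at (S : {pred 'I_m}) x : 'rV[K]_m := \row_j (if j \in S then 0 else x 0 j).

Lemma in_disc_zero_at S r x : 0 < r -> in_disc r x -> in_disc r (zero_at S x).
Proof. by move=> r0 xr j; rewrite mxE; case: ifP => _ //; rewrite normr0. Qed.

(** Division by a coordinate: the terms free of x_i give [f] on x_i = 0, and the others are
    divisible by x_i. Lowering exponents by one multiplies the norm bound by 1 / r. *)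
Lemma expansion_split i c f r M : 0 < r -> expansion c f r M ->
  exists g,
  [/\ expansion (fun a => if a i == 0%N then c a else 0) (fun x => f (zero_at (pred1 i) x)) r M,
      expansion (fun a => c (madd a (munit i))) g r (M / r)
    & forall x, in_disc r x -> f x = f (zero_at (pred1 i) x) + x 0 i * g x].
Proof.
move=> r0 [cM cf].
pose c0 a := if a i == 0%N then c a else 0; pose c1 a := c (madd a (munit i)).
have c0M : abs_bounded c0 r M.
  move=> s us; apply: le_trans (cM s us); apply: ler_sum => a _.
  rewrite ler_wpM2r ?exprn_ge0 ?(ltW r0)// /c0.
  by case: ifP => // _; rewrite normr0.
have c1M : abs_bounded c1 r (M / r).
  move=> s us; rewrite ler_pdivlMr// mulr_suml.
  have := cM [seq madd a (munit i) | a <- s].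
  rewrite map_inj_uniq; last exact: madd_inj.
  move=> /(_ us); rewrite big_map; apply: le_trans.
  by apply: ler_sum => a _; rewrite mdegD mdeg_unit addn1 exprSr mulrA.
have mono_zero x a : mono (zero_at (pred1 i) x) a = if a i == 0%N then mono x a else 0.
  rewrite /mono; case: eqP => [a0|/eqP a0].
    apply: eq_bigr => j _; rewrite mxE inE; case: eqP => // ->.
    by rewrite a0 !expr0.
  by rewrite (bigD1 i)//= mxE inE eqxx expr0n (negPf a0) mul0r.
have box0 x N : power_series_box c0 x N = power_series_box c (zero_at (pred1 i) x) N.
  rewrite !power_series_boxE; apply: eq_bigr => a _; rewrite mono_zero /c0.
  by case: ifP; rewrite ?mul0r ?mulr0.
have c0f : expansion c0 (fun x => f (zero_at (pred1 i) x)) r M.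
  split=> // x xr; rewrite (_ : power_series_box c0 x = power_series_box c (zero_at (pred1 i) x)).
    exact/cf/in_disc_zero_at.
  exact/funext/box0.
have [g gs] := sums_to_exists r0 c1M.
exists g; split=> // x xr.
pose h x := f (zero_at (pred1 i) x) + x 0 i * g x.
suff : sums_to c h r by move=> /(_ x xr) hs; apply: norm_cvg_unique (cf x xr) hs.
apply: (sums_to_intro r0 cM) => {xr}x t /andP[t0 t1] xt N e e0.
have xr := ratio_in_disc r0 t1 xt.
(* The two partial sums recombine into a sum over this list, which is not a box but contains one. *)
pose s N := [seq a : mi <- box m N | a i == 0%N] ++ [seq madd a (munit i) | a <- box m N].
have sE N' : \sum_(a <- s N') c a * mono x a =
    power_series_box c0 x N' + x 0 i * power_series_box c1 x N'.
  rewrite !power_series_boxE big_cat /= big_filter big_map mulr_sumr; congr (_ + _).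
    rewrite big_mkcond /=; apply: eq_bigr => a _; rewrite /c0.
    by case: ifP; rewrite ?mul0r.
  by apply: eq_bigr => a _; rewrite monoD mono_unit /c1; ring.
have : (fun N' => \sum_(a <- s N') c a * mono x a) @ \oo --> h x.
  rewrite (_ : (fun N' => _) = fun N' => power_series_box c0 x N' + x 0 i * power_series_box c1 x N').
    apply: cvgD; first by have [_ /(_ x xr)] := c0f.
    by apply: cvgM; [exact: cvg_cst | exact: gs].
  exact/funext.
move=> /cvgrPdist_le /(_ e e0) [N0 _ HN0].
pose N' := maxn N0 N; exists (s N'); split; last exact/HN0/leq_maxl.
  rewrite cat_uniq filter_uniq ?box_uniq//= map_inj_uniq ?box_uniq ?andbT; last exact: madd_inj.
  apply/hasPn => _ /mapP[a _ ->]; rewrite mem_filter !ffunE eqxx addn1.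
  by [].
move=> a aN0; have aN : a \in box m N' by apply: box_le aN0; apply: leq_maxr.
rewrite mem_cat mem_filter aN andbT.
have [//|ai] := eqVneq (a i) 0%N; apply/orP; right.
have ua : mle (munit i) a.
  by apply/forallP => j; rewrite ffunE; case: eqP => [->|//]; rewrite lt0n.
apply/mapP; exists (msub a (munit i)); last by rewrite msubK.
exact: mle_box (msub_le _ _) aN.
Qed.

(** Identity theorem, by induction on the degree: dividing by a coordinate that occurs in the
    exponent lowers it, and the quotient still vanishes, off x_i = 0 by cancellation and on it by
    continuity. *)
Lemma coefficients_zero c f r M : 0 < r -> expansion c f r M ->
  (forall x, in_disc r x -> f x = 0) -> forall a, c a = 0.
Proof.
move=> r0 + + a; move Ed : (mdeg a) => n.
elim: n => [|n IH] in a Ed c f M *.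
  move=> cf f0; rewrite (mdeg_eq0 Ed) -(expansion_at0 r0 cf) f0// => i.
  by rewrite mxE normr0.
move=> cf f0.
have [i ai] : exists i, (0 < a i)%N.
  apply/existsP; rewrite -[X in is_true X]negbK negb_exists; apply/negP => /forallP h.
  suff : mdeg a = 0%N by rewrite Ed.
  by rewrite /mdeg big1// => i _; apply/eqP; rewrite -leqn0 leqNgt h.
have [g [_ gA Hg]] := expansion_split i r0 cf.
have [g2 [_ gA2 Hg2]] := expansion_split i r0 gA.
have g0 x : in_disc r x -> x 0 i != 0 -> g x = 0.
  move=> xr xi; have := Hg x xr; rewrite !f0//; last exact: in_disc_zero_at.
  by rewrite add0r => /esym/eqP; rewrite mulf_eq0 (negPf xi) => /eqP.
have ua : mle (munit i) a.
  by apply/forallP => j; rewrite ffunE; case: eqP => [->|//].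
rewrite -(msubK ua).
apply: (IH (msub a (munit i)) _ (fun a => c (madd a (munit i))) g) => //.
- by have := congr1 (@mdeg m) (msubK ua); rewrite mdegD mdeg_unit addn1 Ed => -[].
- exact: gA.
move=> x xr; have [xi|xi] := eqVneq (x 0 i) 0; last exact: g0.
apply/eqP; rewrite -normr_le0; apply/ler_addgt0Pr => e e0; rewrite add0r.
have [M0 _] : 0 <= M / r / r /\ True by split => //; case: gA2 => /abs_bounded_ge0.
have M1 : 0 < M / r / r + 1 by rewrite ltr_wpDl.
(* The value of g at x, where x_i = 0, is the limit of its values 0 at points
   with a small nonzero i-th coordinate. *)
have [u [u0 ur ue]] : exists u, [/\ 0 < u, u < r & u * (M / r / r) <= e].
  pose v := e / (M / r / r + 1).
  have v0 : 0 < v by rewrite divr_gt0.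
  have vr : 0 < v + r by rewrite addr_gt0.
  exists (v * r / (v + r)); split.
  - exact: (divr_gt0 (mulr_gt0 v0 r0) vr).
  - by rewrite ltr_pdivrMr// mulrC ltr_pM2l// ltrDl.
  apply: (@le_trans _ _ (v * (M / r / r + 1))); last by rewrite /v divfK ?gt_eqF.
  apply: ler_pM; [exact/ltW/(divr_gt0 (mulr_gt0 v0 r0) vr) | exact: M0 | | by rewrite lerDl ler01].
  by rewrite ler_pdivrMr// ler_pM2l// lerDr ltW.
pose y : 'rV[K]_m := \row_j (if j == i then u else x 0 j).
have yr : in_disc r y by move=> j; rewrite mxE; case: ifP => // _; rewrite gtr0_norm.
have yi : y 0 i = u by rewrite mxE eqxx.
have zy : zero_at (pred1 i) y = x.
  apply/rowP => j; rewrite !mxE inE; case: eqP => // ->.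
  by rewrite xi.
have := Hg2 y yr; rewrite g0 ?yi ?gt_eqF// zy => /eqP; rewrite eq_sym addr_eq0 => /eqP ->.
rewrite normrN normrM gtr0_norm//; apply: le_trans ue.
by rewrite ler_pM2l//; apply: expansion_norm_le gA2 yr.
Qed.

(** The coordinates are set to zero one after the other; each step splits off one multiple of a
    coordinate, and f(0) remains. *)
Lemma expansion_hadamard c f r M : 0 < r -> expansion c f r M ->
  exists g : 'I_m -> 'rV[K]_m -> K, (forall i, exists M', analytic_norm_le r (g i) M') /\
    forall x, in_disc r x -> f x = f 0 + \sum_i x 0 i * g i x.
Proof.
move=> r0 cf.
suff H (s : seq 'I_m) : uniq s -> exists g : 'I_m -> 'rV[K]_m -> K,
    [/\ forall i, exists M', analytic_norm_le r (g i) M',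
        exists d, expansion d (fun x => f (zero_at (mem s) x)) r M
      & forall x, in_disc r x -> f x = f (zero_at (mem s) x) + \sum_(i <- s) x 0 i * g i x].
  have [g [gA _ Hg]] := H _ (enum_uniq 'I_m); exists g; split=> // x xr.
  rewrite Hg// big_enum; congr (f _ + _).
  by apply/rowP => j; rewrite !mxE mem_enum.
elim: s => [_|i s IH /= /andP[iNs us]].
  have z0 x : zero_at (mem [::]) x = x by apply/rowP => j; rewrite mxE.
  exists (fun _ _ => 0); split=> [i||x xr].
  - by exists `|0 : K|; apply: expansion_cst.
  - by exists c; under eq_fun do rewrite z0.
  - by rewrite z0 big_nil addr0.
have [g [gA [d dA] Hg]] := IH us.
have [h [hA hA' Hh]] := expansion_split i r0 dA.
have zz x : zero_at (mem s) (zero_at (pred1 i) x) = zero_at (mem (i :: s)) x.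
  by apply/rowP => j; rewrite !mxE !inE; case: (j \in s); rewrite ?orbT ?orbF.
exists (fun j => if j == i then h else g j); split.
- by move=> j; case: ifP => // _; exists (M / r); eexists; exact: hA'.
- eexists; move: hA; under [X in expansion _ X]eq_fun do rewrite zz.
  exact.
move=> x xr; rewrite Hg// Hh// zz big_cons eqxx addrA; congr (_ + _).
rewrite big_seq [RHS]big_seq; apply: eq_bigr => j js.
by case: eqP => // ji; rewrite -ji js in iNs.
Qed.

Lemma analytic_hadamard f : analytic_at0 f ->
  exists g : 'I_m -> 'rV[K]_m -> K, (forall i, analytic_at0 (g i)) /\
    \forall x \near (0 : 'rV[K]_m), f x = f 0 + \sum_i x 0 i * g i x.
Proof.
move=> /analytic_at0P[r [M [r0 [c cf]]]].
have [g [gA Hg]] := expansion_hadamard r0 cf.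
exists g; split=> [i|]; last by apply/near0P; exists r.
by have [M' h] := gA i; apply/analytic_at0P; exists r, M'; split.
Qed.
End CoordinateSplit.

Section MonomialMilnor.
Context {K : numClosedFieldType} {KC : complete_numfield K} {m : nat}.
Local Notation mi := {ffun 'I_m -> nat}.
Implicit Types (a b : mi) (x : 'rV[K]_m) (g h k : 'rV[K]_m -> K).

(** A relation, so that no expansion of a germ has to be chosen; [coefficients_zero] is what makes
    it single-valued. *)
Definition has_coefficient a g (v : K) :=
  exists (c : mi -> K) (r M : K), [/\ 0 < r, expansion c g r M & c a = v].

Lemma expansion_sub (c : mi -> K) g (r r' M : K) : 0 < r' -> r' <= r -> expansion c g r M -> expansion c g r' M.
Proof.
move=> r'0 rr' [cM cf]; split=> [s us|x xr].
  apply: le_trans (cM s us); apply: ler_sum => a _; rewrite ler_wpM2l//.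
  by rewrite lerXn2r// nnegrE ltW// (lt_le_trans r'0).
exact/cf/(in_disc_le rr').
Qed.

Lemma min_radius (r r' : K) : 0 < r -> 0 < r' -> exists s, [/\ 0 < s, s <= r & s <= r'].
Proof.
move=> r0 r'0; exists (Num.min r r'); rewrite /Num.min.
case: ifPn => [/ltW rr'//|].
by rewrite -real_leNgt ?gtr0_real.
Qed.

Lemma has_coefficientD a g h u v :
  has_coefficient a g u -> has_coefficient a h v -> has_coefficient a (fun x => g x + h x) (u + v).
Proof.
move=> [c [r [M [r0 cg cu]]]] [d [r' [M' [r'0 dh dv]]]].
have [s [s0 sr sr']] := min_radius r0 r'0.
exists (c \+ d), s, (M + M'); split=> //=; last by rewrite cu dv.
by apply: expansionD => //; [apply: expansion_sub cg | apply: expansion_sub dh].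
Qed.

Lemma has_coefficient_sum a (I : Type) (s : seq I) (F : I -> 'rV[K]_m -> K) (v : I -> K) :
  (forall i, has_coefficient a (F i) (v i)) ->
  has_coefficient a (fun x => \sum_(i <- s) F i x) (\sum_(i <- s) v i).
Proof.
move=> hF; elim: s => [|i s IH].
  rewrite big_nil (_ : (fun x => _) = fun=> 0); last by apply/funext => x; rewrite big_nil.
  exists (fun b => if b == mzero then 0 else 0), 1, (`|0 : K| * 1 ^+ mdeg (@mzero m)).
  split=> //; last by rewrite if_same.
  have := expansion_mono 0 (@mzero m) (@ltr01 K).
  by under [X in expansion _ X]eq_fun do rewrite mul0r.
rewrite big_cons (_ : (fun x => _) = fun x => F i x + \sum_(j <- s) F j x).
  exact: has_coefficientD.
by apply/funext => x; rewrite big_cons.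
Qed.

Lemma has_coefficient_mono a b (u : K) :
  has_coefficient a (fun x => u * mono x b) (if a == b then u else 0).
Proof.
by exists (fun a => if a == b then u else 0), 1, (`|u| * 1 ^+ mdeg b); split=> //; apply: expansion_mono.
Qed.

Definition mpow (l : 'I_m) (n : nat) : mi := [ffun j => if j == l then n else 0%N].

Lemma mono_pow x l n : mono x (mpow l n) = x 0 l ^+ n.
Proof.
rewrite /mono (bigD1 l)//= ffunE eqxx big1 ?mulr1// => j /negPf jl.
by rewrite ffunE jl expr0.
Qed.

Lemma has_coefficient_pow a l n g : analytic_at0 g -> (a l < n)%N ->
  has_coefficient a (fun x => x 0 l ^+ n * g x) 0.
Proof.
move=> /analytic_at0P[r [M [r0 [c cg]]]] an.
have := expansionM r0 (expansion_mono 1 (mpow l n) r0) cg.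
under [X in expansion _ X]eq_fun do rewrite mul1r mono_pow.
move=> h; do 3!eexists; split; [exact: r0|exact: h|].
rewrite /cauchy_product big_seq big1// => b; rewrite mem_below => /forallP /(_ l) bl.
case: eqP => [e|]; last by rewrite mul0r.
by move: bl; rewrite e ffunE eqxx leqNgt an.
Qed.

Lemma coefficient_near0 a g v : has_coefficient a g v ->
  (\forall x \near (0 : 'rV[K]_m), g x = 0) -> v = 0.
Proof.
move=> [c [r [M [r0 cg <-]]]] /near0P[r' r'0 h].
have [s [s0 sr sr']] := min_radius r0 r'0.
apply: (coefficients_zero s0 (expansion_sub s0 sr cg)) => x xs.
exact/h/(in_disc_le sr').
Qed.

Variables (f : 'rV[K]_m -> K).

Lemma jacobian_idealD g h : jacobian_ideal f g -> jacobian_ideal f h ->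
  jacobian_ideal f (fun x => g x + h x).
Proof.
move=> [u [uA Hu]] [v [vA Hv]]; exists (fun j x => u j x + v j x); split.
  by move=> j; apply: analyticD.
near=> x; rewrite (_ : g x = \sum_j u j x * partial j f x); last by near: x.
rewrite (_ : h x = \sum_j v j x * partial j f x); last by near: x.
by rewrite -big_split; apply: eq_bigr => j _; rewrite mulrDl.
Unshelve. all: by end_near. Qed.

Lemma jacobian_idealM g h : jacobian_ideal f g -> analytic_at0 h ->
  jacobian_ideal f (fun x => h x * g x).
Proof.
move=> [u [uA Hu]] hA; exists (fun j x => h x * u j x); split.
  by move=> j; apply: analyticM.
near=> x; rewrite (_ : g x = \sum_j u j x * partial j f x); last by near: x.
by rewrite mulr_sumr; apply: eq_bigr => j _; rewrite mulrA.
Unshelve. all: by end_near. Qed.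

Lemma jacobian_ideal_near g h : jacobian_ideal f g ->
  (\forall x \near (0 : 'rV[K]_m), g x = h x) -> jacobian_ideal f h.
Proof.
move=> [u [uA Hu]] gh; exists u; split=> //.
by near=> x; rewrite -(_ : g x = h x); near: x.
Unshelve. all: by end_near. Qed.

Lemma jacobian_ideal0 : jacobian_ideal f (fun=> 0).
Proof.
exists (fun _ _ => 0); split; first by move=> j; apply: analytic_cst.
by near=> x; rewrite big1// => j _; rewrite mul0r.
Unshelve. all: by end_near. Qed.

Variables (e : 'I_m -> nat).
Variables (H G : 'I_m -> 'I_m -> 'rV[K]_m -> K).
Hypothesis H_analytic : forall i l, analytic_at0 (H i l).
Hypothesis G_analytic : forall i l, analytic_at0 (G i l).
Hypothesis partial_in : \forall x \near (0 : 'rV[K]_m), forall i,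
  partial i f x = \sum_l H i l x * x 0 l ^+ e l.
Hypothesis power_in : \forall x \near (0 : 'rV[K]_m), forall l,
  \sum_i G l i x * partial i f x = x 0 l ^+ e l.

Let E := (\sum_i e i)%N.
(** The exponents strictly below [e]. The box of side [\sum_i e i] is merely a finite set large
    enough to contain them. *)
Definition monomial_basis := [seq a : mi <- box m (\sum_i e i)%N | [forall i, (a i < e i)%N]].

Lemma mem_monomial_basis a : (a \in monomial_basis) = [forall i, (a i < e i)%N].
Proof.
rewrite mem_filter; case: (boolP [forall i, (a i < e i)%N]) => //= /forallP h.
rewrite mem_box; apply/forallP => i; apply: leq_trans (h i) _.
by rewrite (bigD1 i)//= leq_addr.
Qed.

Lemma monomial_basis_uniq : uniq monomial_basis.
Proof. by rewrite filter_uniq// box_uniq. Qed.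

Lemma size_monomial_basis : size monomial_basis = (\prod_i e i)%N.
Proof.
pose F (i : 'I_m) := [pred j : 'I_E | (j < e i)%N].
have cF i : #|F i| = e i.
  have eE : (e i <= E)%N by rewrite /E (bigD1 i)//= leq_addr.
  rewrite -sum1_card (eq_bigl (fun j : 'I_E => (j < e i)%N)); last by move=> j; rewrite inE.
  by rewrite (big_ord_narrow eE) /= sum1_card card_ord.
transitivity #|family F|; last first.
  by rewrite card_family foldrE big_map big_enum; apply: eq_bigr => i _; rewrite cF.
rewrite size_filter /box count_map [RHS]cardE [in RHS]/enum_mem size_filter -!enumT.
apply: eq_count => b /=.
by apply/forallP/forallP => h i; have := h i; rewrite ?ffunE ?inE.
Qed.

Lemma power_in_jacobian l g : analytic_at0 g -> jacobian_ideal f (fun x => g x * x 0 l ^+ e l).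
Proof.
move=> gA; apply: jacobian_idealM => //; exists (G l); split=> //.
near=> x; apply/esym; move: l {gA}.
by have : forall l, \sum_i G l i x * partial i f x = x 0 l ^+ e l by near: x.
Unshelve. all: by end_near. Qed.

(** An exponent outside the basis is at least e_l in some variable l, so the monomial is a multiple
    of a power in the ideal. *)
Lemma mono_in_jacobian a g : analytic_at0 g -> a \notin monomial_basis ->
  jacobian_ideal f (fun x => mono x a * g x).
Proof.
move=> gA; rewrite mem_monomial_basis negb_forall; case/existsP => l; rewrite -leqNgt => el.
have la : mle (mpow l (e l)) a.
  by apply/forallP => j; rewrite ffunE; case: eqP => // ->.
rewrite (_ : (fun x => _) = fun x => (mono x (msub a (mpow l (e l))) * g x) * x 0 l ^+ e l).
  apply: power_in_jacobian; apply: analyticM gA.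
  by apply: analytic_prod => i _; apply: analyticX; apply: analytic_coord.
by apply/funext => x; rewrite -{1}(msubK la) monoD mono_pow mulrAC.
Qed.

Let mu := size monomial_basis.
Let bas (i : 'I_mu) x : K := mono x (nth mzero monomial_basis i).

Let reducible g := exists c : 'rV[K]_mu, jacobian_ideal f (fun x => g x - \sum_i c 0 i * bas i x).

Let reducibleD g h : reducible g -> reducible h -> reducible (fun x => g x + h x).
Proof.
move=> [c hc] [d hd]; exists (c + d).
rewrite (_ : (fun x => _) = fun x => (g x - \sum_i c 0 i * bas i x) + (h x - \sum_i d 0 i * bas i x)).
  exact: jacobian_idealD.
apply/funext => x; rewrite addrACA -opprD -big_split /=; congr (_ - _).
by apply: eq_bigr => i _; rewrite mxE mulrDl.
Qed.

Let reducible_jac g : jacobian_ideal f g -> reducible g.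
Proof.
move=> hg; exists 0; rewrite (_ : (fun x => _) = g)//.
by apply/funext => x; rewrite big1 ?subr0// => i _; rewrite mxE mul0r.
Qed.

Let reducible_sum (I : Type) (s : seq I) (F : I -> 'rV[K]_m -> K) :
  (forall i, reducible (F i)) -> reducible (fun x => \sum_(i <- s) F i x).
Proof.
move=> hF; elim: s => [|i s IH].
  rewrite (_ : (fun x => _) = fun=> 0); first exact/reducible_jac/jacobian_ideal0.
  by apply/funext => x; rewrite big_nil.
rewrite (_ : (fun x => _) = fun x => F i x + \sum_(j <- s) F j x).
  exact: reducibleD.
by apply/funext => x; rewrite big_cons.
Qed.

Let reducible_near g h : reducible g ->
  (\forall x \near (0 : 'rV[K]_m), g x = h x) -> reducible h.
Proof.
move=> [c hc] gh; exists c; apply: jacobian_ideal_near hc _.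
by near=> x; rewrite (_ : g x = h x)//; near: x.
Unshelve. all: by end_near. Qed.

Let reducible_mono a (v : K) : reducible (fun x => mono x a * v).
Proof.
have [aB|aB] := boolP (a \in monomial_basis); last first.
  by apply: reducible_jac; apply: mono_in_jacobian => //; apply: analytic_cst.
have ia : (index a monomial_basis < mu)%N by rewrite index_mem.
exists (\row_i (if i == Ordinal ia then v else 0)).
rewrite (_ : (fun x => _) = fun=> 0); first exact: jacobian_ideal0.
apply/funext => x; rewrite (bigD1 (Ordinal ia))//= mxE eqxx big1.
  by rewrite addr0 /bas nth_index// mulrC subrr.
by move=> i /negPf ni; rewrite mxE ni mul0r.
Qed.

(** Taylor expansion to finite order: Hadamard's formula raises the degree of the monomial by one
    until it exceeds E, the sum of the e_i. Then some exponent reaches e_l and the term is in the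
    ideal. The number n bounds the steps left. *)
Let reducible_order n a g : analytic_at0 g -> (E.+1 <= mdeg a + n)%N ->
  reducible (fun x => mono x a * g x).
Proof.
elim: n => [|n IH] in a g *.
  rewrite addn0 => gA aE; apply: reducible_jac; apply: mono_in_jacobian => //.
  rewrite mem_monomial_basis; apply/negP => /forallP h.
  move: aE; rewrite ltnNge => /negP; apply; apply: leq_sum => i _.
  exact: ltnW.
move=> gA aE; have [u [uA Hu]] := analytic_hadamard gA.
apply: (@reducible_near (fun x => mono x a * g 0 + \sum_i mono x (madd a (munit i)) * u i x)).
  apply: reducibleD; first exact: reducible_mono.
  apply: reducible_sum => i; apply: IH => //.
  by rewrite mdegD mdeg_unit addn1 addSnnS.
near=> x; rewrite [in RHS](_ : g x = g 0 + \sum_i x 0 i * u i x); last by near: x.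
rewrite mulrDr mulr_sumr; congr (_ + _); apply: eq_bigr => i _.
by rewrite monoD mono_unit mulrA.
Unshelve. all: by end_near. Qed.

Theorem milnor_monomial : is_milnor_number f (\prod_i e i)%N.
Proof.
rewrite -size_monomial_basis; exists bas; split.
  by move=> i; apply: analytic_prod => j _; apply: analyticX; apply: analytic_coord.
move=> g gA.
have [c hc] : reducible g.
  have := @reducible_order E.+1 mzero g gA (leq_addl _ _).
  by under [X in reducible X -> _]eq_fun do rewrite mono0 mul1r.
exists c; split=> // d hd.
have [u [uA Hu]] := jacobian_idealD hd (jacobian_idealM hc (analytic_cst (-1))).
apply/rowP => i.
pose a := nth mzero monomial_basis i.
have aB : a \in monomial_basis by apply: mem_nth.
pose k l x := \sum_j u j x * H j l x.
have kA l : analytic_at0 (k l).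
  by apply: analytic_sum => j _; apply: analyticM.
(* Two representations of [g] differ by an element of the ideal, rewritten here in terms of the
   powers x_l^(e_l). So [F] vanishes near 0, while multiples of these powers contribute nothing to
   the coefficient at a basis exponent. *)
pose F x := \sum_j (c 0 j - d 0 j) * bas j x + \sum_l x 0 l ^+ e l * (-1 * k l x).
have Fa : has_coefficient a F (c 0 i - d 0 i).
  have -> : c 0 i - d 0 i = \sum_(j < mu) (if a == nth mzero monomial_basis j then c 0 j - d 0 j else 0) + \sum_(l < m) 0.
    rewrite (bigD1 i)//= eqxx big1 ?big1 ?addr0// => j /negPf ji.
    by rewrite nth_uniq ?monomial_basis_uniq// eq_sym val_eqE ji.
  apply: has_coefficientD; apply: has_coefficient_sum => j.
    exact: has_coefficient_mono.
  apply: has_coefficient_pow.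
    by apply: analyticM => //; apply: analytic_cst.
  by move: aB; rewrite mem_monomial_basis => /forallP.
apply/eqP; rewrite -subr_eq0; apply/eqP; apply: (coefficient_near0 Fa).
near=> x.
have E1 : g x - \sum_i d 0 i * bas i x + -1 * (g x - \sum_i c 0 i * bas i x) =
    \sum_j u j x * partial j f x by near: x.
have E2 : forall i, partial i f x = \sum_l H i l x * x 0 l ^+ e l by near: x.
apply/eqP; rewrite addr_eq0; apply/eqP.
rewrite -sumrN [RHS](_ : _ = \sum_j u j x * partial j f x); last first.
  under [RHS]eq_bigr => j _ do rewrite E2 mulr_sumr.
  rewrite exchange_big /=; apply: eq_bigr => l _.
  rewrite mulN1r mulrN opprK /k mulr_sumr; apply: eq_bigr => j _; ring.
rewrite -E1.
under eq_bigr do rewrite mulrBl.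
rewrite sumrB; ring.
Unshelve. all: by end_near. Qed.
End MonomialMilnor.

(** * Closure properties of polynomial functions and contractive maps *)

Section PolyFunctions.
Context {K : numClosedFieldType} {V : Type}.
Implicit Types (p q : (V -> K) -> K).

Lemma poly_fun_ext p q : poly_fun p -> p =1 q -> poly_fun q.
Proof. by move=> hp /funext <-. Qed.

Lemma poly_fun_sum (I : Type) (s : seq I) (P : pred I) (F : I -> (V -> K) -> K) :
  (forall i, P i -> poly_fun (F i)) -> poly_fun (fun v => \sum_(i <- s | P i) F i v).
Proof.
move=> hF; elim: s => [|i s IH].
  by apply: poly_fun_ext (poly_cst V 0) _ => v; rewrite big_nil.
have [Pi|/negPf Pi] := boolP (P i).
  by apply: poly_fun_ext (poly_add (hF i Pi) IH) _ => v; rewrite big_cons Pi.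
by apply: poly_fun_ext IH _ => v; rewrite big_cons Pi.
Qed.

Lemma poly_fun_comp (W : Type) p (q : V -> (W -> K) -> K) :
  poly_fun p -> (forall i, poly_fun (q i)) -> poly_fun (fun v => p (fun i => q i v)).
Proof.
move=> hp hq; elim: hp => [k|i|p1 p2 _ h1 _ h2|p1 p2 _ h1 _ h2].
- exact: poly_cst.
- exact: hq.
- exact: poly_add.
- exact: poly_mul.
Qed.
End PolyFunctions.

(** The polynomial form of Hadamard's lemma. It shows that a polynomial without constant term lies
    in the ideal of the variables, which is how contractivity is checked. *)
Lemma poly_fun_hadamard {K : numClosedFieldType} n (p : ('I_n -> K) -> K) : poly_fun p ->
  exists2 g : 'I_n -> ('I_n -> K) -> K, (forall l, poly_fun (g l)) &
    forall v, p v = p (fun=> 0) + \sum_l v l * g l v.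
Proof.
elim=> [k|i|p1 p2 hp1 [g1 G1 H1] hp2 [g2 G2 H2]|p1 p2 hp1 [g1 G1 H1] hp2 [g2 G2 H2]].
- exists (fun _ _ => 0) => [l|v]; first exact: poly_cst.
  by rewrite big1 ?addr0// => l _; rewrite mulr0.
- exists (fun l _ => (l == i)%:R) => [l|v]; first exact: poly_cst.
  rewrite add0r (bigD1 i)//= eqxx mulr1 big1 ?addr0// => l /negPf ->.
  by rewrite mulr0.
- exists (fun l v => g1 l v + g2 l v) => [l|v]; first exact: poly_add.
  rewrite H1 H2 addrACA -big_split /=; congr (_ + _).
  by apply: eq_bigr => l _; rewrite mulrDr.
- exists (fun l v => p1 (fun=> 0) * g2 l v + g1 l v * p2 v) => [l|v].
    by apply: poly_add; apply: poly_mul => //; apply: poly_cst.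
  rewrite [in LHS]H1 mulrDl {1}H2 mulrDr -addrA; congr (_ + _).
  rewrite mulr_sumr mulr_suml -big_split /=.
  by apply: eq_bigr => l _; ring.
Qed.

Section Contractive.
Context {K : numClosedFieldType} {m : nat} {J : Type}.
Implicit Types (p q : ('I_m + J -> K) -> K).

Lemma contractive_ext p q : contractive p -> p =1 q -> contractive q.
Proof. by move=> hp /funext <-. Qed.

Lemma contractive_sum (I : Type) (s : seq I) (F : I -> ('I_m + J -> K) -> K) :
  (forall i, contractive (F i)) -> contractive (fun v => \sum_(i <- s) F i v).
Proof.
move=> hF; elim: s => [|i s IH].
  by apply: contractive_ext (contractive0 _ _) _ => v; rewrite big_nil.
by apply: contractive_ext (contractiveD (hF i) IH) _ => v; rewrite big_cons.
Qed.

Lemma contractiveMl p q : poly_fun p -> contractive q -> contractive (fun v => p v * q v).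
Proof. by move=> hp hq; apply: contractive_ext (contractiveM hq hp) _ => v; rewrite mulrC. Qed.
End Contractive.

(** * The Morse lemma *)

Section MatrixEquation.
Context {K : numClosedFieldType} {n : nat}.
Implicit Types (E N Pi : 'M[K]_n).

(** The expansion of (1 + E)(1 + N)(1 + E) = 1, solved for its linear term 2 E. The outer factors
    [Pi] force [E] to live on the range of [Pi]. *)
Definition root_equation Pi N E :=
  E = (- 2^-1) *: (Pi *m (E *m E + (1%:M + E) *m N *m (1%:M + E)) *m Pi).

Variables (Pi N E : 'M[K]_n).
Hypotheses (Pi2 : Pi *m Pi = Pi) (PiN : Pi *m N = N) (NPi : N *m Pi = N).

Lemma root_equation_supp : root_equation Pi N E -> Pi *m E = E /\ E *m Pi = E.
Proof.
move=> h; split; rewrite h.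
  by rewrite -scalemxAr !mulmxA Pi2.
by rewrite -scalemxAl -!mulmxA Pi2.
Qed.

Lemma sandwich_supp : Pi *m E = E -> E *m Pi = E ->
  Pi *m (E *m E + (1%:M + E) *m N *m (1%:M + E)) *m Pi =
  E *m E + (1%:M + E) *m N *m (1%:M + E).
Proof.
move=> PE EP; rewrite mulmxDr mulmxDl; congr (_ + _).
  by rewrite !mulmxA PE -mulmxA EP.
have h1 : Pi *m (1%:M + E) *m N = (1%:M + E) *m N.
  by rewrite mulmxDr mulmx1 PE !mulmxDl PiN mul1mx.
have h2 : N *m ((1%:M + E) *m Pi) = N *m (1%:M + E).
  by rewrite mulmxDl mul1mx EP !mulmxDr NPi mulmx1.
by rewrite !mulmxA h1 -!mulmxA h2.
Qed.

Lemma root_expand : (1%:M + E) *m (1%:M + N) *m (1%:M + E) =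
  1%:M + (2 *: E + (E *m E + (1%:M + E) *m N *m (1%:M + E))).
Proof.
have sq : (1%:M + E) *m (1%:M + E) = 1%:M + (E + E + E *m E).
  by rewrite mulmxDl mul1mx mulmxDr mulmx1 !addrA.
rewrite [_ *m (_ + N)]mulmxDr mulmx1 [LHS]mulmxDl sq scaler_nat mulr2n.
by rewrite -!addrA.
Qed.

Lemma root_equationP : Pi *m E = E -> E *m Pi = E ->
  root_equation Pi N E <-> (1%:M + E) *m (1%:M + N) *m (1%:M + E) = 1%:M.
Proof.
move=> PE EP; rewrite root_expand /root_equation sandwich_supp//.
set S := _ + _; have two0 : (2 : K) != 0 by rewrite pnatr_eq0.
split=> [->|/eqP].
  by rewrite scalerA mulrN divff// scaleN1r addNr addr0.
rewrite -subr_eq0 addrAC subrr add0r addr_eq0 => /eqP h.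
by rewrite scaleNr -scalerN -h scalerA mulVf// scale1r.
Qed.
End MatrixEquation.

Section MatrixPolynomials.
Context {K : numClosedFieldType}.

Definition mx_poly V p q (M : (V -> K) -> 'M[K]_(p, q)) := forall i j, poly_fun (fun v => M v i j).

Lemma mx_poly_cst V p q (M : 'M[K]_(p, q)) : @mx_poly V p q (fun=> M).
Proof. by move=> i j; apply: poly_cst. Qed.

Lemma mx_polyM V p q s (M : (V -> K) -> 'M[K]_(p, q)) (N : (V -> K) -> 'M[K]_(q, s)) :
  mx_poly M -> mx_poly N -> mx_poly (fun v => M v *m N v).
Proof.
move=> hM hN i j.
apply: (@poly_fun_ext K V (fun v => \sum_l M v i l * N v l j)) => [|v]; last by rewrite mxE.
by apply: poly_fun_sum => l _; apply: poly_mul.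
Qed.

Lemma mx_polyD V p q (M N : (V -> K) -> 'M[K]_(p, q)) :
  mx_poly M -> mx_poly N -> mx_poly (fun v => M v + N v).
Proof.
move=> hM hN i j; apply: poly_fun_ext (poly_add (hM i j) (hN i j)) _ => v.
by rewrite mxE.
Qed.

Context {m : nat} {J : Type}.

Definition mx_contractive p q (M : ('I_m + J -> K) -> 'M[K]_(p, q)) :=
  forall i j, contractive (fun v => M v i j).

Lemma mx_contractiveMr p q s (M : _ -> 'M[K]_(p, q)) (N : _ -> 'M[K]_(q, s)) :
  mx_contractive M -> mx_poly N -> mx_contractive (fun v => M v *m N v).
Proof.
move=> hM hN i j.
apply: (@contractive_ext K m J (fun v => \sum_l M v i l * N v l j)) => [|v]; last by rewrite mxE.
by apply: contractive_sum => l; apply: contractiveM.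
Qed.

Lemma mx_contractiveMl p q s (M : _ -> 'M[K]_(p, q)) (N : _ -> 'M[K]_(q, s)) :
  mx_poly M -> mx_contractive N -> mx_contractive (fun v => M v *m N v).
Proof.
move=> hM hN i j.
apply: (@contractive_ext K m J (fun v => \sum_l M v i l * N v l j)) => [|v]; last by rewrite mxE.
by apply: contractive_sum => l; apply: contractiveMl.
Qed.

Lemma mx_contractiveD p q (M N : _ -> 'M[K]_(p, q)) :
  mx_contractive M -> mx_contractive N -> mx_contractive (fun v => M v + N v).
Proof.
move=> hM hN i j; apply: contractive_ext (contractiveD (hM i j) (hN i j)) _ => v.
by rewrite mxE.
Qed.

Lemma mx_contractiveZ p q k (M : _ -> 'M[K]_(p, q)) :
  mx_contractive M -> mx_contractive (fun v => k *: M v).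
Proof.
move=> hM i j; apply: contractive_ext (contractiveMl (poly_cst _ k) (hM i j)) _ => v.
by rewrite mxE.
Qed.
End MatrixPolynomials.

Section MorseEquation.
Context {K : numClosedFieldType} {n : nat}.
Local Notation J := ('I_n * 'I_n)%type.
Variables (N : 'rV[K]_n -> 'M[K]_n) (Pi : 'M[K]_n) (rho : ('I_n + J -> K) -> 'M[K]_n).
Hypothesis N_poly : mx_poly (fun v : 'I_n -> K => N (\row_l v l)).
Hypothesis N0 : N 0 = 0.
Hypothesis rho_poly : mx_poly rho.

Definition unknown_mx (v : 'I_n + J -> K) : 'M[K]_n := \matrix_(i, j) v (inr (i, j)).
Definition coord_row (v : 'I_n + J -> K) : 'rV[K]_n := \row_i v (inl i).

(* On the range of Pi, U = morse_map U says (1 + U)(1 + N)(1 + U) = 1. *)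
Definition morse_map (ij : J) (v : 'I_n + J -> K) : K :=
  ((- 2^-1) *: (Pi *m (unknown_mx v *m unknown_mx v +
     (1%:M + unknown_mx v) *m N (coord_row v *m rho v) *m (1%:M + unknown_mx v)) *m Pi)) ij.1 ij.2.

Lemma unknown_mx_poly : mx_poly unknown_mx.
Proof. by move=> i j; apply: poly_fun_ext (@poly_var K _ (inr (i, j))) _ => v; rewrite mxE. Qed.

(** The square of the unknown has order two in it, and N(x rho) is divisible by coordinates of x
    because N vanishes at 0. *)
Lemma morse_map_contractive ij : contractive (morse_map ij).
Proof.
case: ij => i j; move: i j.
have oneE : mx_poly (fun v : 'I_n + J -> K => 1%:M + unknown_mx v).
  by apply: mx_polyD; [apply: mx_poly_cst | apply: unknown_mx_poly].
have U_poly l : poly_fun (fun v => (coord_row v *m rho v) 0 l).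
  apply: (@poly_fun_ext K _ (fun v => \sum_s v (inl s) * rho v s l)) => [|v].
    by apply: poly_fun_sum => s _; apply: poly_mul => //; apply: poly_var.
  by rewrite mxE; apply: eq_bigr => s _; rewrite mxE.
apply: mx_contractiveZ; apply: mx_contractiveMr; last exact: mx_poly_cst.
apply: mx_contractiveMl; first exact: mx_poly_cst.
apply: mx_contractiveD.
  move=> i j.
  apply: (@contractive_ext _ _ _ (fun v => \sum_l v (inr (i, l)) * v (inr (l, j)) * 1)) => [|v].
    by apply: contractive_sum => l; apply: contractive_zz; apply: poly_cst.
  by rewrite mxE; apply: eq_bigr => l _; rewrite !mxE mulr1.
apply: mx_contractiveMr => //; apply: mx_contractiveMl => // i j.
have [g gP Hg] := poly_fun_hadamard (N_poly i j).
apply: (@contractive_ext _ _ _ (fun v => \sum_l (coord_row v *m rho v) 0 l *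
    g l (fun l => (coord_row v *m rho v) 0 l))) => [|v].
  apply: contractive_sum => l.
  apply: (@contractive_ext _ _ _ (fun v => \sum_s v (inl s) * (rho v s l *
    g l (fun l => (coord_row v *m rho v) 0 l)))) => [|v].
    apply: contractive_sum => s; apply: contractive_x; apply: poly_mul => //.
    exact: (poly_fun_comp (gP l) U_poly).
  rewrite mxE mulr_suml; apply: eq_bigr => s _; rewrite mxE mulrA.
  by congr (_ * g l _); apply/funext => t; rewrite mxE.
have := Hg (fun l => (coord_row v *m rho v) 0 l).
have -> : \row_l (fun l => (coord_row v *m rho v) 0 l) l = coord_row v *m rho v.
  by apply/rowP => l; rewrite mxE.
have -> : \row_l (fun=> 0 : K) l = 0 :> 'rV[K]_n by apply/rowP => l; rewrite !mxE.
by rewrite N0 mxE add0r => ->.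
Qed.

Lemma morse_solves x (z : J -> K) :
  solves morse_map x z <->
  root_equation Pi (N (x *m rho (point x z))) (\matrix_(i, j) z (i, j)).
Proof.
have E1 : unknown_mx (point x z) = \matrix_(i, j) z (i, j) by apply/matrixP => i j; rewrite !mxE.
have E2 : coord_row (point x z) = x by apply/rowP => i; rewrite mxE.
rewrite /root_equation -E1; split=> [h|h [i j]].
  by apply/matrixP => i j; rewrite {1}E1 mxE h /morse_map E2.
by have := congr1 (fun M : 'M[K]_n => M i j) h; rewrite /morse_map E2 {1}E1 mxE.
Qed.
End MorseEquation.

Section MorseLemma.
Context {K : numClosedFieldType} {KC : complete_numfield K} {n : nat}.
Variables (A : 'rV[K]_n -> 'M[K]_n) (Pi P Q : 'M[K]_n).
Hypothesis A_poly : mx_poly (fun v : 'I_n -> K => A (\row_l v l)).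
Hypothesis A_sym : forall y, (A y)^T = A y.
Hypothesis A_supp : forall y, Pi *m A y *m Pi = A y.
Hypotheses (Pi2 : Pi *m Pi = Pi) (Pi_sym : Pi^T = Pi).
Hypotheses (PQ : P *m Q = 1%:M) (PiP : Pi *m P = P *m Pi).
Hypothesis P_id : P *m (1%:M - Pi) = 1%:M - Pi.
Hypothesis PAP : P *m A 0 *m P^T = Pi.

(** The defect of the quadratic form from its normal form [Pi], read in the coordinates v with y = v
    P that diagonalise A(0). *)
Let N v := P *m A (v *m P) *m P^T - Pi.

Let N_poly : mx_poly (fun v : 'I_n -> K => N (\row_l v l)).
Proof.
apply: mx_polyD; last exact: mx_poly_cst.
apply: mx_polyM; last exact: mx_poly_cst.
apply: mx_polyM; first exact: mx_poly_cst.
move=> i j; pose q l (v : 'I_n -> K) := \sum_s v s * P s l.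
have qP l : poly_fun (q l).
  by apply: poly_fun_sum => s _; apply: poly_mul; [apply: poly_var | apply: poly_cst].
apply: poly_fun_ext (poly_fun_comp (A_poly i j) qP) _ => v /=.
congr (A _ i j); apply/rowP => l; rewrite !mxE.
by apply: eq_bigr => s _; rewrite mxE.
Qed.

Let N0 : N 0 = 0.
Proof. by rewrite /N mul0mx PAP subrr. Qed.

Let N_sym v : (N v)^T = N v.
Proof. by rewrite /N linearB /= !trmx_mul trmxK A_sym Pi_sym mulmxA. Qed.

Let PiPT : P^T *m Pi = Pi *m P^T.
Proof. by rewrite -{1}Pi_sym -trmx_mul PiP trmx_mul Pi_sym. Qed.

Let PiA y : Pi *m A y = A y.
Proof. by rewrite -A_supp !mulmxA Pi2. Qed.

Let APi y : A y *m Pi = A y.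
Proof. by rewrite -A_supp -!mulmxA Pi2. Qed.

Let PiN v : Pi *m N v = N v.
Proof. by rewrite /N mulmxBr Pi2 !mulmxA PiP -(mulmxA P Pi) PiA. Qed.

Let NPi v : N v *m Pi = N v.
Proof. by rewrite /N mulmxBl Pi2 -!mulmxA PiPT (mulmxA (A _)) APi. Qed.

Let zmx (z : 'I_n * 'I_n -> K) : 'M[K]_n := \matrix_(i, j) z (i, j).

(** Two forms of the same matrix equation: in the source variable x, with N taken at x (1 + U), and
    in the target variable y, with N taken at y Q. They agree when y = x (1 + U) P. *)
Let rho1 (v : 'I_n + 'I_n * 'I_n -> K) : 'M[K]_n := 1%:M + unknown_mx v.
Let rho2 (v : 'I_n + 'I_n * 'I_n -> K) : 'M[K]_n := Q.

Let unknown_point x z : unknown_mx (point x z) = zmx z.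
Proof. by apply/matrixP => i j; rewrite !mxE. Qed.

Let norm_val_le (f : 'rV[K]_n -> K) (r s : K) (x : 'rV[K]_n) : 0 < r -> analytic_norm_le r f s -> in_disc r x -> `|f x| <= s.
Proof. by move=> r0 [c hc]; apply: expansion_norm_le hc. Qed.

Let analytic_mx p (F : 'rV[K]_n -> 'M[K]_(p, n)) (M : 'rV[K]_n -> 'M[K]_n) :
  (forall i j, analytic_at0 (fun x => F x i j)) -> (forall i j, analytic_at0 (fun x => M x i j)) ->
  forall i j, analytic_at0 (fun x => (F x *m M x) i j).
Proof.
move=> hF hM i j; under eq_fun do rewrite mxE.
by apply: analytic_sum => l _; apply: analyticM.
Qed.

Theorem morse_lemma : exists phi : 'rV[K]_n -> 'rV[K]_n,
  coordinate_change phi /\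
  \forall x \near (0 : 'rV[K]_n),
    phi x *m A (phi x) *m (phi x)^T = x *m Pi *m x^T /\
    phi x *m (1%:M - Pi) = x *m (1%:M - Pi).
Proof.
have rho1P : mx_poly rho1.
  by apply: mx_polyD; [apply: mx_poly_cst | apply: unknown_mx_poly].
have rho2P : mx_poly rho2 by apply: mx_poly_cst.
have [r1 [s1 [z1 [r10 s10 z1A z1S z1U]]]] := analytic_solution (morse_map_contractive Pi N_poly N0 rho1P).
have [r2 [s2 [z2 [r20 s20 z2A z2S z2U]]]] := analytic_solution (morse_map_contractive Pi N_poly N0 rho2P).
pose Rm x := 1%:M + zmx (z1 x); pose W y := 1%:M + zmx (z2 y).
pose phi x := x *m Rm x *m P.
(* From R (1 + N) R = 1 the inverse of R is R (1 + N), so [psi] is analytic without inverting a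
   matrix of functions. *)
pose psi y := y *m Q *m W y *m (1%:M + N (y *m Q)).
have QP : Q *m P = 1%:M by apply: mulmx1C.
have z1an i j : analytic_at0 (fun x => z1 x (i, j)).
  by apply/analytic_at0P; exists r1, s1; split=> //; case: (z1A (i, j)).
have z2an i j : analytic_at0 (fun x => z2 x (i, j)).
  by apply/analytic_at0P; exists r2, s2; split=> //; case: (z2A (i, j)).
have csta p q (M : 'M[K]_(p, q)) i j : analytic_at0 (fun _ : 'rV[K]_n => M i j).
  exact: analytic_cst.
have idA i j : analytic_at0 (fun x : 'rV[K]_n => x i j).
  by rewrite (ord1 i); apply: analytic_coord.
have RA i j : analytic_at0 (fun x => Rm x i j).
  by under eq_fun do rewrite !mxE; apply: analyticD => //; apply: analytic_cst.
have WA i j : analytic_at0 (fun x => W x i j).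
  by under eq_fun do rewrite !mxE; apply: analyticD => //; apply: analytic_cst.
have phiA : analytic_map_at0 phi.
  by move=> i; apply: analytic_mx => //; apply: analytic_mx.
have NQA i j : analytic_at0 (fun x => (1%:M + N (x *m Q)) i j).
  have h := poly_fun_analytic (N_poly i j) (fun l => analytic_mx idA (csta _ _ Q) 0 l).
  rewrite (_ : (fun x => _) = fun x => (1%:M : 'M[K]_n) i j + N (\row_l (x *m Q) 0 l) i j).
    by apply: analyticD; [exact: analytic_cst | exact: h].
  apply/funext => x; rewrite mxE; congr (_ + N _ i j).
  by apply/rowP => l; rewrite !mxE.
have psiA : analytic_map_at0 psi.
  by move=> i; apply: analytic_mx => //; apply: analytic_mx => //; apply: analytic_mx.
have phi0 : phi 0 = 0 by rewrite /phi !mul0mx.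
have psi0 : psi 0 = 0 by rewrite /psi !mul0mx.
have small (z : 'rV[K]_n -> 'I_n * 'I_n -> K) s : 0 < s ->
    (forall i j, analytic_at0 (fun x => z x (i, j))) -> (forall ij, z 0 ij = 0) ->
    \forall x \near (0 : 'rV[K]_n), forall ij, `|z x ij| <= s.
  move=> s0 zA z0.
  apply: (@filter_forall _ _ (fun ij x => `|z x ij| <= s) _ (nbhs_filter _)) => -[i j].
  by apply: filterS (analytic_cvg0 (zA i j) s0) => x; rewrite z0 subr0.
have disc_near (r : K) : 0 < r -> \forall x \near (0 : 'rV[K]_n), in_disc r x.
  by move=> r0; apply/near0P; exists r.
(* Near 0, the solution E of the equation at x is also the one at phi(x). *)
have sameRW : \forall x \near (0 : 'rV[K]_n), in_disc r1 x /\
    z2 (phi x) = z1 x /\ z2 (phi x) = (fun ij => z1 x (ij.2, ij.1)).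
  have H1 := disc_near _ r10; have H2 := analytic_map_near phiA phi0 (disc_near _ r20).
  have H3 := small z1 s2 s20 z1an (fun ij => (z1A ij).2).
  near=> x.
  have xr1 : in_disc r1 x by near: x.
  have pr2 : in_disc r2 (phi x) by near: x.
  have zs : forall ij, `|z1 x ij| <= s2 by near: x.
  have e1 := (morse_solves _ _ _ _ _).1 (z1S x xr1).
  rewrite /rho1 unknown_point -/(Rm x) in e1.
  have e2 : solves (morse_map N Pi rho2) (phi x) (z1 x).
    by apply/morse_solves; rewrite /rho2 /phi -mulmxA PQ mulmx1.
  have z2s : forall ij, `|z2 (phi x) ij| <= s2.
    by move=> ij; apply: (norm_val_le r20 (z2A ij).1 pr2).
  split=> //; split; apply: (z2U _ pr2) => //; try exact: z2S.
  apply/morse_solves; rewrite /rho2 /phi -mulmxA PQ mulmx1.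
  (* As [N] and [Pi] are symmetric, the transposed solution satisfies the same equation; uniqueness
     will make [Rm x] symmetric. *)
  have -> : \matrix_(i, j) z1 x ((i, j).2, (i, j).1) = (zmx (z1 x))^T.
    by apply/matrixP => i j; rewrite !mxE.
  move: e1 (N_sym (x *m Rm x)); rewrite /root_equation; move: (N (x *m Rm x)) => Nv e1 Ns.
  have := congr1 trmx e1.
  have trD (B C : 'M[K]_n) : (B + C)^T = B^T + C^T by apply: linearD.
  rewrite linearZ /= !trmx_mul trD !trmx_mul trD trmx1 Ns Pi_sym.
  by rewrite -/(zmx (z1 x)) !mulmxA.
have eqR x : in_disc r1 x -> [/\ Pi *m zmx (z1 x) = zmx (z1 x), zmx (z1 x) *m Pi = zmx (z1 x)
    & Rm x *m (1%:M + N (x *m Rm x)) *m Rm x = 1%:M].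
  move=> xr; have e := (morse_solves _ _ _ _ _).1 (z1S x xr).
  rewrite /rho1 unknown_point -/(Rm x) in e.
  have [h1 h2] := root_equation_supp Pi2 e.
  by split=> //; apply/(root_equationP (PiN _) (NPi _) h1 h2).
have eqW y : in_disc r2 y -> [/\ Pi *m zmx (z2 y) = zmx (z2 y), zmx (z2 y) *m Pi = zmx (z2 y)
    & W y *m (1%:M + N (y *m Q)) *m W y = 1%:M].
  move=> yr; have e := (morse_solves _ _ _ _ _).1 (z2S y yr).
  have [h1 h2] := root_equation_supp Pi2 e.
  by split=> //; apply/(root_equationP (PiN _) (NPi _) h1 h2).
exists phi; split.
  split=> //; exists psi; split=> //.
    apply: filterS sameRW => x [xr [e _]].
    have [_ _ h] := eqR x xr.
    rewrite /psi /W e -/(Rm x) /phi -!(mulmxA _ P Q) PQ !mulmx1.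
    by rewrite -!mulmxA (mulmx1C h) mulmx1.
  have H1 := analytic_map_near psiA psi0 (disc_near _ r10); have H2 := disc_near _ r20.
  have H3 := small z2 s1 s10 z2an (fun ij => (z2A ij).2).
  near=> y.
  have pr1 : in_disc r1 (psi y) by near: y.
  have yr2 : in_disc r2 y by near: y.
  have zs : forall ij, `|z2 y ij| <= s1 by near: y.
  have [h1 h2 h3] := eqW y yr2.
  have xW : psi y *m W y = y *m Q.
    by rewrite /psi -!mulmxA [W y *m _]mulmxA h3 mulmx1.
  (* Because [psi y *m W y] is [y *m Q], the solution at y also solves the source equation at
     [psi y]. *)
  have e : z1 (psi y) = z2 y.
    apply: (z1U _ pr1) => //; first by move=> ij; apply: (norm_val_le r10 (z1A ij).1 pr1).
      exact: z1S.
    apply/morse_solves; rewrite /rho1 unknown_point -/(W y) xW.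
    exact/(root_equationP (PiN _) (NPi _) h1 h2).
  by rewrite /phi /Rm e -/(W y) xW -mulmxA QP mulmx1.
apply: filterS sameRW => x [xr [e e']].
have [h1 h2 h] := eqR x xr.
have Rsym : (Rm x)^T = Rm x.
  rewrite /Rm linearD /= trmx1; congr (_ + _); apply/matrixP => i j.
  by rewrite !mxE -[LHS]/((fun ij => z1 x (ij.2, ij.1)) (i, j)) -e' e.
have RPi : Rm x *m (1%:M - Pi) = 1%:M - Pi.
  by rewrite mulmxDl mul1mx mulmxBr mulmx1 h2 subrr addr0.
split; last by rewrite /phi -mulmxA P_id -mulmxA RPi.
(* The identity for 1 + N minus that for 1 - Pi, which [Rm x] fixes under multiplication on either
   side. *)
have E : Rm x *m (Pi + N (x *m Rm x)) *m Rm x = Pi.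
  have -> : Pi + N (x *m Rm x) = (1%:M + N (x *m Rm x)) - (1%:M - Pi).
    by rewrite opprB [Pi - _]addrC addrACA subrr add0r addrC.
  have PiR : (1%:M - Pi) *m Rm x = 1%:M - Pi.
    by rewrite mulmxDr mulmx1 mulmxBl mul1mx h1 subrr addr0.
  by rewrite mulmxBr mulmxBl h RPi PiR opprB addrCA subrr addr0.
rewrite /phi !trmx_mul Rsym -!mulmxA; congr (x *m _).
rewrite !mulmxA -[in RHS]E; congr (_ *m _).
rewrite -!mulmxA; congr (Rm x *m _); rewrite !mulmxA; congr (_ *m _).
by rewrite /N addrC subrK.
Unshelve. all: by end_near. Qed.
End MorseLemma.

(** * Milnor number when the partial derivatives are an invertible combination of powers *)

Section MilnorPolynomial.
Context {K : numClosedFieldType} {KC : complete_numfield K} {n : nat}.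
Local Notation J := ('I_n * 'I_n)%type.
Variables (f : 'rV[K]_n -> K) (e : 'I_n -> nat) (H : 'rV[K]_n -> 'M[K]_n).
Hypothesis H_poly : mx_poly (fun v : 'I_n -> K => H (\row_l v l)).
Hypothesis H_unit : H 0 \in unitmx.
Hypothesis partial_eq : forall x i, partial i f x = \sum_l H x i l * x 0 l ^+ e l.

Let N x := invmx (H 0) *m H x - 1%:M.

(* Z = inverse_map (y, Z) says (1 + Z)(1 + N y) = 1. *)
Let inverse_map (ij : J) (v : 'I_n + J -> K) : K :=
  ((-1) *: (N (coord_row v) + unknown_mx v *m N (coord_row v))) ij.1 ij.2.

Let inverse_map_contractive ij : contractive (inverse_map ij).
Proof.
case: ij => i j; move: i j.
have N_contractive : @mx_contractive K n J n n (fun v => N (coord_row v)).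
  have N_poly : mx_poly (fun v : 'I_n -> K => N (\row_l v l)).
    apply: mx_polyD; last exact: mx_poly_cst.
    by apply: mx_polyM; first exact: mx_poly_cst.
  move=> i j; have [g gP Hg] := poly_fun_hadamard (N_poly i j).
  apply: (@contractive_ext _ _ _ (fun v => \sum_l v (inl l) * g l (fun l => v (inl l)))) => [|v].
    apply: contractive_sum => l; apply: contractive_x.
    apply: (poly_fun_comp (gP l)) => s; exact: poly_var.
  have := Hg (fun l => v (inl l)).
  have -> : \row_l (fun=> 0 : K) l = 0 :> 'rV[K]_n by apply/rowP => l; rewrite !mxE.
  have -> : N 0 = 0 by rewrite /N mulVmx// subrr.
  by rewrite [X in X + _]mxE add0r => <-.
apply: mx_contractiveZ; apply: mx_contractiveD => //.
apply: mx_contractiveMl => //; exact: unknown_mx_poly.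
Qed.

(** Solving for the inverse of [H] near 0 as an analytic matrix (1 + Z) H(0)^-1 puts the powers
    x_l^(e_l) into the Jacobian ideal; the other inclusion is the hypothesis on the partial
    derivatives. *)
Theorem milnor_poly : is_milnor_number f (\prod_i e i)%N.
Proof.
have [r [s [z [r0 s0 zA zS _]]]] := analytic_solution inverse_map_contractive.
pose E x : 'M[K]_n := \matrix_(i, j) z x (i, j).
have zan i j : analytic_at0 (fun x => z x (i, j)).
  by apply/analytic_at0P; exists r, s; split=> //; case: (zA (i, j)).
have ES x : in_disc r x -> (1%:M + E x) *m (1%:M + N x) = 1%:M.
  move=> xr.
  have h : E x = (-1) *: (N x + E x *m N x).
    have E1 : unknown_mx (point x (z x)) = E x by apply/matrixP => i j; rewrite !mxE.
    have E2 : coord_row (point x (z x)) = x by apply/rowP => i; rewrite mxE.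
    by apply/matrixP => i j; rewrite {1}/E mxE (zS x xr (i, j)) /inverse_map E1 E2.
  rewrite mulmxDr mulmx1 mulmxDl mul1mx -addrA {1}h scaleN1r.
  by rewrite addNr addr0.
have GH x : in_disc r x -> (1%:M + E x) *m invmx (H 0) *m H x = 1%:M.
  move=> xr; rewrite -mulmxA (_ : invmx (H 0) *m H x = 1%:M + N x) ?ES//.
  by rewrite /N addrC subrK.
pose G l i x := ((1%:M + E x) *m invmx (H 0)) l i.
apply: (@milnor_monomial _ _ _ f e (fun i l x => H x i l) G).
- move=> i l.
  have -> : (fun x => H x i l) = (fun x : 'rV[K]_n => H (\row_j x 0 j) i l).
    2: exact: (poly_fun_analytic (H_poly i l) (fun l => analytic_coord l)).
  by apply/funext => x; congr (H _ i l); apply/rowP => j; rewrite mxE.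
- move=> l i; rewrite /G; under eq_fun do rewrite mxE.
  apply: analytic_sum => j _; apply: analyticM; last exact: analytic_cst.
  rewrite (_ : (fun x => _) = fun x => (1%:M : 'M[K]_n) l j + z x (l, j)).
    by apply: analyticD; [apply: analytic_cst | apply: zan].
  by apply/funext => x; rewrite mxE; congr (_ + _); rewrite mxE.
- by near=> x => i; apply: partial_eq.
apply/near0P; exists r => // x xr l.
under eq_bigr => i _ do rewrite partial_eq mulr_sumr.
rewrite exchange_big /=.
under eq_bigr => k _.
  under eq_bigr => i _ do rewrite mulrA.
  rewrite -mulr_suml.
  over.
rewrite (bigD1 l)//= [X in _ + X]big1 ?addr0 => [|k kl]; last first.
  have -> : \sum_i G l i x * H x i k = ((1%:M + E x) *m invmx (H 0) *m H x) l k.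
    by rewrite mxE.
  rewrite GH// mxE.
  by rewrite eq_sym (negPf kl) mul0r.
have -> : \sum_i G l i x * H x i l = ((1%:M + E x) *m invmx (H 0) *m H x) l l.
  by rewrite mxE.
by rewrite GH// mxE eqxx mul1r.
Unshelve. all: by end_near. Qed.
End MilnorPolynomial.

(** * Partial derivatives of polynomial functions *)

Section PolynomialDerivative.
Context {K : numClosedFieldType} {n : nat}.

Lemma horner_cvg (p : {poly K}) (a : K) (F : set_system K) : Filter F ->
  F --> a -> p.[h] @[h --> F] --> p.[a].
Proof.
move=> FF Fa; elim/poly_ind: p => [|p c IH].
  rewrite (_ : (fun h => (0 : {poly K}).[h]) = fun=> 0) ?horner0; first exact: cvg_cst.
  by apply/funext => h; rewrite horner0.
rewrite (_ : (fun h => (p * 'X + c%:P).[h]) = fun h => p.[h] * h + c); last first.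
  by apply/funext => h; rewrite hornerMXaddC.
rewrite hornerMXaddC.
apply: cvgD; last exact: cvg_cst.
exact: cvgM IH Fa.
Qed.

(** Along a coordinate line the difference quotient is the polynomial (p - p(0)) / X, which is
    continuous and takes the value p'(0) at 0. *)
Lemma partial_poly (f : 'rV[K]_n -> K) i x (p : {poly K}) :
  (forall h : K, f (h *: delta_mx 0 i + x) = p.[h]) -> partial i f x = p^`().[0].
Proof.
move=> fp; rewrite /partial /derive.
have fx : f x = p.[0] by rewrite -fp scale0r add0r.
have [q pq] : exists q, p = q * 'X + (p.[0])%:P.
  have /factor_theorem[q] : root (p - (p.[0])%:P) 0.
    by rewrite /root !hornerE subrr.
  by rewrite subr0 => e; exists q; rewrite -e subrK.
have -> : p^`().[0] = q.[0].
  by rewrite pq derivD derivC derivM derivX !hornerE ?mulr0 ?add0r.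
apply/cvg_lim => //.
apply: (@cvg_trans _ (q.[h] @[h --> 0^'])); last first.
  by apply: horner_cvg; apply: nbhs_dnbhs.
apply: near_eq_cvg; near=> h.
have h0 : h != 0 by near: h; exact: nbhs_dnbhs_neq.
rewrite /= fp fx {1}pq !hornerE addrK.
by rewrite /GRing.scale/= mulrC mulfK.
Unshelve. all: by end_near. Qed.
End PolynomialDerivative.

(** * The germ at a singular point *)

Section Jets.
Context {K : numClosedFieldType} {n : nat}.
Implicit Types (p : ('I_n -> K) -> K) (l c : 'I_n -> K).

(* The 2-jet of log p is sum_i l_i v_i + 1/2 sum_i c_i v_i^2: in this normal form
   the jets of products add. *)
Definition log_jet p l c := exists S : ('I_n -> K) -> 'M[K]_n,
  [/\ mx_poly S, forall v i j, S v i j = S v j i,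
      forall i j, S (fun=> 0) i j = 2^-1 * (l i * l j + (i == j)%:R * c i)
    & forall v, p v = 1 + \sum_i v i * l i + \sum_i v i * \sum_j v j * S v i j].

Lemma log_jet_ext p l l' c c' : l =1 l' -> c =1 c' -> log_jet p l c -> log_jet p l' c'.
Proof. by move=> /funext -> /funext ->. Qed.

Lemma log_jet1 : log_jet (fun=> 1) (fun=> 0) (fun=> 0).
Proof.
exists (fun=> 0); split=> [||i j|v].
- exact: mx_poly_cst.
- by move=> v i j; rewrite !mxE.
- by rewrite mxE !mulr0 addr0 mulr0.
- rewrite !big1 ?addr0// => i _; rewrite ?mulr0// big1 ?mulr0// => j _.
  by rewrite mxE mulr0.
Qed.

Lemma log_jet_coord (i0 : 'I_n) (t : K) :
  log_jet (fun v => 1 + t * v i0) (fun i => (i == i0)%:R * t) (fun i => - ((i == i0)%:R * t ^+ 2)).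
Proof.
exists (fun=> 0); split=> [||i j|v].
- exact: mx_poly_cst.
- by move=> v i j; rewrite !mxE.
- rewrite mxE; have [->|ij] := eqVneq i j.
    by case: (j == i0); rewrite ?mul0r ?oppr0 ?mulr0 ?addr0 ?mulr0 // !mul1r expr2 subrr mulr0.
  have [ii0|_] := eqVneq i i0; last by rewrite !mul0r ?oppr0 addr0 mulr0.
  by rewrite -ii0 eq_sym (negPf ij) !mul0r mulr0 addr0 mulr0.
- rewrite (bigD1 i0)//= eqxx mul1r [\sum_(i | _) v i * _]big1 ?addr0; last first.
    by move=> i /negPf ->; rewrite mul0r mulr0.
  rewrite big1 ?addr0 1?mulrC// => i _; rewrite big1 ?mulr0// => j _.
  by rewrite mxE mulr0.
Qed.

Lemma log_jetM p p' l l' c c' : log_jet p l c -> log_jet p' l' c' ->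
  log_jet (fun v => p v * p' v) (fun i => l i + l' i) (fun i => c i + c' i).
Proof.
move=> [S [SP Ssym S0 HS]] [S' [SP' Ssym' S0' HS']].
pose L v := \sum_i v i * l i; pose L' v := \sum_i v i * l' i.
pose B v := \sum_i v i * \sum_j v j * S v i j.
pose B' v := \sum_i v i * \sum_j v j * S' v i j.
pose bil (v : 'I_n -> K) (M : 'I_n -> 'I_n -> K) := \sum_i v i * \sum_j v j * M i j.
have bilZ v M k : bil v (fun i j => k * M i j) = k * bil v M.
  rewrite mulr_sumr; apply: eq_bigr => i _; rewrite mulrCA; congr (_ * _).
  by rewrite mulr_sumr; apply: eq_bigr => j _; rewrite mulrCA.
have bilD v M M' : bil v (fun i j => M i j + M' i j) = bil v M + bil v M'.
  rewrite -big_split /=; apply: eq_bigr => i _; rewrite -mulrDr; congr (_ * _).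
  by rewrite -big_split /=; apply: eq_bigr => j _; rewrite mulrDr.
have LP (k : 'I_n -> K) : poly_fun (fun v : 'I_n -> K => \sum_i v i * k i).
  by apply: poly_fun_sum => i _; apply: poly_mul; [apply: poly_var | apply: poly_cst].
have BP (M : ('I_n -> K) -> 'M[K]_n) : mx_poly M ->
    poly_fun (fun v : 'I_n -> K => \sum_i v i * \sum_j v j * M v i j).
  move=> hM; apply: poly_fun_sum => i _; apply: poly_mul; first exact: poly_var.
  by apply: poly_fun_sum => j _; apply: poly_mul; first exact: poly_var.
(* The terms of the product of degree at least two are (1 + L) B' + (1 + L' + B') B + L L'; the last
   one is symmetrised to keep the matrix symmetric. *)
exists (fun v => \matrix_(i, j) ((1 + L v) * S' v i j + (1 + L' v + B' v) * S v i j
   + 2^-1 * (l i * l' j + l' i * l j))).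
have zero_sum (k : 'I_n -> K) : \sum_(i < n) 0 * k i = 0.
  by rewrite big1// => i _; rewrite mul0r.
split.
- move=> i j; apply: (@poly_fun_ext _ _ (fun v => (1 + L v) * S' v i j + (1 + L' v + B' v) * S v i j
   + 2^-1 * (l i * l' j + l' i * l j))) => [|v]; last by rewrite mxE.
  have P1 : poly_fun (fun v => 1 + L v) := poly_add (poly_cst _ 1) (LP l).
  have P2 : poly_fun (fun v => 1 + L' v + B' v) := poly_add (poly_add (poly_cst _ 1) (LP l')) (BP _ SP').
  exact: poly_add (poly_add (poly_mul P1 (SP' i j)) (poly_mul P2 (SP i j))) (poly_cst _ _).
- by move=> v i j; rewrite !mxE Ssym Ssym'; ring.
- move=> i j; rewrite mxE S0 S0' /L /L' /B' !zero_sum; ring.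
- move=> v; rewrite HS HS' -/(L v) -/(L' v) -/(B v) -/(B' v).
  have -> : \sum_i v i * (l i + l' i) = L v + L' v.
    by rewrite -big_split /=; apply: eq_bigr => i _; rewrite mulrDr.
  have -> : \sum_i v i * (\sum_j v j * (\matrix_(i, j) ((1 + L v) * S' v i j +
      (1 + L' v + B' v) * S v i j + 2^-1 * (l i * l' j + l' i * l j))) i j) =
      (1 + L v) * B' v + (1 + L' v + B' v) * B v + L v * L' v.
    have LL : \sum_i v i * \sum_j v j * (l i * l' j) = L v * L' v.
      rewrite mulr_suml; apply: eq_bigr => i _; rewrite -mulrA; congr (_ * _).
      by rewrite mulr_sumr; apply: eq_bigr => j _; rewrite mulrCA.
    have LL' : \sum_i v i * \sum_j v j * (l' i * l j) = L' v * L v.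
      rewrite mulr_suml; apply: eq_bigr => i _; rewrite -mulrA; congr (_ * _).
      by rewrite mulr_sumr; apply: eq_bigr => j _; rewrite mulrCA.
    have -> : L v * L' v = 2^-1 * (L v * L' v + L' v * L v) by field.
    rewrite -LL -LL' -[RHS]/(_ * bil v (S' v) + _ * bil v (S v) + _ * (bil v _ + bil v _)).
    rewrite -bilD -!bilZ -!bilD; apply: eq_bigr => i _; congr (_ * _).
    by apply: eq_bigr => j _; rewrite mxE.
  ring.
Qed.

Lemma log_jetX p l c k : log_jet p l c ->
  log_jet (fun v => p v ^+ k) (fun i => k%:R * l i) (fun i => k%:R * c i).
Proof.
move=> h; elim: k => [|k IH].
  by apply: log_jet_ext log_jet1 => i; rewrite mul0r.
have := log_jetM h IH.
under [X in log_jet X]eq_fun do rewrite -exprS.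
by apply: log_jet_ext => i; rewrite mulrS mulrDl mul1r.
Qed.

Lemma log_jet_prod (I : Type) (s : seq I) (P : pred I) (p : I -> ('I_n -> K) -> K) (l c : I -> 'I_n -> K) :
  (forall i, log_jet (p i) (l i) (c i)) ->
  log_jet (fun v => \prod_(i <- s | P i) p i v)
    (fun j => \sum_(i <- s | P i) l i j) (fun j => \sum_(i <- s | P i) c i j).
Proof.
move=> h; elim: s => [|i s IH].
  rewrite (_ : (fun v => _) = fun=> 1); last by apply/funext => v; rewrite big_nil.
  by apply: log_jet_ext log_jet1 => j; rewrite big_nil.
have [Pi|/negPf Pi] := boolP (P i).
  rewrite (_ : (fun v => _) = fun v => p i v * \prod_(i <- s | P i) p i v).
    by apply: log_jet_ext (log_jetM (h i) IH) => j; rewrite big_cons Pi.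
  by apply/funext => v; rewrite big_cons Pi.
rewrite (_ : (fun v => _) = fun v => \prod_(i <- s | P i) p i v).
  by apply: log_jet_ext IH => j; rewrite big_cons Pi.
by apply/funext => v; rewrite big_cons Pi.
Qed.

(** The logarithm is the sum of the b_i log(1 + t_i v_i), whose second order terms are diagonal. *)
Lemma log_jet_monomial (b : 'I_n -> nat) (t : 'I_n -> K) (P : pred 'I_n) :
  log_jet (fun v => \prod_(i | P i) (1 + t i * v i) ^+ b i)
    (fun i => if P i then (b i)%:R * t i else 0)
    (fun i => - if P i then (b i)%:R * t i ^+ 2 else 0).
Proof.
have := @log_jet_prod _ (index_enum 'I_n) P _ _ _ (fun i => log_jetX (b i) (log_jet_coord i (t i))).
apply: log_jet_ext => j; case: ifPn => Pj.
- rewrite (bigD1 j)//= eqxx mul1r big1 ?addr0// => i /andP[_ /negPf ij].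
  by rewrite eq_sym ij mul0r mulr0.
- rewrite big1// => i Pi; case: eqP => [e|_]; last by rewrite mul0r mulr0.
  by rewrite e Pi in Pj.
- rewrite (bigD1 j)//= eqxx mul1r mulrN big1 ?addr0// => i /andP[_ /negPf ij].
  by rewrite eq_sym ij mul0r oppr0 mulr0.
- rewrite oppr0 big1// => i Pi; case: eqP => [e|_]; last by rewrite mul0r oppr0 mulr0.
  by rewrite e Pi in Pj.
Qed.
End Jets.

Section LocalModel.
Context {K : numClosedFieldType} {KC : complete_numfield K} {n : nat}.
Variables (Y : pred 'I_n) (D b : 'I_n -> nat) (t lam : 'I_n -> K) (kappa lam0 : K).
Hypothesis kappa_neq0 : kappa != 0.
Hypothesis t_neq0 : forall i, Y i -> t i != 0.
Hypothesis lam_gt0 : forall i, Y i -> 0 < lam i.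
Hypothesis lam0_gt0 : 0 < lam0.
Hypothesis lam_sum : \sum_(i | Y i) lam i = 1 - lam0.
Hypothesis lamD : forall i, Y i -> lam i * (D i)%:R = (b i)%:R.
Hypothesis b_gt0 : forall i, Y i -> (0 < b i)%N.
Hypothesis D_gt1 : forall i, ~~ Y i -> (1 < D i)%N.

(** The relation lam_i D_i = b_i makes the linear terms of the sum and of the product equal, so the
    origin is a critical point. *)
Definition model_nondeg (y : 'rV[K]_n) : K :=
  kappa * (\sum_(i | Y i) lam i * ((1 + t i * y 0 i) ^+ D i - 1)
           - (\prod_(i | Y i) (1 + t i * y 0 i) ^+ b i - 1)).

Definition model (y : 'rV[K]_n) : K := model_nondeg y + \sum_(i | ~~ Y i) y 0 i ^+ D i.

Definition model_normal_form (y : 'rV[K]_n) : K :=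
  \sum_(i | Y i) y 0 i ^+ 2 + \sum_(i | ~~ Y i) y 0 i ^+ D i.

Let Pi : 'M[K]_n := diag_mx (\row_i (Y i)%:R).

Let PiE i j : Pi i j = (Y i && (i == j))%:R.
Proof. by rewrite !mxE; case: (Y i); case: (i == j); rewrite ?mulr1n ?mulr0n. Qed.

Let PiTr : Pi^T = Pi.
Proof. exact: tr_diag_mx. Qed.

Let Pi2 : Pi *m Pi = Pi.
Proof.
rewrite mulmx_diag; congr diag_mx; apply/rowP => i; rewrite !mxE.
by case: (Y i); rewrite ?mulr1 ?mulr0.
Qed.

Let mulPi (y : 'rV[K]_n) i : (y *m Pi) 0 i = if Y i then y 0 i else 0.
Proof. by rewrite mul_mx_diag !mxE; case: (Y i); rewrite ?mulr1 ?mulr0. Qed.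

Let Pi_sandwich (M : 'M[K]_n) i j : (Pi *m M *m Pi) i j = if Y i && Y j then M i j else 0.
Proof.
rewrite mul_mx_diag mul_diag_mx !mxE.
by case: (Y i); case: (Y j); rewrite ?mul1r ?mul0r ?mulr1 ?mulr0.
Qed.

Let model_nondeg_Pi y : model_nondeg (y *m Pi) = model_nondeg y.
Proof.
congr (kappa * (_ - (_ - _))).
  by apply: eq_bigr => i Yi; rewrite mulPi Yi.
by apply: eq_bigr => i Yi; rewrite mulPi Yi.
Qed.

(** Weighted by lam, the diagonal corrections of the log jets of the powers are - b_i t_i^2, as for
    the monomial, so they cancel. What is left is the difference of the squares of the linear parts:
    the diagonal b_i D_i t_i^2 minus a rank one matrix. *)
Lemma model_quadratic : exists A : 'rV[K]_n -> 'M[K]_n,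
  [/\ mx_poly (fun v : 'I_n -> K => A (\row_l v l)),
      forall y, (A y)^T = A y /\ Pi *m A y *m Pi = A y,
      forall i j, A 0 i j = if Y i && Y j then kappa / 2 *
         ((i == j)%:R * ((b i)%:R * (D i)%:R * t i ^+ 2) - (b i)%:R * (b j)%:R * t i * t j) else 0
    & forall y, model_nondeg y = (y *m A y *m y^T) 0 0].
Proof.
have /choice[S HS] i := log_jetX (D i) (log_jet_coord i (t i)).
have [S' [S'P S'sym S'0 HS']] := log_jet_monomial b t Y.
pose A0 (v : 'I_n -> K) : 'M[K]_n := kappa *: (\sum_(i | Y i) lam i *: S i v - S' v).
have A0E v i j : A0 v i j = kappa * (\sum_(k | Y k) lam k * S k v i j - S' v i j).
  rewrite !mxE summxE; congr (_ * (_ - _)).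
  by apply: eq_bigr => k _; rewrite mxE.
have A0P : mx_poly A0.
  move=> i j; apply: (@poly_fun_ext _ _ (fun v => kappa * (\sum_(k | Y k) lam k * S k v i j + -1 * S' v i j))).
    apply: poly_mul; first exact: poly_cst.
    apply: poly_add; last by apply: poly_mul => //; apply: poly_cst.
    apply: poly_fun_sum => k _; apply: poly_mul; first exact: poly_cst.
    by have [h _ _ _] := HS k.
  by move=> v; rewrite A0E mulN1r.
have A0sym v i j : A0 v i j = A0 v j i.
  rewrite !A0E S'sym; congr (_ * (_ - _)); apply: eq_bigr => k _.
  by have [_ h _ _] := HS k; rewrite h.
have quad y : model_nondeg y = \sum_i y 0 i * \sum_j y 0 j * A0 (fun l => y 0 l) i j.
  rewrite /model_nondeg HS'.
  under eq_bigr => k _ do rewrite (let: And4 _ _ _ h := HS k in h (fun l => y 0 l)).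
  set v := fun l => y 0 l.
  pose bil (M : 'M[K]_n) := \sum_i v i * \sum_j v j * M i j.
  have bilZ k M : bil (k *: M) = k * bil M.
    rewrite mulr_sumr; apply: eq_bigr => i _; rewrite mulrCA; congr (_ * _).
    by rewrite mulr_sumr; apply: eq_bigr => j _; rewrite mxE mulrCA.
  have bilD M M' : bil (M + M') = bil M + bil M'.
    rewrite -big_split /=; apply: eq_bigr => i _; rewrite -mulrDr; congr (_ * _).
    by rewrite -big_split /=; apply: eq_bigr => j _; rewrite mxE mulrDr.
  have bilN M : bil (- M) = - bil M by rewrite -scaleN1r bilZ mulN1r.
  have bil0 : bil 0 = 0.
    by rewrite /bil big1// => i _; rewrite big1 ?mulr0// => j _; rewrite mxE mulr0.
  have bil_sum (F : 'I_n -> 'M[K]_n) : bil (\sum_(k | Y k) F k) = \sum_(k | Y k) bil (F k).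
    exact: (big_morph bil bilD bil0).
  rewrite -[RHS]/(bil (A0 v)) /A0 bilZ bilD bilN bil_sum; congr (_ * _).
  under [X in _ = X - _]eq_bigr => k _ do rewrite bilZ.
  have lin : \sum_i v i * (if Y i then (b i)%:R * t i else 0) =
     \sum_(k | Y k) lam k * \sum_i v i * ((D k)%:R * ((i == k)%:R * t k)).
    rewrite [RHS](_ : _ = \sum_(k | Y k) v k * ((b k)%:R * t k)).
      rewrite [RHS]big_mkcond; apply: eq_bigr => k _.
      by case: (Y k); rewrite ?mulr0.
    apply: eq_bigr => k Yk; rewrite (bigD1 k)//= eqxx mul1r big1 ?addr0 => [|i /negPf ->].
      by rewrite -(lamD Yk); ring.
    by rewrite mul0r !mulr0.
  have cancel1 (a c : K) : 1 + a + c - 1 = a + c by ring.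
  rewrite lin cancel1 opprD addrA; congr (_ - _); rewrite -sumrB; apply: eq_bigr => k _.
  by rewrite cancel1 /bil; ring.
exists (fun y => Pi *m A0 (fun l => (y *m Pi) 0 l) *m Pi); split.
- move=> i j.
  apply: (@poly_fun_ext _ _ (fun v => if Y i && Y j then A0 (fun l => if Y l then v l else 0) i j else 0)).
    case: (Y i && Y j); last exact: poly_cst.
    apply: (@poly_fun_comp K 'I_n 'I_n (fun v => A0 v i j) (fun l v => if Y l then v l else 0) (A0P i j)).
    by move=> l; case: (Y l); [apply: poly_var | apply: poly_cst].
  move=> v; rewrite Pi_sandwich; case: ifP => // _; congr (A0 _ i j).
  by apply/funext => l; rewrite mulPi mxE.
- move=> y; split; last by rewrite -!mulmxA Pi2 !mulmxA Pi2.
  apply/matrixP => i j; rewrite [LHS]mxE !Pi_sandwich andbC.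
  by case: ifP => // _; rewrite A0sym.
- move=> i j; rewrite Pi_sandwich; case: ifP => // /andP[Yi Yj].
  have -> : (fun l => (0 *m Pi : 'rV[K]_n) 0 l) = fun=> 0.
    by apply/funext => l; rewrite mul0mx mxE.
  rewrite A0E S'0 Yi Yj.
  under eq_bigr => k _ do rewrite (let: And4 _ _ h _ := HS k in h i j).
  rewrite (bigD1 i)//= eqxx big1 => [|k /andP[_ /negPf ki]]; last first.
    by rewrite eq_sym ki !(mul0r, mulr0, oppr0, addr0).
  rewrite -(lamD Yi); have [<-|ij] := eqVneq i j; last first.
    by rewrite /= !(mul0r, mulr0, mulr0n); field.
  by rewrite /= !mulr1n; field.
- move=> y; rewrite -(model_nondeg_Pi y) quad.
  have -> : y *m (Pi *m A0 (fun l => (y *m Pi) 0 l) *m Pi) *m y^T =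
     (y *m Pi) *m A0 (fun l => (y *m Pi) 0 l) *m (y *m Pi)^T.
    by rewrite trmx_mul PiTr !mulmxA.
  rewrite mxE; under [RHS]eq_bigr => j _ do rewrite mxE mulr_suml.
  rewrite exchange_big; apply: eq_bigr => i _; rewrite mulr_sumr; apply: eq_bigr => j _.
  by rewrite [X in _ = _ * X]mxE; ring.
Qed.

(** This vector has beta beta^T = 1 - lam0, so 1 - B acts on it by lam0 > 0: this is where
    positivity makes the Hessian invertible on [Y]. *)
Let beta_row : 'rV[K]_n := \row_i (if Y i then sqrtC (lam i) else 0).
Let B : 'M[K]_n := beta_row^T *m beta_row.

Let sqrt_lam i : Y i -> sqrtC (lam i) * sqrtC (lam i) = lam i.
Proof. by move=> _; rewrite -expr2 sqrtCK. Qed.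

Let B_Pi : B *m Pi = B.
Proof.
rewrite /B -mulmxA; congr (_ *m _); apply/rowP => i; rewrite mulPi !mxE.
by case: (Y i).
Qed.

Let B_sym : B^T = B.
Proof. by rewrite /B trmx_mul trmxK. Qed.

Let Pi_B : Pi *m B = B.
Proof. by rewrite -[LHS]trmxK trmx_mul PiTr B_sym B_Pi B_sym. Qed.

Let B2 : B *m B = (1 - lam0) *: B.
Proof.
rewrite /B mulmxA -(mulmxA _ beta_row) (_ : beta_row *m beta_row^T = (1 - lam0)%:M).
  by rewrite mul_mx_scalar scalemxAl.
apply/matrixP => i j; rewrite !ord1 !mxE eqxx mulr1n -lam_sum [RHS]big_mkcond.
apply: eq_bigr => k _; rewrite !mxE; case: ifP => Yk; last by rewrite mulr0.
exact: sqrt_lam.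
Qed.

Let s0 : K := sqrtC lam0.
Let s0_gt0 : 0 < s0. Proof. by rewrite sqrtC_gt0. Qed.
Let s0_sqr : s0 * s0 = lam0. Proof. by rewrite -expr2 sqrtCK. Qed.
Let s01_neq0 : 1 + s0 != 0. Proof. by rewrite gt_eqF// addr_gt0. Qed.

(* T is the square root of 1 - B, and T' its inverse. *)
Let T : 'M[K]_n := 1%:M - (1 + s0)^-1 *: B.
Let T' : 'M[K]_n := 1%:M + (s0 * (1 + s0))^-1 *: B.

(** As B^2 is a multiple of B, products of matrices 1 + u B reduce to scalar identities; on the line
    of [beta_row], [T] acts by [s0]. *)
Let mul_1B u v : (1%:M + u *: B) *m (1%:M + v *: B) = 1%:M + (u + v + u * v * (1 - lam0)) *: B.
Proof.
rewrite mulmxDl mul1mx mulmxDr mulmx1 -scalemxAl -scalemxAr B2 !scalerA -!addrA.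
by congr (_ + _); rewrite addrCA !addrA -!scalerDl; congr (_ *: _); ring.
Qed.

Let TT' : T' *m T = 1%:M.
Proof.
rewrite /T -scaleNr mul_1B -s0_sqr [X in X *: _](_ : _ = 0) ?scale0r ?addr0//.
by field; rewrite s01_neq0 gt_eqF.
Qed.

Let T'T : T *m T' = 1%:M. Proof. exact: mulmx1C TT'. Qed.

Let TPiT : T *m Pi *m T = Pi - B.
Proof.
have E : T *m Pi = Pi *m T.
  by rewrite /T mulmxBl mulmxBr mul1mx mulmx1 -scalemxAl -scalemxAr B_Pi Pi_B.
rewrite E -mulmxA {1 2}/T -scaleNr mul_1B -s0_sqr [X in X *: _](_ : _ = -1).
  by rewrite scaleN1r mulmxBr mulmx1 Pi_B.
by field.
Qed.

(** The rescaling for which g_i^2 = (kappa / 2) b_i D_i t_i^2, since D_i = b_i / lam_i; with the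
    roots of the lam_i it also gives the rank one entries. *)
Let g i : K := if Y i then sqrtC (kappa / 2) * (b i)%:R * t i / sqrtC (lam i) else 1.

Let g_neq0 i : g i != 0.
Proof.
rewrite /g; case: ifP => Yi; last exact: oner_neq0.
rewrite !mulf_neq0 ?invr_eq0 ?sqrtC_eq0 ?t_neq0//.
- by rewrite mulf_neq0 ?invr_eq0 ?pnatr_eq0.
- by rewrite pnatr_eq0 -lt0n b_gt0.
- by rewrite gt_eqF// lam_gt0.
Qed.

Let G : 'M[K]_n := diag_mx (\row_i g i).
Let G' : 'M[K]_n := diag_mx (\row_i (g i)^-1).

Let GG' : G *m G' = 1%:M.
Proof.
rewrite mulmx_diag -diag_const_mx; congr diag_mx; apply/rowP => i; rewrite !mxE.
by rewrite mulfV.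
Qed.

Let G'G : G' *m G = 1%:M. Proof. exact: mulmx1C GG'. Qed.

Let model_hessian (A : 'M[K]_n) : (forall i j, A i j = if Y i && Y j then kappa / 2 *
         ((i == j)%:R * ((b i)%:R * (D i)%:R * t i ^+ 2) - (b i)%:R * (b j)%:R * t i * t j) else 0) ->
  A = G *m (Pi - B) *m G.
Proof.
move=> AE; apply/matrixP => i j; rewrite AE.
have -> : (G *m (Pi - B) *m G) i j =
    g i * ((Y i && (i == j))%:R - beta_row 0 i * beta_row 0 j) * g j.
  rewrite mul_mx_diag mul_diag_mx [LHS]mxE [X in X * _]mxE [X in _ * X * _]mxE PiE.
  rewrite [X in _ + X]mxE [B i j]mxE big_ord1.
  by congr (_ * (_ - _ * _) * _); rewrite mxE.
have bbE k : beta_row 0 k = if Y k then sqrtC (lam k) else 0 by rewrite mxE.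
rewrite !bbE /g; case: (boolP (Y i)) => Yi /=; last by rewrite mul0r subrr mulr0 mul0r.
case: (boolP (Y j)) => Yj /=; last first.
  have [ij|_] := eqVneq i j; first by rewrite ij (negPf Yj) in Yi.
  by rewrite mulr0 subrr mulr0 mul0r.
have s_neq0 k : Y k -> sqrtC (lam k) != 0 by move=> Yk; rewrite sqrtC_eq0 gt_eqF ?lam_gt0.
have si := s_neq0 i Yi; have sj := s_neq0 j Yj.
have kE : kappa / 2 = sqrtC (kappa / 2) * sqrtC (kappa / 2) by rewrite -expr2 sqrtCK.
rewrite {1}kE; have [<-|ij] := eqVneq i j; rewrite /= ?mulr0n ?mulr1n; last by field; rewrite si sj.
have := sqrt_lam Yi; move: si; rewrite -(lamD Yi); move: (sqrtC (lam i)) => u u0 <-; field.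
exact: u0.
Qed.

Lemma model_diagonalization (A : 'M[K]_n) : (forall i j, A i j = if Y i && Y j then kappa / 2 *
         ((i == j)%:R * ((b i)%:R * (D i)%:R * t i ^+ 2) - (b i)%:R * (b j)%:R * t i * t j) else 0) ->
  exists P Q : 'M[K]_n, [/\ P *m Q = 1%:M, Pi *m P = P *m Pi,
    P *m (1%:M - Pi) = 1%:M - Pi & P *m A *m P^T = Pi].
Proof.
move=> /model_hessian ->.
have T'_sym : T'^T = T' by rewrite /T' linearD linearZ /= trmx1 B_sym.
have G'_sym : G'^T = G' by apply: tr_diag_mx.
have PiT' : Pi *m T' = T' *m Pi.
  by rewrite /T' mulmxDl mulmxDr mul1mx mulmx1 -scalemxAl -scalemxAr B_Pi Pi_B.
have PiG' : Pi *m G' = G' *m Pi by rewrite !mulmx_diag; congr diag_mx; apply/rowP => i; rewrite !mxE mulrC.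
exists (T' *m G'), (G *m T); split.
- by rewrite mulmxA -(mulmxA T') G'G mulmx1.
- by rewrite mulmxA PiT' -mulmxA PiG' mulmxA.
(* Outside [Y] the scaling is 1 and [B] vanishes, so the change of basis is the identity there. *)
- have G'Pi : G' *m (1%:M - Pi) = 1%:M - Pi.
    apply/matrixP => i j; rewrite mul_diag_mx !mxE /g.
    case: (Y i) => /=; last by rewrite invr1 mul1r.
    by case: (i == j); rewrite ?mulr1n ?mulr0n subrr mulr0.
  rewrite -mulmxA G'Pi mulmxBr mulmx1 -PiT' /T' mulmxDr mulmx1 -scalemxAr Pi_B.
  by rewrite opprD addrACA subrr addr0.
- rewrite trmx_mul T'_sym G'_sym -!mulmxA (mulmxA G' G) G'G mul1mx (mulmxA G G') GG' mul1mx.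
  by rewrite -TPiT !mulmxA TT' mul1mx -mulmxA T'T mulmx1.
Qed.

Theorem model_local_equation : has_local_equation model model_normal_form.
Proof.
have [A [AP AS A0 Aq]] := model_quadratic.
have [P [Q [PQ PiP P_id PAP]]] := model_diagonalization A0.
have [phi [phiC Hphi]] := morse_lemma AP (fun y => (AS y).1) (fun y => (AS y).2)
  Pi2 PiTr PQ PiP P_id PAP.
exists phi, (fun=> 1); split; [exact: phiC | exact: analytic_cst | by rewrite oner_neq0 |].
apply: filterS Hphi => x [e1 e2].
rewrite mul1r /model Aq e1 /model_normal_form; congr (_ + _).
  rewrite mxE [RHS]big_mkcond; apply: eq_bigr => i _.
  by rewrite mulPi [X in _ * X]mxE; case: (Y i); rewrite ?mul0r ?expr2.
(* The Morse change fixes the coordinates outside [Y], so their powers pass unchanged and the unit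
   can be 1. *)
apply: eq_bigr => i Yi; congr (_ ^+ _).
have := congr1 (fun M : 'rV[K]_n => M 0 i) e2.
rewrite !mulmxBr !mulmx1 [LHS]mxE [RHS]mxE [X in _ + X]mxE [X in _ = _ + X]mxE.
by rewrite !mulPi (negPf Yi) !subr0.
Qed.

Lemma partial_model y i : partial i model y =
  if Y i then kappa * (b i)%:R * t i * ((1 + t i * y 0 i) ^+ (D i).-1 -
      \prod_(l | Y l) (1 + t l * y 0 l) ^+ (b l - (l == i)))
  else (D i)%:R * y 0 i ^+ (D i).-1.
Proof.
have yh h l : (h *: delta_mx 0 i + y) 0 l = if l == i then h + y 0 i else y 0 l.
  by rewrite !mxE eqxx andTb; case: eqP => [->|_]; rewrite ?mulr1 ?mulr0 ?add0r.
case: ifPn => Yi.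
  pose c1 := \sum_(l | Y l && (l != i)) lam l * ((1 + t l * y 0 l) ^+ D l - 1).
  pose c2 := \prod_(l | Y l && (l != i)) (1 + t l * y 0 l) ^+ b l.
  pose c3 := \sum_(l | ~~ Y l) y 0 l ^+ D l.
  pose u : {poly K} := (t i)%:P * ('X + (y 0 i)%:P) + 1.
  rewrite (@partial_poly _ _ _ _ _ (kappa%:P * ((lam i)%:P * (u ^+ D i - 1) + c1%:P
     - (u ^+ b i * c2%:P - 1)) + c3%:P)).
    rewrite !(derivD, derivM, derivN, derivC, derivXn, derivX, deriv_exp, hornerE) /=.
    rewrite (bigD1 i)//= eqxx subn1.
    rewrite [\prod_(l | _) _](_ : _ = c2); last first.
      by apply: eq_bigr => l /andP[_ /negPf ->]; rewrite subn0.
    have e1 : u.[0] = 1 + t i * y 0 i by rewrite /u !hornerE ?add0r addrC.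
    have dE k : ((t i)%:P * u ^+ k.-1 *+ k).[0] = k%:R * t i * (1 + t i * y 0 i) ^+ k.-1.
      by rewrite hornerMn hornerM hornerC horner_exp e1 -mulr_natl mulrA.
    by rewrite !dE !subr0 -(lamD Yi); ring.
  move=> h; rewrite /model /model_nondeg (bigD1 i)//= [\prod_(l | Y l) _](bigD1 i)//= !yh eqxx.
  rewrite [\sum_(l | Y l && _) _](_ : _ = c1); last first.
    by apply: eq_bigr => l /andP[_ /negPf li]; rewrite yh li.
  rewrite [\prod_(l | Y l && _) _](_ : _ = c2); last first.
    by apply: eq_bigr => l /andP[_ /negPf li]; rewrite yh li.
  rewrite [\sum_(l | ~~ _) _](_ : _ = c3); last first.
    apply: eq_bigr => l Yl; rewrite yh; case: eqP => // e.
    by rewrite e Yi in Yl.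
  by rewrite !hornerE [1 + _]addrC.
pose c3 := \sum_(l | ~~ Y l && (l != i)) y 0 l ^+ D l.
rewrite (@partial_poly _ _ _ _ _ ((model_nondeg y + c3)%:P + ('X + (y 0 i)%:P) ^+ D i)).
  rewrite derivD derivC deriv_exp derivD derivX derivC addr0 mul1r add0r.
  by rewrite hornerMn horner_exp !hornerE -mulr_natl.
move=> h; rewrite /model (bigD1 i)//= yh eqxx.
rewrite [\sum_(l | ~~ Y l && _) _](_ : _ = c3); last first.
  by apply: eq_bigr => l /andP[_ /negPf li]; rewrite yh li.
rewrite (_ : model_nondeg _ = model_nondeg y); last first.
  congr (kappa * (_ - (_ - _))).
    by apply: eq_bigr => l Yl; rewrite yh; case: eqP => // e; rewrite e (negPf Yi) in Yl.
  by apply: eq_bigr => l Yl; rewrite yh; case: eqP => // e; rewrite e (negPf Yi) in Yl.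
by rewrite !hornerE; apply: addrAC.
Qed.

Let e i := if Y i then 1%N else (D i).-1.

(** For i in [Y] the partial derivative is a multiple of the difference of two products with value 1
    at 0, hence a combination of the y_l with l in [Y]; the jets of these products give the
    coefficients, and hence H(0). *)
Let partial_matrix : exists H : 'rV[K]_n -> 'M[K]_n,
  [/\ mx_poly (fun v : 'I_n -> K => H (\row_l v l)),
      forall i j, H 0 i j = if Y i then if Y j then kappa * (b i)%:R * t i *
         ((i == j)%:R * ((D i)%:R * t i) - (b j)%:R * t j) else 0 else (i == j)%:R * (D i)%:R
    & forall x i, partial i model x = \sum_l H x i l * x 0 l ^+ e l].
Proof.
have /choice[S HS] i := log_jetX (D i).-1 (log_jet_coord i (t i)).
have /choice[S' HS'] i := log_jet_monomial (fun l => (b l - (l == i))%N) t Y.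
pose h i j (v : 'I_n -> K) := kappa * (b i)%:R * t i *
   ((i == j)%:R * ((D i)%:R * t i) - (b j)%:R * t j + \sum_k v k * (S i v j k - S' i v j k)).
pose mask (v : 'I_n -> K) l := if Y l then v l else 0.
exists (fun y => \matrix_(i, j) if Y i then if Y j then h i j (mask (y 0)) else 0
   else (i == j)%:R * (D i)%:R); split.
- move=> i j; apply: (@poly_fun_ext _ _ (fun v => if Y i then if Y j then h i j (mask v) else 0
   else (i == j)%:R * (D i)%:R)) => [|v]; last first.
    rewrite mxE; case: (Y i) => //; case: (Y j) => //; congr (h i j _).
    by apply/funext => l; rewrite /mask mxE.
  case: (Y i); last exact: poly_cst.
  case: (Y j); last exact: poly_cst.
  have hP : poly_fun (h i j).
    apply: poly_mul; first exact: poly_cst.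
    apply: poly_add; first exact: poly_cst.
    apply: poly_fun_sum => k _; apply: poly_mul; first exact: poly_var.
    have [SP _ _ _] := HS i; have [S'P _ _ _] := HS' i.
    apply: poly_fun_ext (poly_add (SP j k) (poly_mul (poly_cst _ (-1)) (S'P j k))) _ => v.
    by rewrite mulN1r.
  apply: (poly_fun_comp hP) => l; rewrite /mask.
  by case: (Y l); [apply: poly_var | apply: poly_cst].
- move=> i j; rewrite mxE; case: (Y i) => //; case: (Y j) => //.
  rewrite /h big1 ?addr0// => k _.
  by rewrite /mask mxE if_same mul0r.
move=> x i; rewrite partial_model; case: ifPn => Yi; last first.
  rewrite (bigD1 i)//= mxE (negPf Yi) eqxx mul1r /e (negPf Yi) big1 ?addr0// => l /negPf li.
  by rewrite mxE (negPf Yi) eq_sym li !mul0r.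
have mP : forall l, Y l -> x 0 l = mask (x 0) l by move=> l Yl; rewrite /mask Yl.
rewrite [x 0 i]mP//.
have [_ _ _ /(_ (mask (x 0))) ->] := HS i.
rewrite [\prod_(l | Y l) _](eq_bigr (fun l => (1 + t l * mask (x 0) l) ^+ (b l - (l == i)))); last first.
  by move=> l Yl; rewrite mP.
have [_ _ _ /(_ (mask (x 0))) ->] := HS' i.
have -> : \sum_l (\matrix_(i, j) if Y i then if Y j then h i j (mask (x 0)) else 0
   else (i == j)%:R * (D i)%:R) i l * x 0 l ^+ e l = \sum_l mask (x 0) l * h i l (mask (x 0)).
  apply: eq_bigr => l _; rewrite mxE Yi /e /mask; case: (Y l); last by rewrite !mul0r.
  by rewrite expr1 mulrC.
have D0 : (0 < D i)%N.
  rewrite lt0n; apply/eqP => D0; have := lamD Yi; rewrite D0 mulr0 => /esym/eqP.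
  by rewrite pnatr_eq0 -leqn0 leqNgt b_gt0.
rewrite /h; under [RHS]eq_bigr => l _ do rewrite mulrCA.
rewrite -mulr_sumr; congr (_ * _).
have e1 (u v u' v' : K) : 1 + u + v - (1 + u' + v') = (u - u') + (v - v') by ring.
rewrite e1 -!sumrB -big_split /=.
apply: eq_bigr => l _; rewrite -!mulrBr -mulrDr -sumrB; rewrite [mask (x 0) l]/mask.
case: ifPn => Yl; last by rewrite !mul0r.
congr (_ * (_ + _)); last by apply: eq_bigr => k _; rewrite mulrBr.
have [<-|il] := eqVneq i l; rewrite ?mul0r ?subn0 ?mulr0 //=.
rewrite !mul1r /= natrB ?b_gt0// -subn1 natrB//; ring.
Qed.

Theorem model_milnor : is_milnor_number model (\prod_(i | ~~ Y i) (D i - 1))%N.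
Proof.
have [H [HP H0 Hp]] := partial_matrix.
have [A [AP AS A0 _]] := model_quadratic.
have [P [Q [PQ PiP P_id PAP]]] := model_diagonalization A0.
have -> : (\prod_(i | ~~ Y i) (D i - 1) = \prod_i e i)%N.
  rewrite [LHS]big_mkcond; apply: eq_bigr => i _; rewrite /e subn1.
  by case: (Y i).
apply: milnor_poly HP _ Hp.
(* Differentiating y A y^T doubles the linear part on [Y]; outside [Y] the derivative of y_i^(D_i)
   has leading coefficient D_i. *)
pose C : 'M[K]_n := diag_mx (\row_i if Y i then 2 else (D i)%:R).
have -> : H 0 = C *m (A 0 + (1%:M - Pi)).
  apply/matrixP => i j; rewrite H0 mul_diag_mx !mxE A0.
  case: (boolP (Y i)) => Yi; case: (boolP (Y j)) => Yj /=.
  - by rewrite subrr addr0; field.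
  - by rewrite subrr addr0 mulr0.
  - by rewrite mul0rn subr0 add0r mulrC.
  - by rewrite mul0rn subr0 add0r mulrC.
rewrite unitmx_mul; apply/andP; split.
  rewrite unitmxE det_diag unitfE; apply/prodf_neq0 => i _.
  rewrite mxE; case: ifPn => [_|/D_gt1 Di]; rewrite pnatr_eq0//.
  by rewrite -lt0n ltnW.
(* The basis that diagonalises A(0) turns this sum into Pi + (1 - Pi) = 1. *)
have : P *m (A 0 + (1%:M - Pi)) *m P^T \in unitmx.
  have PiC : (1%:M - Pi)^T = 1%:M - Pi by rewrite linearB /= trmx1 PiTr.
  rewrite mulmxDr mulmxDl PAP P_id -{1}PiC -trmx_mul P_id PiC addrC subrK.
  exact: unitmx1.
by rewrite !unitmx_mul => /andP[/andP[]].
Qed.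
End LocalModel.

(** * Singular points and discriminant *)

Lemma card_eq_seq (T : eqType) (s : seq T) : uniq s -> [set x | x \in s] #= `I_(size s).
Proof.
elim: s => [_|x s IH /= /andP[xs us]].
  have -> : [set x : T | x \in [::]] = set0 by apply/seteqP; split.
  by rewrite II0; apply: card_eq00.
apply/eq_cardSP; exists x; first by rewrite /= inE eqxx.
have -> : [set y | y \in x :: s] `\ x = [set y | y \in s]; last exact: IH.
apply/seteqP; split => y /=; rewrite inE.
  by move=> [/orP[/eqP ->|//] nx]; case: nx.
by move=> ys; split; [rewrite ys orbT | move=> e; rewrite -e ys in xs].
Qed.

(** Counts singular points as classes of twists: [S] will be a group of characters and [f] the orbit
    that each one produces. *)
Lemma card_image_fibers (A : finType) (T : choiceType) (S : {set A}) (f : A -> T) (c : nat) :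
  (0 < c)%N -> (forall a, a \in S -> #|[set x in S | f x == f a]%SET| = c) ->
  exists N, (N * c = #|S|)%N /\ (f @` [set a | a \in S])%classic #= `I_N.
Proof.
move=> c0 fib.
pose s := undup [seq f a | a <- enum S].
exists (size s); split.
  rewrite -sum1_card.
  transitivity (\sum_(x <- s) \sum_(a in S | f a == x) 1)%N.
    rewrite -sum1_size big_distrl /= big_seq [RHS]big_seq.
    apply: eq_bigr => x; rewrite mem_undup => /mapP[a]; rewrite mem_enum => aS ->.
    rewrite mul1n sum1dep_card -(fib a aS).
    by apply: eq_card => b; rewrite !inE.
  rewrite (exchange_big_dep (mem S)) => [|x a _ /andP[]//] /=.
  apply: eq_bigr => a aS.
  rewrite -big_filter sum1_size size_filter.
  rewrite (@eq_count _ _ (pred1 (f a))) => [|x]; last by rewrite /= aS eq_sym.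
  rewrite count_uniq_mem ?undup_uniq// mem_undup map_f// mem_enum//.
have -> : (f @` [set a | a \in S])%classic = [set x | x \in s].
  apply/seteqP; split => [_ [a aS <-]|x] /=.
    by rewrite mem_undup map_f// mem_enum.
  by rewrite mem_undup => /mapP[a]; rewrite mem_enum => aS ->; exists a.
exact/card_eq_seq/undup_uniq.
Qed.

Lemma Bezout_big (I : eqType) (s : seq I) (m : I -> nat) : uniq s ->
  exists u : I -> int, \sum_(i <- s) u i * (m i)%:Z = (\big[gcdn/0%N]_(i <- s) m i)%:Z.
Proof.
elim: s => [_|i s IH /= /andP[iNs us]]; first by exists (fun=> 0); rewrite !big_nil.
have [u Hu] := IH us; rewrite big_cons.
have [p [q Hpq]] := Bezoutz (m i)%:Z (\big[gcdn/0%N]_(j <- s) m j)%:Z.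
exists (fun j => if j == i then p else q * u j).
rewrite big_cons eqxx [X in _ + X](_ : _ = q * \sum_(j <- s) u j * (m j)%:Z).
  by rewrite Hu Hpq.
rewrite mulr_sumr big_seq [RHS]big_seq; apply: eq_bigr => j js.
by case: eqP => [e|_]; [rewrite -e js in iNs | rewrite mulrA].
Qed.

(** * Counting in a power of Z/d *)

Section CyclicCounting.
Local Open Scope set_scope.
Variables (d' : nat).
Local Notation d := d'.+1.
Local Notation Zd := 'I_d.
Implicit Types (x : Zd) (k : nat).

Lemma Zp_muln_eq0 x k : (x *+ k == 0) = (d %| x * k)%N.
Proof. by rewrite Zp_mulrn -val_eqE /=. Qed.

Lemma Zp_muln_ord x : x *+ d = 0.
Proof. by apply/eqP; rewrite Zp_muln_eq0 dvdn_mull. Qed.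

(** The elements killed by k are the multiples of d / k. *)
Lemma card_torsion k : (k %| d)%N -> #|[set x : Zd | x *+ k == 0]| = k.
Proof.
move=> /dvdnP[e de].
have k0 : (0 < k)%N by case: k de => //; rewrite muln0.
have e0 : (0 < e)%N by case: e de.
have lt (j : 'I_k) : (e * j < d)%N by rewrite de ltn_pmul2l.
pose f (j : 'I_k) : Zd := Ordinal (lt j).
have f_inj : injective f.
  by move=> i j /(congr1 val) /= /eqP; rewrite eqn_pmul2l// => /eqP /val_inj.
rewrite -[RHS]card_ord -(card_codom f_inj); apply: eq_card => x.
have dv (j : nat) : (d %| j * k)%N = (e %| j)%N by rewrite de dvdn_pmul2r.
rewrite inE Zp_muln_eq0 dv.
apply/dvdnP/codomP => [[j xj]|[j ->]]; last by exists j; rewrite mulnC.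
have jk : (j < k)%N by rewrite -(ltn_pmul2l e0) [(e * j)%N]mulnC -xj -de ltn_ord.
by exists (Ordinal jk); apply: val_inj; rewrite /= mulnC.
Qed.

Variables (I : finType) (w b : I -> nat).
Hypothesis w_dvd : forall i, (w i %| d)%N.
Hypothesis sum_bw : (\sum_i b i * w i = d)%N.
Let gam := (\big[gcdn/0%N]_i (b i * w i))%N.
Let g := (\big[gcdn/0%N]_i w i)%N.
Local Notation A := {ffun I -> Zd}.

(** The exponent of zeta by which the monomial x^beta is multiplied when each x_i is multiplied by
    zeta^(w_i a_i). *)
Definition weighted_sum (a : A) : Zd := \sum_i a i *+ (b i * w i).
Definition relation_group : {set A} := [set a | weighted_sum a == 0].
(** The twists by a and a' differ by the scalar zeta^l. Only multiples by w_i count, since a_i acts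
    through zeta^(w_i a_i). *)
Definition same_orbit (a a' : A) := [exists l : Zd, [forall i, (a i - a' i - l) *+ w i == 0]].

Lemma weighted_sumD a a' : weighted_sum (a + a') = weighted_sum a + weighted_sum a'.
Proof. by rewrite -big_split; apply: eq_bigr => i _; rewrite ffunE mulrnDl. Qed.

Lemma weighted_sumB a a' : weighted_sum (a - a') = weighted_sum a - weighted_sum a'.
Proof. by rewrite -sumrB; apply: eq_bigr => i _; rewrite !ffunE mulrnBl. Qed.

Lemma big_gcdn_dvd (m : I -> nat) i : (\big[gcdn/0%N]_j m j %| m i)%N.
Proof. by rewrite (bigD1 i)//= dvdn_gcdl. Qed.

Lemma dvdn_big_gcd (m : I -> nat) k : (forall i, k %| m i)%N -> (k %| \big[gcdn/0%N]_j m j)%N.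
Proof. by move=> h; elim/big_ind: _ => // p q hp hq; rewrite dvdn_gcd hp. Qed.

Lemma gam_dvd : (gam %| d)%N.
Proof. by rewrite -sum_bw; apply: dvdn_sum => i _; apply: big_gcdn_dvd. Qed.

Lemma gcd_weight_dvd (i0 : I) : (g %| d)%N.
Proof. exact: dvdn_trans (big_gcdn_dvd w i0) (w_dvd i0). Qed.

Lemma weighted_sum_image x : (gam %| x)%N -> exists a, weighted_sum a = x.
Proof.
move=> /dvdnP[j xj]; have [u Hu] := Bezout_big (fun i => b i * w i)%N (index_enum_uniq I).
pose one : Zd := inZp 1.
have oneE k : (one *+ k : Zd) = inZp k by rewrite Zp_mulrn; apply: val_inj; rewrite /= modnMml mul1n.
exists [ffun i => one *~ (u i * j)].
transitivity (one *~ (\sum_i u i * (b i * w i)%:Z * j)).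
  rewrite mulrz_sumr; apply: eq_bigr => i _; rewrite ffunE pmulrn -mulrzA.
  by congr (_ *~ _); ring.
rewrite -mulr_suml Hu -PoszM -pmulrn oneE; apply: val_inj => /=.
by rewrite -/gam mulnC -xj modn_small.
Qed.

(** By Bezout the image of the homomorphism [weighted_sum] consists of the multiples of [gam], of
    which there are d / gam; its fibres are cosets of the kernel. *)
Lemma card_relation_group : (#|relation_group| * (d %/ gam) = d ^ #|I|)%N.
Proof.
have d0 : (0 < d)%N by [].
pose Im := [set x : Zd | x *+ (d %/ gam) == 0].
have gd := gam_dvd; have g0 : (0 < gam)%N by apply: dvdn_gt0 gd.
have ImE x : (x \in Im) = (gam %| x)%N.
  have h0 : (0 < d %/ gam)%N by rewrite divn_gt0// dvdn_leq.
  rewrite inE Zp_muln_eq0; move: (val x) => k /=.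
  rewrite -[X in (X %| _)%N](divnK gd) [(_ * gam)%N]mulnC; exact: dvdn_pmul2r h0.
have cIm : #|Im| = (d %/ gam)%N by apply: card_torsion; apply: dvdn_div.
rewrite -{1}[d in RHS]card_ord -card_ffun -cIm -[RHS]sum1_card.
rewrite [RHS](partition_big weighted_sum (mem Im)) /=; last first.
  move=> a _; rewrite inE -sumrMnl; apply/eqP/big1 => i _.
  rewrite -mulrnA; have /dvdnP[q /= ->] := big_gcdn_dvd (fun i => b i * w i)%N i.
  by rewrite -mulnA [(_ * (d %/ _))%N]mulnC divnK// mulnC mulrnA Zp_muln_ord mul0rn.
rewrite [RHS](eq_bigr (fun=> #|relation_group|)) ?sum_nat_const 1?mulnC// => x; rewrite ImE => gx.
have [a0 <-] := weighted_sum_image gx.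
rewrite sum1dep_card -[RHS](card_imset _ (addIr a0)); apply: eq_card => a.
rewrite inE; apply/eqP/imsetP => [e|[a1]].
  by exists (a - a0); rewrite ?subrK// inE weighted_sumB e subrr.
by rewrite inE => /eqP h ->; rewrite weighted_sumD h add0r.
Qed.

(** A scalar shift l changes the weighted sum by l times the sum of the b_i w_i, that is by l d =
    0. *)
Lemma same_orbit_relation a a' : same_orbit a a' -> a' \in relation_group -> a \in relation_group.
Proof.
move=> /existsP[l /forallP h]; rewrite !inE => /eqP h'.
rewrite -(subrK a' a) weighted_sumD h' addr0.
have -> : weighted_sum (a - a') = \sum_i l *+ (b i * w i).
  apply: eq_bigr => i _; apply/eqP; rewrite -subr_eq0 -mulrnBl !ffunE mulnC mulrnA.
  by rewrite (eqP (h i)) mul0rn.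
by rewrite sumrMnr sum_bw Zp_muln_ord.
Qed.

(** Pairs (a, l) are counted twice: each l admits w_i choices for every a_i, and for each a in the
    orbit the admissible l form a coset of the g-torsion. *)
Lemma card_same_orbit (i0 : I) a' :
  (#|[set a : A | same_orbit a a']| * g = (\prod_i w i) * d)%N.
Proof.
pose Ker := [set l : Zd | [forall i, l *+ w i == 0]].
have KerE : Ker = [set l : Zd | l *+ g == 0].
  apply/setP => l; rewrite !inE Zp_muln_eq0; apply/forallP/idP => [h|h i].
    rewrite /g (big_morph _ (muln_gcdr l) (muln0 l)).
    by apply: dvdn_big_gcd => i; rewrite -Zp_muln_eq0.
  rewrite Zp_muln_eq0; apply: dvdn_trans h _.
  by rewrite dvdn_mul// big_gcdn_dvd.
have cKer : #|Ker| = g by rewrite KerE card_torsion// (gcd_weight_dvd i0).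
pose X (a : A) (l : Zd) := [forall i, (a i - a' i - l) *+ w i == 0].
transitivity (\sum_l \sum_(a | X a l) 1)%N; last first.
  rewrite (eq_bigr (fun=> \prod_i w i)%N) => [|l _].
    by rewrite sum_nat_const card_ord mulnC.
  pose F i := [pred x : Zd | (x - a' i - l) *+ w i == 0].
  have cF i : #|F i| = w i.
    rewrite -[RHS](card_torsion (w_dvd i)) -[RHS](card_imset _ (addIr (a' i + l))).
    apply: eq_card => x; rewrite inE /= -addrA -opprD; apply/idP/imsetP => [h|[y]].
      by exists (x - (a' i + l)); rewrite ?inE ?subrK.
    by rewrite inE => h ->; rewrite addrK.
  transitivity #|family F|; last by rewrite card_family foldrE big_map big_enum; apply: eq_bigr => i _; apply: cF.
  by rewrite sum1dep_card; apply: eq_card => a; rewrite inE.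
rewrite (exchange_big_dep (fun a => same_orbit a a')) => [|l a _ h] /=; last first.
  by apply/existsP; exists l.
rewrite -sum1_card big_distrl /=; apply: eq_big => [a|a]; rewrite inE//.
move=> /existsP[l0 /forallP h0].
rewrite mul1n -cKer sum1dep_card -[LHS](card_imset _ (addIr l0)); apply: eq_card => l.
rewrite [RHS]inE; apply/imsetP/forallP => [[k]|h].
  rewrite inE => /forallP hk -> i; rewrite opprD addrCA mulrnDl.
  by rewrite mulNrn (eqP (hk i)) oppr0 add0r h0.
exists (l - l0); rewrite ?subrK// inE; apply/forallP => i.
have -> : l - l0 = (a i - a' i - l0) - (a i - a' i - l) by rewrite opprB [RHS]addrC subrKA.
by rewrite mulrnBl (eqP (h0 i)) (eqP (h i)) subrr.
Qed.
End CyclicCounting.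

(** * Roots and roots of unity *)

Section ClosedFieldRoots.
Context {K : numClosedFieldType}.

Lemma power_roots (c : K) N : (0 < N)%N -> c != 0 ->
  exists s : seq K, [/\ uniq s, size s = N & forall x, (x \in s) = (x ^+ N == c)].
Proof.
move=> N0 c0; pose p : {poly K} := 'X^N - c%:P.
have sp : size p = N.+1 by rewrite size_XnsubC.
have [s ps] := closed_field_poly_normal p.
have lp : lead_coef p = 1 by apply/monicP/monicXnsubC.
rewrite lp scale1r in ps.
have rootE x : (x \in s) = (x ^+ N == c).
  by rewrite -root_prod_XsubC -ps /root !hornerE subr_eq0.
exists s; split=> //.
  rewrite -separable_prod_XsubC -ps unlock.
  apply: Pdiv.ClosedField.root_coprimep => x; rewrite /root !hornerE subr_eq0 => /eqP xN.
  rewrite derivB derivC subr0 derivXn hornerMn hornerXn mulrn_eq0 negb_or -lt0n N0 /=.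
  rewrite expf_eq0 negb_and; apply/orP; right; apply/eqP => x0.
  by move: c0; rewrite -xN x0 expr0n eqn0Ngt N0 eqxx.
by have := size_prod_XsubC s id; rewrite -ps sp => -[].
Qed.

Lemma prim_root_exists N : (0 < N)%N -> exists z : K, N.-primitive_root z.
Proof.
move=> N0; have [s [us ss sE]] := power_roots N0 (oner_neq0 K).
have : has N.-primitive_root s.
  apply: has_prim_root; rewrite ?ss//.
  by apply/allP => x; rewrite sE unity_rootE.
by case/hasP => z _ zN; exists z.
Qed.

Lemma power_root_exists (c : K) N : (0 < N)%N -> exists x : K, x ^+ N = c.
Proof.
move=> N0; have [->|c0] := eqVneq c 0; first by exists 0; rewrite expr0n eqn0Ngt N0.
have [s [_ ss sE]] := power_roots N0 c0.
case: s ss sE => [|x s] ss sE; first by rewrite -ss in N0.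
by exists x; apply/eqP; rewrite -sE inE eqxx.
Qed.
End ClosedFieldRoots.

Section RootPower.
Context {K : numClosedFieldType} {d' : nat}.
Local Notation d := d'.+1.
Variable zeta : K.
Hypothesis zeta_prim : d.-primitive_root zeta.
Implicit Types x y : 'I_d.

Definition zpow (x : 'I_d) := zeta ^+ x.

Lemma zpowD x y : zpow (x + y) = zpow x * zpow y.
Proof. by rewrite /zpow -exprD /= -(prim_expr_mod zeta_prim (_ + _)). Qed.

Lemma zpow0 : zpow 0 = 1. Proof. by rewrite /zpow expr0. Qed.

Lemma zpow_neq0 x : zpow x != 0.
Proof.
have h : zeta ^+ d = 1 := prim_expr_order zeta_prim.
rewrite expf_neq0//; apply/eqP => z0; move: h; rewrite z0 expr0n => /eqP.
by rewrite eq_sym oner_eq0.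
Qed.

Lemma zpowMn x k : zpow (x *+ k) = zpow x ^+ k.
Proof. by elim: k => [|k IH]; rewrite ?mulr0n ?zpow0 ?expr0// mulrS zpowD IH exprS. Qed.

Lemma zpow_sum (I : finType) (F : I -> 'I_d) : zpow (\sum_i F i) = \prod_i zpow (F i).
Proof. exact: (big_morph _ zpowD zpow0). Qed.

Lemma zpow_eq1 x : (zpow x == 1) = (x == 0).
Proof.
rewrite /zpow -(prim_order_dvd zeta_prim); apply/idP/eqP => [h|->]; last exact: dvdn0.
by apply: val_inj => /=; apply/eqP; rewrite -(modn_small (ltn_ord x)).
Qed.

Lemma zpow_inj : injective zpow.
Proof.
move=> x y e; apply/eqP; rewrite -subr_eq0 -zpow_eq1.
apply/eqP/(mulIf (zpow_neq0 y)); by rewrite -zpowD subrK mul1r.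
Qed.

Lemma zpow_surj (u : K) : u ^+ d = 1 -> exists x, u = zpow x.
Proof. by move=> /(prim_rootP zeta_prim)[x ->]; exists x. Qed.
End RootPower.

(** * Equations of the singular points *)

Section CriticalPoints.
Context {K : numClosedFieldType}.
Variables (n k d : nat) (w beta : 'I_n.+1 -> nat).
Hypothesis w_gt0 : forall i, (0 < w i)%N.
Hypothesis d_def : d = (\sum_(i < n.+1) w i)%N.
Hypothesis w_dvd : forall i, (w i %| d)%N.
Hypothesis k_range : (1 <= k <= n.+1)%N.
Hypothesis beta_gt0 : forall i : 'I_n.+1, (i < k)%N -> (0 < beta i)%N.
Hypothesis beta_sum : (\sum_(i < n.+1 | (i < k)%N) beta i * w i)%N = d.
Implicit Types (a t : K) (x y : 'rV[K]_n.+1).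

Let F := @hypersurface_family K n.+1 w beta k d.
Let D i := (d %/ w i)%N.
Let mon x : K := \prod_(i < n.+1 | (i < k)%N) x 0 i ^+ beta i.

Lemma degree_gt0 : (0 < d)%N.
Proof. by rewrite d_def (bigD1 ord0)//= addn_gt0 w_gt0. Qed.

Lemma exponent_gt0 i : (0 < D i)%N.
Proof. by rewrite divn_gt0// dvdn_leq// degree_gt0. Qed.

Lemma exponentK i : (D i * w i)%N = d. Proof. exact: divnK. Qed.

(** An index other than 0 means that there are at least two weights, so w_i is strictly smaller than
    their sum d. *)
Lemma exponent_gt1 (i : 'I_n.+1) : i != ord0 -> (1 < D i)%N.
Proof.
move=> i0; have : (w i < d)%N.
  rewrite d_def (bigD1 i)//= -[X in (X < _)%N]addn0 ltn_add2l.
  by rewrite (bigD1 ord0) 1?eq_sym//= addn_gt0 w_gt0.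
by rewrite -{1}(exponentK i) -[X in (X < _)%N]mul1n ltn_pmul2r.
Qed.

Lemma partial_family a x i : partial i (F a) x = (D i)%:R * x 0 i ^+ (D i).-1 +
  (if (i < k)%N then a * ((beta i)%:R * x 0 i ^+ (beta i).-1 *
     \prod_(l < n.+1 | (l < k)%N && (l != i)) x 0 l ^+ beta l) else 0).
Proof.
have xh h l : (h *: delta_mx 0 i + x) 0 l = if l == i then h + x 0 i else x 0 l.
  by rewrite !mxE eqxx andTb; case: eqP => [->|_]; rewrite ?mulr1 ?mulr0 ?add0r.
pose c1 := \sum_(l < n.+1 | l != i) x 0 l ^+ D l.
have sumE h : \sum_l (h *: delta_mx 0 i + x) 0 l ^+ D l = (h + x 0 i) ^+ D i + c1.
  rewrite (bigD1 i)//= xh eqxx; congr (_ + _).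
  by apply: eq_bigr => l /negPf li; rewrite xh li.
pose u : {poly K} := 'X + (x 0 i)%:P.
have u0 : u.[0] = x 0 i by rewrite !hornerE ?add0r.
have uh h : u.[h] = h + x 0 i by rewrite !hornerE.
have du : u^`() = 1 by rewrite derivD derivX derivC addr0.
have u0X r : (u ^+ r).[0] = x 0 i ^+ r by rewrite horner_exp u0.
have uhX h r : (u ^+ r).[h] = (h + x 0 i) ^+ r by rewrite horner_exp uh.
clearbody u.
case: ifPn => ik.
  pose c2 := \prod_(l < n.+1 | (l < k)%N && (l != i)) x 0 l ^+ beta l.
  rewrite (@partial_poly _ _ _ _ _ (u ^+ D i + c1%:P + (a * c2)%:P * u ^+ beta i)).
    rewrite !derivD derivC derivM derivC mul0r add0r addr0 !deriv_exp du !mul1r.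
    rewrite hornerD hornerM !hornerMn !u0X hornerC -/c2 !mulr_natl.
    by rewrite -!mulrA [c2 * _]mulrC.
  move=> h; rewrite /F /hypersurface_family sumE (bigD1 i)//= xh eqxx.
  rewrite [\prod_(l < n.+1 | _) _](_ : _ = c2); last first.
    by apply: eq_bigr => l /andP[_ /negPf li]; rewrite xh li.
  rewrite !hornerD hornerM !uhX !hornerC; ring.
rewrite (@partial_poly _ _ _ _ _ (u ^+ D i + (c1 + a * mon x)%:P)).
  by rewrite derivD derivC addr0 deriv_exp du mul1r hornerMn u0X -mulr_natl addr0.
move=> h; rewrite /F /hypersurface_family sumE.
rewrite [\prod_(l < n.+1 | _) _](_ : _ = mon x); last first.
  by apply: eq_bigr => l lk; rewrite xh; case: eqP => // e; rewrite -e lk in ik.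
by rewrite hornerD uhX hornerC addrA.
Qed.

Lemma mul_partial_family a x (i : 'I_n.+1) : (i < k)%N ->
  x 0 i * partial i (F a) x = (D i)%:R * x 0 i ^+ D i + a * ((beta i)%:R * mon x).
Proof.
move=> ik; rewrite partial_family ik /mon [in RHS](bigD1 i)//=.
have eX m : (0 < m)%N -> x 0 i ^+ m = x 0 i * x 0 i ^+ m.-1 by move=> m0; rewrite -exprS prednK.
rewrite (eX _ (exponent_gt0 i)) (eX _ (beta_gt0 ik)) /=.
move: (x 0 i ^+ (D i).-1) (x 0 i ^+ (beta i).-1) (D i)%:R => u v e; ring.
Qed.

Definition critical a t x := [/\ t != 0, forall i : 'I_n.+1, (k <= i)%N -> x 0 i = 0,
  forall i : 'I_n.+1, (i < k)%N -> x 0 i ^+ D i = (beta i * w i)%:R * t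
  & a * mon x = - (d%:R * t)].

Lemma critical_neq0 a t x : critical a t x -> forall i : 'I_n.+1, (i < k)%N -> x 0 i != 0.
Proof.
move=> [t0 _ h _] i ik; apply/eqP => xi; have := h i ik.
rewrite xi expr0n eqn0Ngt exponent_gt0 /= => /esym/eqP.
by rewrite mulf_eq0 (negPf t0) orbF pnatr_eq0 muln_eq0 !eqn0Ngt beta_gt0// w_gt0.
Qed.

(** Multiplied by x_i, the i-th derivative is D_i x_i^(D_i) + a beta_i x^beta for i < k, which
    suggests t = - a x^beta / d; if t were 0, all coordinates would vanish. *)
Lemma criticalP a x : x != 0 -> (forall i, partial i (F a) x = 0) <-> exists t, critical a t x.
Proof.
have dK : (d%:R : K) != 0 by rewrite pnatr_eq0 -lt0n degree_gt0.
have DK i : ((D i)%:R : K) != 0 by rewrite pnatr_eq0 -lt0n exponent_gt0.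
have dwK i : (d%:R : K) = (D i)%:R * (w i)%:R by rewrite -natrM exponentK.
move=> x0; split=> [h|[t crit] i].
  pose t := - (a * mon x) / d%:R.
  have xk (i : 'I_n.+1) : (k <= i)%N -> x 0 i = 0.
    move=> ki; have := h i; rewrite partial_family ltnNge ki /= addr0 => /eqP.
    by rewrite mulf_eq0 (negPf (DK i)) /= expf_eq0 => /andP[_ /eqP].
  have xi (i : 'I_n.+1) : (i < k)%N -> x 0 i ^+ D i = (beta i * w i)%:R * t.
    move=> ik; have := mul_partial_family a x ik; rewrite h mulr0 => /esym/eqP.
    rewrite addr_eq0 => /eqP e.
    apply: (mulfI (DK i)); rewrite e /t (dwK i) natrM; field.
    by rewrite DK pnatr_eq0 -lt0n w_gt0.
  exists t; split=> //.
    apply/eqP => t0; move: x0; rewrite -[x != 0]/(~~ (x == 0)) => /negP; apply; apply/eqP/rowP => i.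
    rewrite mxE; have [/xi|/xk//] := ltnP i k.
    by rewrite t0 mulr0 => /eqP; rewrite expf_eq0 => /andP[_ /eqP].
  by rewrite /t; field.
have [t0 xk xi am] := crit.
have [ik|ki] := ltnP i k.
  apply: (mulfI (critical_neq0 crit ik)).
  rewrite mul_partial_family// mulr0 xi// [a * _]mulrCA am (dwK i) natrM; ring.
rewrite partial_family ltnNge ki /= addr0 xk// expr0n.
(* An exponent 1 would leave a nonzero constant derivative; as k >= 1, an index i >= k is not 0, so
   this does not occur. *)
have : (1 < D i)%N.
  by apply: exponent_gt1; apply/eqP => i0; move: ki k_range; rewrite i0 leqn0 => /eqP ->.
by case: (D i) => [|[|e]]//= _; rewrite ?mulr0n mulr0.
Qed.

Lemma weighted_scaleE l x i : weighted_scale w l x 0 i = l ^+ w i * x 0 i.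
Proof. by rewrite mxE. Qed.

Lemma weighted_scaleM l l' x : weighted_scale w l (weighted_scale w l' x) = weighted_scale w (l * l') x.
Proof. by apply/rowP => i; rewrite !weighted_scaleE exprMn mulrA. Qed.

Lemma weighted_scale1 x : weighted_scale w 1 x = x.
Proof. by apply/rowP => i; rewrite weighted_scaleE expr1n mul1r. Qed.

Lemma mon_scale l x : mon (weighted_scale w l x) = l ^+ d * mon x.
Proof.
rewrite /mon -beta_sum -prodrXr -big_split /=; apply: eq_bigr => i _.
by rewrite weighted_scaleE exprMn -exprM mulnC.
Qed.

Lemma critical_scale a t l x : l != 0 -> critical a t x ->
  critical a (l ^+ d * t) (weighted_scale w l x).
Proof.
move=> l0 [t0 xk xi am]; split.
- by rewrite mulf_neq0// expf_neq0.
- by move=> i ki; rewrite weighted_scaleE xk// mulr0.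
- move=> i ik; rewrite weighted_scaleE exprMn -exprM [(w i * _)%N]mulnC exponentK xi//.
  by rewrite mulrCA.
- by rewrite mon_scale mulrCA am mulrN; ring.
Qed.

Lemma weighted_orbit_eq x y : weighted_orbit w x y -> weighted_orbit w y = weighted_orbit w x.
Proof.
move=> [l l0 ->]; apply/seteqP; split=> z [l' l'0 ->].
  by exists (l' * l); rewrite ?mulf_neq0// weighted_scaleM.
exists (l' / l); first by rewrite mulf_neq0// invr_eq0.
by rewrite weighted_scaleM divfK.
Qed.

Lemma weighted_orbit_refl x : weighted_orbit w x x.
Proof. by exists 1; rewrite ?oner_eq0// weighted_scale1. Qed.

Lemma critical_point_neq0 a t x : critical a t x -> x != 0.
Proof.
move=> crit; have /andP[k0 _] := k_range.
by apply/eqP => x0; have := @critical_neq0 a t x crit ord0 k0; rewrite x0 mxE eqxx.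
Qed.

Lemma singularitiesP a (p : set 'rV[K]_n.+1) :
  singularities w (F a) p <-> exists2 x, critical a 1 x & p = weighted_orbit w x.
Proof.
split=> [[[x0 x00 ->] h]|[x crit ->]].
  have /criticalP : forall i, partial i (F a) x0 = 0 by apply/h/weighted_orbit_refl.
  move=> /(_ x00)[t crit]; have [t0 _ _ _] := crit.
  have [l ld] := power_root_exists t^-1 degree_gt0.
  have l0 : l != 0.
    apply/eqP => l0; move: ld; rewrite l0 expr0n eqn0Ngt degree_gt0 => /esym/eqP.
    by rewrite invr_eq0 (negPf t0).
  exists (weighted_scale w l x0).
    by have := critical_scale l0 crit; rewrite ld mulVf.
  by rewrite (@weighted_orbit_eq x0)//; exists l.
split; first by exists x => //; apply: critical_point_neq0 crit.
move=> y [l l0 ->]; apply/criticalP; last by exists (l ^+ d * 1); apply: critical_scale.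
exact: (critical_point_neq0 (critical_scale l0 crit)).
Qed.
End CriticalPoints.

(** * The discriminant and the number of singular points *)

Section SingularFibres.
Context {K : numClosedFieldType}.
Variables (n k d' : nat) (w beta : 'I_n.+1 -> nat).
Local Notation d := d'.+1.
Hypothesis w_gt0 : forall i, (0 < w i)%N.
Hypothesis d_def : d = (\sum_(i < n.+1) w i)%N.
Hypothesis w_dvd : forall i, (w i %| d)%N.
Hypothesis k_range : (1 <= k <= n.+1)%N.
Hypothesis beta_gt0 : forall i : 'I_n.+1, (i < k)%N -> (0 < beta i)%N.
Hypothesis beta_sum : (\sum_(i < n.+1 | (i < k)%N) beta i * w i)%N = d.

Let kn : (k <= n.+1)%N. Proof. by case/andP: k_range. Qed.
Let k0 : (0 < k)%N. Proof. by case/andP: k_range. Qed.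
Let wk (i : 'I_k) := w (widen_ord kn i).
Let bk (i : 'I_k) := beta (widen_ord kn i).
Let gam := (\big[gcdn/0%N]_(i < n.+1 | (i < k)%N) (beta i * w i))%N.
Let D i := (d %/ w i)%N.
Let N := (d %/ gam)%N.
Let mon (x : 'rV[K]_n.+1) : K := \prod_(i < n.+1 | (i < k)%N) x 0 i ^+ beta i.
Let crit a x := @critical K n k d w beta a 1 x.
Let C0 : K := \prod_(i < n.+1 | (i < k)%N) (beta i * w i)%:R ^+ (beta i * w i %/ gam).

Let wk_dvd i : (wk i %| d)%N. Proof. exact: w_dvd. Qed.

Let sum_bk : (\sum_i bk i * wk i = d)%N.
Proof. by rewrite -[RHS]beta_sum (big_ord_narrow kn). Qed.

Let gamE : gam = (\big[gcdn/0%N]_i (bk i * wk i))%N.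
Proof. by rewrite /gam (big_ord_narrow kn). Qed.

Let gam_d : (gam %| d)%N. Proof. by rewrite gamE; apply: gam_dvd. Qed.

Let gam_gt0 : (0 < gam)%N. Proof. exact: dvdn_gt0 gam_d. Qed.

Let gam_bw (i : 'I_n.+1) : (i < k)%N -> (gam %| beta i * w i)%N.
Proof. by move=> ik; rewrite /gam (bigD1 i)//= dvdn_gcdl. Qed.

Let NK : (N * gam)%N = d. Proof. exact: divnK. Qed.

Let N_gt0 : (0 < N)%N. Proof. by rewrite divn_gt0// dvdn_leq. Qed.

Let DK i : (D i * w i)%N = d. Proof. exact: divnK. Qed.

Let D_gt0 i : (0 < D i)%N. Proof. by rewrite divn_gt0// dvdn_leq. Qed.

Let dK : (d%:R : K) != 0. Proof. by rewrite pnatr_eq0. Qed.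

Let C0_neq0 : C0 != 0.
Proof.
apply/prodf_neq0 => i ik; rewrite expf_neq0// pnatr_eq0 muln_eq0 negb_or -!lt0n w_gt0 andbT.
exact: beta_gt0.
Qed.

(** Both beta_i N and D_i (beta_i w_i / gam) equal d beta_i / gam, so the N-th power of the monomial
    is determined by the x_i^(D_i). *)
Let mon_power (x : 'rV[K]_n.+1) : (forall i : 'I_n.+1, (i < k)%N -> x 0 i ^+ D i = (beta i * w i)%:R) ->
  mon x ^+ N = C0.
Proof.
move=> xi; rewrite /mon -prodrXl; apply: eq_bigr => i ik.
rewrite -xi// -!exprM; congr (_ ^+ _).
apply/eqP; rewrite -(eqn_pmul2r (w_gt0 i)) -(eqn_pmul2r gam_gt0).
apply/eqP; rewrite -[LHS]mulnA -[RHS]mulnA [LHS]mulnACA NK [RHS]mulnACA DK.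
by rewrite divnK ?gam_bw// mulnC.
Qed.

Let disc_eq a := a ^+ N + (-1) ^+ N.-1 * (d%:R ^+ N / C0) = 0.

Let disc_eqP a : disc_eq a <-> a ^+ N * C0 = (- d%:R) ^+ N.
Proof.
have e : (-1 : K) ^+ N.-1 = - (-1) ^+ N by rewrite -{2}(prednK N_gt0) exprS mulN1r opprK.
rewrite /disc_eq e [(- d%:R) ^+ N]exprNn; split=> [h|h].
  move/eqP: h; rewrite mulNr subr_eq0 => /eqP ->.
  by rewrite -mulrA divfK.
by apply: (mulIf C0_neq0); rewrite mul0r mulrDl h !mulNr -[X in _ - X]mulrA divfK// subrr.
Qed.

Let critical_disc a x : crit a x -> a ^+ N * C0 = (- d%:R) ^+ N.
Proof.
move=> [_ _ xi am]; rewrite -(mon_power (x := x)); last by move=> i ik; rewrite xi// mulr1.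
by rewrite -exprMn am mulr1.
Qed.

Variable zeta : K.
Hypothesis zeta_prim : d.-primitive_root zeta.
Local Notation zp := (zpow zeta).

Let ext (al : {ffun 'I_k -> 'I_d}) (i : 'I_n.+1) : 'I_d :=
  if insub (val i) is Some i' then al i' else 0.

Let ext_widen al i : ext al (widen_ord kn i) = al i.
Proof. by rewrite /ext /= insubT//= => ik; congr (al _); apply: val_inj. Qed.

(** Each coordinate is multiplied by a D_i-th root of unity, since D_i w_i = d. This keeps the
    equations for x_i^(D_i) and moves only the value of the monomial. *)
Let twist (x : 'rV[K]_n.+1) al : 'rV[K]_n.+1 := \row_i (x 0 i * zp (ext al i *+ w i)).

Let twistE x al i : twist x al 0 i = x 0 i * zp (ext al i *+ w i).
Proof. by rewrite mxE. Qed.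

Let mon_twist x al : mon (twist x al) = mon x * zp (weighted_sum wk bk al).
Proof.
rewrite /mon; under eq_bigr => i _ do rewrite twistE exprMn -zpowMn// -mulrnA mulnC.
rewrite big_split /=; congr (_ * _).
rewrite (big_ord_narrow kn) zpow_sum//; apply: eq_bigr => i _.
by rewrite ext_widen.
Qed.

Let twist_power x al i : twist x al 0 i ^+ D i = x 0 i ^+ D i.
Proof.
rewrite twistE exprMn -zpowMn// -mulrnA mulnC DK Zp_muln_ord.
by rewrite zpow0 mulr1.
Qed.

Let twist_critical a (x : 'rV[K]_n.+1) al : (forall i : 'I_n.+1, (k <= i)%N -> x 0 i = 0) ->
  (forall i : 'I_n.+1, (i < k)%N -> x 0 i ^+ D i = (beta i * w i)%:R) ->
  a * mon x * zp (weighted_sum wk bk al) = - d%:R -> crit a (twist x al).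
Proof.
move=> xk xi am; split; first exact: oner_neq0.
- by move=> i ki; rewrite twistE xk// mul0r.
- by move=> i ik; rewrite twist_power mulr1 xi.
- by rewrite -/(mon _) mon_twist mulrA am mulr1.
Qed.

Let disc_critical a : a ^+ N * C0 = (- d%:R) ^+ N -> exists x, crit a x.
Proof.
move=> ha.
have /choice[y hy] (i : 'I_n.+1) : exists y : K, y ^+ D i = (beta i * w i)%:R.
  exact: power_root_exists.
pose x : 'rV[K]_n.+1 := \row_i (if (i < k)%N then y i else 0).
have xk (i : 'I_n.+1) : (k <= i)%N -> x 0 i = 0 by rewrite mxE ltnNge => ->.
have xi (i : 'I_n.+1) : (i < k)%N -> x 0 i ^+ D i = (beta i * w i)%:R.
  by move=> ik; rewrite mxE ik.
have mN := mon_power xi.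
have a0 : a != 0.
  apply/eqP => a0; move: ha; rewrite a0 expr0n eqn0Ngt N_gt0 mul0r => /esym/eqP.
  by rewrite expf_eq0 oppr_eq0 (negPf dK) andbF.
have m0 : mon x != 0.
  apply/eqP => m0; move: C0_neq0; rewrite -mN m0 expr0n eqn0Ngt N_gt0 eqxx.
  by [].
(* The factor still missing from the last critical equation. It is an N-th root of unity, so its
   exponent in zeta is divisible by [gam] and is the weighted sum of some twist. *)
pose eta := - d%:R / (a * mon x).
have etaN : eta ^+ N = 1.
  rewrite /eta expr_div_n exprMn mN -ha divff// mulf_neq0// expf_neq0//.
have etad : eta ^+ d = 1 by rewrite -NK exprM etaN expr1n.
have [e eE] := zpow_surj zeta_prim etad.
have ge : (gam %| e)%N.
  have /eqP : zp (e *+ N) = 1 by rewrite zpowMn// -eE.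
  rewrite zpow_eq1// Zp_muln_eq0 -[X in (X %| _)%N]NK [(N * gam)%N]mulnC.
  by rewrite dvdn_pmul2r.
have [al hal] : exists al, weighted_sum wk bk al = e.
  by apply: weighted_sum_image => //; rewrite -gamE.
exists (twist x al); apply: twist_critical => //.
by rewrite hal -eE /eta mulrC divfK// mulf_neq0.
Qed.

Lemma discriminantE : family_discriminant w (@hypersurface_family K n.+1 w beta k d) =
  [set a : K | disc_eq a].
Proof.
have SP := singularitiesP w_gt0 d_def w_dvd k_range beta_gt0 beta_sum.
apply/seteqP; split=> a /=.
  by move=> [p /SP[x xc _]]; apply/disc_eqP; apply: critical_disc xc.
move/disc_eqP/disc_critical => [x xc]; exists (weighted_orbit w x).
by apply/SP; exists x.
Qed.

Lemma card_discriminant :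
  family_discriminant w (@hypersurface_family K n.+1 w beta k d) #= `I_N.
Proof.
rewrite discriminantE.
have c0 : (- d%:R) ^+ N / C0 != 0 by rewrite mulf_neq0 ?invr_eq0 ?expf_neq0 ?oppr_eq0.
have [s [us ss sE]] := power_roots N_gt0 c0.
have -> : [set a | disc_eq a] = [set a | a \in s].
  apply/seteqP; split=> a /=; rewrite sE.
    by move/disc_eqP => h; apply/eqP; apply: (mulIf C0_neq0); rewrite divfK.
  by move/eqP => h; apply/disc_eqP; rewrite h divfK.
by rewrite -ss; apply: card_eq_seq.
Qed.

(** A scalar l carrying one twist to another has l^(w_i) equal to a D_i-th root of unity, hence l^d
    = 1 and l is a power of zeta. *)
Let orbit_twist a x al al' : crit a x ->
  weighted_orbit w (twist x al') = weighted_orbit w (twist x al) <-> same_orbit wk al' al.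
Proof.
move=> xc; have x0 (i : 'I_k) : x 0 (widen_ord kn i) != 0.
  by apply: (critical_neq0 w_gt0 d_def w_dvd beta_gt0 xc); exact: (ltn_ord i).
have [_ xk xi _] := xc.
split=> [h|/existsP[l /forallP hl]].
  have : weighted_orbit w (twist x al) (twist x al') by rewrite -h; apply: weighted_orbit_refl.
  move=> [l l0 e].
  have li (i : 'I_k) : zp (al' i *+ wk i) = l ^+ wk i * zp (al i *+ wk i).
    have := congr1 (fun M : 'rV[K]_n.+1 => M 0 (widen_ord kn i)) e.
    rewrite weighted_scaleE !twistE !ext_widen [RHS]mulrCA => /(mulfI (x0 i)).
    exact.
  pose i0 : 'I_k := Ordinal k0.
  have ld : l ^+ d = 1.
    have := congr1 (fun u => u ^+ D (widen_ord kn i0)) (li i0).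
    rewrite exprMn -!zpowMn// -!mulrnA -exprM [(wk i0 * _)%N]mulnC DK !Zp_muln_ord.
    by rewrite zpow0 mulr1.
  have [e0 lE] := zpow_surj zeta_prim ld.
  apply/existsP; exists e0; apply/forallP => i.
  have := li i; rewrite lE -zpowMn// -zpowD// => /(zpow_inj zeta_prim) h2.
  by rewrite !mulrnBl h2 addrK subrr.
apply: weighted_orbit_eq; exists (zp l); first exact: zpow_neq0.
apply/rowP => i; rewrite weighted_scaleE !twistE.
have [ik|ki] := ltnP i k; last by rewrite xk// !mul0r mulr0.
have -> : i = widen_ord kn (Ordinal ik) by apply: val_inj.
rewrite !ext_widen mulrCA -zpowMn// -zpowD//; congr (_ * zp _).
move: (hl (Ordinal ik)); rewrite !mulrnBl -addrA -opprD subr_eq0 addrC => /eqP.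
by rewrite addrC.
Qed.

Lemma card_singularities a :
  family_discriminant w (@hypersurface_family K n.+1 w beta k d) a ->
  exists M : nat,
   M%:R = (\big[gcdn/0%N]_(i < n.+1 | (i < k)%N) w i)%:R
          / \prod_(i < n.+1 | (i < k)%N) (w i)%:R * d%:R ^ (k%:Z - 2) * gam%:R :> rat /\
   singularities w (@hypersurface_family K n.+1 w beta k d a) #= `I_M.
Proof.
have SP := singularitiesP w_gt0 d_def w_dvd k_range beta_gt0 beta_sum.
move=> [p0 /SP[x xc _]]; have [_ xk xi am] := xc.
pose i0 : 'I_k := Ordinal k0.
pose H := relation_group d' wk bk.
pose Phi (al : {ffun 'I_k -> 'I_d}) : set 'rV[K]_n.+1 := weighted_orbit w (twist x al).
pose g := (\big[gcdn/0%N]_i wk i)%N.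
pose c := #|[set al | same_orbit wk al (0 : {ffun 'I_k -> 'I_d})]%SET|.
have cw (al : {ffun 'I_k -> 'I_d}) : (#|[set al' | same_orbit wk al' al]%SET| * g = (\prod_i wk i) * d)%N.
  exact: card_same_orbit wk_dvd i0 al.
have cg (al : {ffun 'I_k -> 'I_d}) : #|[set al' | same_orbit wk al' al]%SET| = c.
  have g0 : (0 < g)%N by apply: dvdn_gt0 (gcd_weight_dvd wk_dvd i0).
  by apply/eqP; rewrite -(eqn_pmul2r g0) cw -(cw 0).
have cE : (c * g = (\prod_i wk i) * d)%N by apply: cw.
have c_gt0 : (0 < c)%N.
  have : (0 < c * g)%N by rewrite cE muln_gt0 prodn_gt0//= => i; apply: w_gt0.
  by rewrite muln_gt0 => /andP[].
(* Two twists in [H] give the same point exactly when they are in the same orbit, and all classes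
   have size [c]. *)
have [|M [MH MS]] := @card_image_fibers _ _ H Phi c c_gt0.
  move=> al alH; rewrite -(cg al); apply: eq_card => al'; rewrite !inE.
  apply/andP/idP => [[_ /eqP]|h]; first by move/(orbit_twist _ _ xc).
  split; last by apply/eqP/(orbit_twist _ _ xc).
  by have := same_orbit_relation sum_bk h alH; rewrite inE.
exists M; split; last first.
  rewrite (_ : singularities _ _ = (Phi @` [set al | al \in H])%classic)//.
  apply/seteqP; split=> p.
    move=> /SP[y yc ->].
    have [_ yk yi ym] := yc.
    (* Every singular point of the fibre is a twist of [x]: the ratios of coordinates are D_i-th
       roots of unity, that is powers of zeta^(w_i). *)
    have /choice[al hal] (i : 'I_k) : exists e : 'I_d,
        y 0 (widen_ord kn i) = x 0 (widen_ord kn i) * zp (e *+ wk i).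
      have x0 : x 0 (widen_ord kn i) != 0.
        by apply: (critical_neq0 w_gt0 d_def w_dvd beta_gt0 xc); exact: (ltn_ord i).
      have uD : (y 0 (widen_ord kn i) / x 0 (widen_ord kn i)) ^+ D (widen_ord kn i) = 1.
        rewrite expr_div_n yi ?xi ?mulr1 ?divff//; try exact: (ltn_ord i).
        rewrite pnatr_eq0 muln_eq0 negb_or -!lt0n w_gt0 andbT.
        by apply: beta_gt0; exact: (ltn_ord i).
      have prim := dvdn_prim_root zeta_prim (dvdn_div (wk_dvd i)).
      have wE : (d %/ (d %/ wk i))%N = wk i.
        by rewrite -{1}(DK (widen_ord kn i)) mulKn// D_gt0.
      rewrite wE in prim.
      have [e he] := prim_rootP prim uD.
      have eD : (e < d)%N by apply: leq_trans (ltn_ord e) _; apply: leq_div.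
      exists (Ordinal eD); rewrite zpowMn// /zpow /= exprAC -he mulrC divfK//.
    pose al' := [ffun i => al i]; exists al'; last first.
      congr weighted_orbit; apply/rowP => i; rewrite twistE.
      have [ik|ki] := ltnP i k; last by rewrite xk// yk// mul0r.
      have -> : i = widen_ord kn (Ordinal ik) by apply: val_inj.
      by rewrite ext_widen ffunE -hal.
    rewrite /= inE -(zpow_eq1 zeta_prim).
    have my : mon y = mon x * zp (weighted_sum wk bk al').
      rewrite -mon_twist; congr mon; apply/rowP => i; rewrite twistE.
      have [ik|ki] := ltnP i k; last by rewrite xk// yk// mul0r.
      have -> : i = widen_ord kn (Ordinal ik) by apply: val_inj.
      by rewrite ext_widen ffunE -hal.
    apply/eqP; have amx0 : a * mon x != 0 by rewrite am mulr1 oppr_eq0.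
    by apply: (mulfI amx0); rewrite -mulrA -my mulr1 ym am.
  move=> [al]; rewrite /= inE => /eqP alH <-; apply/SP; exists (twist x al) => //.
  apply: twist_critical => //; first by move=> i ik; rewrite xi// mulr1.
  by rewrite alH zpow0 mulr1 am mulr1.
(* The count without division: for k = 1 the exponent k - 2 is negative, so the factor d^2 stays on
   the left until the passage to the rationals. *)
have main : (M * (\prod_i wk i) * d * d = d ^ k * g * gam)%N.
  have h1 : (#|H| * N = d ^ k)%N.
    by have := card_relation_group (d' := d') sum_bk; rewrite -gamE card_ord.
  transitivity (M * (c * g) * (N * gam))%N; first by rewrite cE NK !mulnA.
  by rewrite -h1 -MH; lia.
have dQ : (d%:R : rat) != 0 by rewrite pnatr_eq0.
have wQ : ((\prod_i wk i)%N%:R : rat) != 0.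
  by rewrite pnatr_eq0 -lt0n prodn_gt0// => i; apply: w_gt0.
rewrite !(big_ord_narrow kn) -natr_prod -[(\prod_(i < k) _)%N]/(\prod_i wk i)%N.
rewrite -[(\big[gcdn/0%N]_(i < k) _)%N]/g expfzDr// -exprnP.
have -> : (d%:R : rat) ^ (- 2%:Z) = (d%:R * d%:R)^-1 by rewrite -exprnN expr2.
have := congr1 (fun m => m%:R : rat) main; rewrite !natrM natrX => mainQ.
apply: (mulIf wQ); apply: (mulIf dQ); apply: (mulIf dQ); rewrite mainQ.
move: (\prod_i wk i)%N%:R wQ => W WQ; move: dQ; move: (d%:R : rat) => e dQ.
by field; rewrite ?WQ ?dQ.
Qed.
End SingularFibres.

Lemma lift_ltn (n k : nat) (j : 'I_n.+1) (i : 'I_n) :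
  (j < k)%N -> (lift j i < k)%N = (i.+1 < k)%N.
Proof. by move=> jk; rewrite /= /bump; case: leqP => ij; lia. Qed.

(** The omitted coordinate j is among the first k, so beyond them a chart has the same variables as
    x_1 = 1, and the same normal form serves for every j. *)
Lemma lift_geq (n k : nat) (j : 'I_n.+1) (i : 'I_n) :
  (j < k)%N -> (k <= i.+1)%N -> lift j i = lift ord0 i.
Proof. by move=> jk ki; apply: val_inj; rewrite /= /bump; case: leqP => ij; lia. Qed.

(** * The germ in an affine chart *)

Section ChartGerm.
Context {K : numClosedFieldType} (KC : complete_numfield K).
Variables (n k d : nat) (w beta : 'I_n.+1 -> nat).
Hypothesis w_gt0 : forall i, (0 < w i)%N.
Hypothesis d_def : d = (\sum_(i < n.+1) w i)%N.
Hypothesis w_dvd : forall i, (w i %| d)%N.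
Hypothesis k_range : (1 <= k <= n.+1)%N.
Hypothesis beta_gt0 : forall i : 'I_n.+1, (i < k)%N -> (0 < beta i)%N.
Hypothesis beta_sum : (\sum_(i < n.+1 | (i < k)%N) beta i * w i)%N = d.
Variables (a t : K) (q : 'rV[K]_n.+1) (j : 'I_n.+1).
Hypothesis q_crit : critical k d w beta a t q.
Hypothesis qj : q 0 j = 1.

Let Y : pred 'I_n := fun i => (i.+1 < k)%N.
Let D i := (d %/ w (lift j i))%N.
Let b i := beta (lift j i).
Let s i : K := (q 0 (lift j i))^-1.
(** The share of x_i in the weighted degree of the monomial; together with [lam0], the share of the
    chart coordinate, these sum to 1. *)
Let lam i : K := (b i * w (lift j i))%:R / d%:R.
(** By the last critical equation this is - a q^beta, the scale of both the monomial and the powers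
    near [q]. *)
Let kappa : K := d%:R * t.
Let lam0 : K := (beta j * w j)%:R / d%:R.

Let d_gt0 : (0 < d)%N. Proof. exact: degree_gt0 w_gt0 d_def. Qed.

Let d0 : (d%:R : K) != 0. Proof. by rewrite pnatr_eq0 -lt0n. Qed.

Let jk : (j < k)%N.
Proof.
have [_ qk _ _] := q_crit; rewrite ltnNge; apply/negP => /qk/eqP.
by rewrite qj oner_eq0.
Qed.

Let t0 : t != 0. Proof. by have [] := q_crit. Qed.

Let Yk i : Y i = (lift j i < k)%N. Proof. by rewrite lift_ltn. Qed.

Let q_neq0 i : Y i -> q 0 (lift j i) != 0.
Proof. by rewrite Yk; apply: (critical_neq0 w_gt0 d_def w_dvd beta_gt0 q_crit). Qed.

Let kappa_div x : kappa * (x / d%:R) = x * t.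
Proof. by rewrite /kappa; field; apply: d0. Qed.

Let lam_sum : \sum_(i | Y i) lam i = 1 - lam0.
Proof.
apply/eqP; rewrite eq_sym subr_eq; apply/eqP.
have /(congr1 (fun m => m%:R / d%:R : K)) := beta_sum.
rewrite divff// natr_sum mulr_suml (bigD1_ord j)//= addrC => <-; congr (_ + _).
by apply: eq_bigl => i; rewrite Yk.
Qed.

Lemma chart_germ_model :
  chart_germ (@hypersurface_family K n.+1 w beta k d a) j q = model Y D b s lam kappa.
Proof.
have [_ qk qD am] := q_crit.
(* As q_j = 1, the critical equation for j reads beta_j w_j t = 1. So the constant 1 coming from x_j
   cancels [kappa * lam0], and the germ has no constant term. *)
have kl0 : kappa * lam0 = 1.
  by rewrite kappa_div -qD// qj expr1n.
apply/funext => y; rewrite /chart_germ /hypersurface_family /model.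
set z := \row_i _.
have zj : z 0 j = 1 by rewrite mxE unlift_none.
have zl i : z 0 (lift j i) = q 0 (lift j i) + y 0 i by rewrite mxE liftK.
(* With s_i = 1 / q_i, the powers of q_i factor out of both the sum and the monomial, where the
   critical equations give their values. *)
have zY i : Y i -> z 0 (lift j i) = q 0 (lift j i) * (1 + s i * y 0 i).
  by move=> Yi; rewrite zl mulrDr mulr1 mulrA divff ?mul1r// q_neq0.
have monE : a * \prod_(i < n.+1 | (i < k)%N) z 0 i ^+ beta i =
    - kappa * \prod_(i | Y i) (1 + s i * y 0 i) ^+ b i.
  rewrite -am -mulrA; congr (_ * _).
  rewrite !(bigD1_ord j)//= zj qj !expr1n !mul1r.
  rewrite [RHS](_ : _ = \prod_(i | Y i) q 0 (lift j i) ^+ b i * \prod_(i | Y i) (1 + s i * y 0 i) ^+ b i).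
    rewrite -big_split/=; apply: eq_big => i; first by rewrite Yk.
    by rewrite -Yk => Yi; rewrite zY// exprMn.
  by congr (_ * _); apply: eq_bigl => i; rewrite Yk.
have sumE : \sum_i z 0 i ^+ (d %/ w i) =
    1 + (\sum_(i | Y i) kappa * lam i * (1 + s i * y 0 i) ^+ D i + \sum_(i | ~~ Y i) y 0 i ^+ D i).
  rewrite (bigD1_ord j)//= zj expr1n (bigID Y)/=; congr (_ + (_ + _)).
    apply: eq_bigr => i Yi; rewrite zY// exprMn qD -?Yk//; congr (_ * _).
    by rewrite /lam kappa_div.
  by apply: eq_bigr => i Yi; rewrite zl qk ?add0r// leqNgt -Yk.
rewrite sumE monE /model_nondeg.
have -> : \sum_(i | Y i) kappa * lam i * (1 + s i * y 0 i) ^+ D i =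
    kappa * (\sum_(i | Y i) lam i * ((1 + s i * y 0 i) ^+ D i - 1) + (1 - lam0)).
  rewrite -lam_sum -big_split mulr_sumr/=; apply: eq_bigr => i _; ring.
rewrite -[X in X + (_ + _) + _]kl0; ring.
Qed.

Let kappa_neq0 : kappa != 0. Proof. exact: mulf_neq0. Qed.

Let s_neq0 i : Y i -> s i != 0. Proof. by move=> Yi; rewrite invr_eq0 q_neq0. Qed.

Let lam_gt0 i : Y i -> 0 < lam i.
Proof. by rewrite Yk => ik; rewrite divr_gt0 ?ltr0n// muln_gt0 beta_gt0// w_gt0. Qed.

Let lam0_gt0 : 0 < lam0.
Proof. by rewrite divr_gt0 ?ltr0n// muln_gt0 beta_gt0// w_gt0. Qed.

Let lamD i : Y i -> lam i * (D i)%:R = (b i)%:R.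
Proof.
move=> _; rewrite /lam mulrAC -natrM -mulnA [(w _ * _)%N]mulnC divnK//.
by rewrite natrM mulfK.
Qed.

Let b_gt0 i : Y i -> (0 < b i)%N. Proof. by rewrite Yk; apply: beta_gt0. Qed.

Let YN i : ~~ Y i = (k <= i.+1)%N. Proof. by rewrite leqNgt. Qed.

Lemma chart_germ_local_equation :
  has_local_equation (chart_germ (@hypersurface_family K n.+1 w beta k d a) j q)
    (normal_form w k d).
Proof.
rewrite chart_germ_model (_ : normal_form w k d = model_normal_form Y D).
  exact: model_local_equation kappa_neq0 s_neq0 lam_gt0 lam0_gt0 lam_sum lamD b_gt0.
apply/funext => y; congr (_ + _); apply: eq_big => i; first by rewrite YN.
by move=> ki; rewrite /D (lift_geq jk).
Qed.

Lemma chart_germ_milnor :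
  is_milnor_number (chart_germ (@hypersurface_family K n.+1 w beta k d a) j q)
    (\prod_(i < n.+1 | (k <= i)%N) (d %/ w i - 1))%N.
Proof.
rewrite chart_germ_model (_ : (\prod_(i < n.+1 | _) _ = \prod_(i | ~~ Y i) (D i - 1))%N).
  apply: model_milnor kappa_neq0 s_neq0 lam_gt0 lam0_gt0 lam_sum lamD b_gt0 _ => i.
  rewrite YN => ki; apply: (exponent_gt1 w_gt0 d_def w_dvd).
  by rewrite (lift_geq jk).
have /andP[k0 _] := k_range.
have kN : (k <= @ord0 n)%N = false by rewrite leqNgt k0.
rewrite big_mkcond big_ord_recl (ifF _ _ kN) Monoid.mul1m [RHS]big_mkcond.
apply: eq_bigr => i _; rewrite YN lift0.
by case: ifP => // ki; rewrite /D (lift_geq jk).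
Qed.
End ChartGerm.

Unset Implicit Arguments.

Theorem lemma6 (R : realType) (n k d gamma : nat) (w beta : 'I_n.+1 -> nat)
  (w_gt0 : forall i, (0 < w i)%N)
  (w_gcd : \big[gcdn/0%N]_(i < n.+1) w i = 1%N)
  (d_def : d = (\sum_(i < n.+1) w i)%N)
  (w_dvd : forall i, (w i %| d)%N)
  (k_range : (1 <= k <= n.+1)%N)
  (beta_gt0 : forall i : 'I_n.+1, (i < k)%N -> (0 < beta i)%N)
  (beta_sum : (\sum_(i < n.+1 | (i < k)%N) beta i * w i)%N = d)
  (gamma_def : gamma = \big[gcdn/0%N]_(i < n.+1 | (i < k)%N) (beta i * w i)%N) :
  let C := complexField R in
  let F : C -> 'rV[C]_n.+1 -> C := hypersurface_family w beta k d in
  [/\ family_discriminant w F =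
        [set a : C | a ^+ (d %/ gamma)
                     + (-1) ^+ (d %/ gamma).-1
                       * (d%:R ^+ (d %/ gamma)
                          / \prod_(i < n.+1 | (i < k)%N)
                              (beta i * w i)%:R ^+ (beta i * w i %/ gamma))
                     = 0],
      family_discriminant w F #= `I_(d %/ gamma)
    & forall a : C, family_discriminant w F a ->
        exists N : nat,
          [/\ N%:R = (\big[gcdn/0%N]_(i < n.+1 | (i < k)%N) w i)%:R
                     / \prod_(i < n.+1 | (i < k)%N) (w i)%:R
                     * d%:R ^ (k%:Z - 2) * gamma%:R :> rat,
              singularities w (F a) #= `I_N
            & forall (p : set 'rV[C]_n.+1) (j : 'I_n.+1) (q : 'rV[C]_n.+1),
                singularities w (F a) p -> p q -> q 0 j = 1 ->
                has_local_equation (chart_germ (F a) j q) (normal_form w k d)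
                /\ is_milnor_number (chart_germ (F a) j q)
                     (\prod_(i < n.+1 | (k <= i)%N) (d %/ w i - 1))%N]].
Proof.
have KC := complexField_complete R.
(* Positive weights exclude d = 0, and a successor is what makes ['I_d] the ring Z/d in the
   counting. *)
case: d => [|d] in d_def w_dvd beta_sum *.
  by move/eqP: d_def; rewrite eq_sym (bigD1 ord0)//= addn_eq0 eqn0Ngt w_gt0.
move=> C F; subst gamma.
have [zeta zeta_prim] := prim_root_exists (K := C) (ltn0Sn d).
split.
- exact: (discriminantE w_gt0 d_def w_dvd k_range beta_gt0 beta_sum zeta_prim).
- exact: (card_discriminant w_gt0 d_def w_dvd k_range beta_gt0 beta_sum zeta_prim).
move=> a /(card_singularities w_gt0 d_def w_dvd k_range beta_gt0 beta_sum zeta_prim).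
move=> [N [NE NS]]; exists N; split=> // p j q [_ crit] pq qj.
have q0 : q != 0 by apply/eqP => q0; move/eqP: qj; rewrite q0 mxE eq_sym oner_eq0.
have /(criticalP w_gt0 d_def w_dvd k_range beta_gt0 a q0)[t q_crit] := crit q pq.
split.
  exact: (chart_germ_local_equation KC w_gt0 d_def w_dvd beta_gt0 beta_sum q_crit qj).
exact: (chart_germ_milnor KC w_gt0 d_def w_dvd k_range beta_gt0 beta_sum q_crit qj).
Qed.
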